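(* Let $V\in L^1_{loc}(\Omega)$, let $h\in L^1_{loc}(\Omega)$ with $h\ge 0$, and let $\Phi\in L^1_{loc}(\Omega)$ satisfy $\Phi\ge 0$, $\Phi\not\equiv 0$, $V\Phi\in L^1_{loc}(\Omega)$ and $-\Delta\Phi+V\Phi\ge h$ in $\mathcal D'(\Omega)$. Then $$Q_V(\xi)\ \ge\ \int_\Omega \Big(\frac{h}{\Phi}\Big)\,\xi^2\,dx\qquad\text{for all }\xi\in W^{1,\infty}_c(\Omega).$$ In particular, $h/\Phi\in L^1_{loc}(\Omega)$.
   Context: $\Omega$ is a domain (nonempty connected open set) in $\mathbb R^N$, $N\ge1$. $W^{1,\infty}_c(\Omega)$ is the space of Lipschitz continuous functions with compact support in $\Omega$, and for $V\in L^1_{loc}(\Omega)$, $Q_V(\xi)=\int_\Omega\{|\nabla\xi|^2+V\xi^2\}\,dx$ for $\xi\in W^{1,\infty}_c(\Omega)$. The inequality $-\Delta\Phi+V\Phi\ge h$ in $\mathcal D'(\Omega)$ means $\int_\Omega\Phi(-\Delta\xi+V\xi)\,dx\ge\int_\Omega h\xi\,dx$ for all $0\le\xi\in C^\infty_c(\Omega)$. By the (known) strong maximum principle of Ancona and Brezis--Ponce such a $\Phi$ is positive a.e. in $\Omega$, so the quotient $h/\Phi$ is well defined a.e. *)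

(* Defs.v *)
From HB Require Import structures.
From mathcomp Require Import all_boot all_order all_algebra.
From mathcomp Require Import all_classical all_reals all_analysis.

Set Implicit Arguments.
Unset Strict Implicit.
Unset Printing Implicit Defensive.
Import Order.TTheory GRing.Theory Num.Theory.
Import numFieldNormedType.Exports.

Local Open Scope classical_set_scope.
Local Open Scope ring_scope.

(* R^n is 'rV[R]_n, with the topology and normed module structure of
   MathComp-Analysis (its norm is the sup norm, which only matters up to
   equivalence below). Its sigma-algebra is the one generated by the
   coordinates, that is, the Borel sigma-algebra of R^n. *)
Definition rV_display : measure_display.
Proof. exact: default_measure_display. Qed.

Section measurable_rV.
Context {R : realType} (n : nat).

Definition coord_rV (i : 'I_n) (x : 'rV[R]_n) : measurableTypeR R := x ord0 i.

Let rV_set0 : g_sigma_preimage coord_rV set0.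
Proof. exact: sigma_algebra0. Qed.

Let rV_setC A : g_sigma_preimage coord_rV A -> g_sigma_preimage coord_rV (~` A).
Proof. exact: sigma_algebraC. Qed.

Let rV_bigcup (F : (set 'rV[R]_n)^nat) :
  (forall i, g_sigma_preimage coord_rV (F i)) ->
  g_sigma_preimage coord_rV (\bigcup_i F i).
Proof. exact: sigma_algebra_bigcup. Qed.

HB.instance Definition _ := @isMeasurable.Build rV_display 'rV[R]_n
  (g_sigma_preimage coord_rV) rV_set0 rV_setC rV_bigcup.

End measurable_rV.

Section lebesgue_rV.
Context {R : realType}.
Local Open Scope ereal_scope.

Lemma measurable_coord_rV n (i : 'I_n) :
  measurable_fun [set: 'rV[R]_n] (coord_rV i).
Proof.
move=> _ Y mY; rewrite setTI; apply: sub_sigma_algebra => /=.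
rewrite -bigcup_seq/=; exists i => /=; first by rewrite mem_index_enum.
by exists Y => //; rewrite setTI.
Qed.

Lemma measurable_fun_rVP d (T : measurableType d) n (f : T -> 'rV[R]_n) :
  (forall i, measurable_fun [set: T] (coord_rV i \o f)) ->
  measurable_fun [set: T] f.
Proof.
move=> mf _ A mA; rewrite setTI; move: A mA.
suff : g_sigma_preimage (@coord_rV R n) `<=` image_set_system setT f measurable.
  by move=> sub A /sub; rewrite /image_set_system /= setTI.
apply: smallest_sub.
  exact/sigma_algebra_image/sigma_algebra_measurable.
rewrite -bigcup_seq; apply: bigcup_sub => i _ A [B mB <-].
by rewrite /image_set_system /= !setTI -[X in measurable X]setTI; exact: mf.
Qed.

(* the identification of R * R^n with R^(n+1) *)
Definition cons_rV n (p : measurableTypeR R * 'rV[R]_n) : 'rV[R]_n.+1 :=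
  \row_i (if unlift ord0 i is Some j then p.2 ord0 j else p.1).

Lemma measurable_cons_rV n : measurable_fun setT (@cons_rV n).
Proof.
apply: measurable_fun_rVP => i; rewrite /comp /coord_rV /cons_rV.
case: (unliftP ord0 i) => [j|] ->.
- rewrite (_ : (fun _ => _) = coord_rV j \o snd).
    by apply: measurableT_comp => //; exact: measurable_coord_rV.
  by apply/funext => p; rewrite mxE liftK.
- rewrite (_ : (fun _ => _) = fst); first exact: measurable_fst.
  by apply/funext => p; rewrite mxE unlift_none.
Qed.

Section cons_measure.
Variables (n : nat) (mu : {sigma_finite_measure set 'rV[R]_n -> \bar R}).

Definition cons_measure : set 'rV[R]_n.+1 -> \bar R :=
  pushforward (@lebesgue_measure R \x mu) (@cons_rV n).

Let cons_measure0 : cons_measure set0 = 0.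
Proof. by rewrite /cons_measure /pushforward preimage_set0 measure0. Qed.

Let mpreimage A : measurable A -> measurable (@cons_rV n @^-1` A).
Proof.
by move=> mA; rewrite -[X in measurable X]setTI; exact: measurable_cons_rV.
Qed.

Let cons_measure_ge0 A : 0 <= cons_measure A.
Proof. by rewrite /cons_measure /pushforward; exact: measure_ge0. Qed.

Let cons_measure_sigma_additive : semi_sigma_additive cons_measure.
Proof.
move=> F mF tF mUF; rewrite /cons_measure /pushforward preimage_bigcup.
apply: measure_semi_sigma_additive.
- by move=> k; exact: mpreimage.
- apply/trivIsetP => /= i j _ _ ij; rewrite -preimage_setI.
  by move/trivIsetP : tF => /(_ _ _ _ _ ij) ->//; rewrite preimage_set0.
- by rewrite -preimage_bigcup; exact: mpreimage.
Qed.

HB.instance Definition _ := isMeasure.Build _ _ _ cons_measure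
  cons_measure0 cons_measure_ge0 cons_measure_sigma_additive.

Let uncons (x : 'rV[R]_n.+1) : measurableTypeR R * 'rV[R]_n :=
  (x ord0 ord0, \row_j x ord0 (lift ord0 j)).

Let measurable_uncons : measurable_fun setT uncons.
Proof.
apply/measurable_fun_pairP; split; first exact: (measurable_coord_rV ord0).
apply: measurable_fun_rVP => i.
rewrite (_ : _ \o _ = coord_rV (lift ord0 i)); first exact: measurable_coord_rV.
by apply/funext => x; rewrite /coord_rV /= mxE.
Qed.

Let uncons_cons p : uncons (cons_rV p) = p.
Proof.
case: p => a x; rewrite /uncons /cons_rV mxE unlift_none; congr pair.
by apply/rowP => j; rewrite !mxE liftK.
Qed.

Let cons_measure_sigma_finite : sigma_finite setT cons_measure.
Proof.
have /sigma_finiteP[F [TF ndF Foo]] := sigma_finiteT (@lebesgue_measure R).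
have /sigma_finiteP[G [TG ndG Goo]] := sigma_finiteT mu.
exists (fun k => uncons @^-1` (F k `*` G k)).
  rewrite -preimage_bigcup (_ : \bigcup_k _ = setT) ?preimage_setT//.
  rewrite -subTset => -[a x] _.
  have : [set: measurableTypeR R] a by [].
  have : [set: 'rV[R]_n] x by [].
  rewrite {1}TF {1}TG => -[k _ Gx] [l _ Fa]; exists (maxn k l) => //; split.
  - by move: a Fa; exact/subsetPset/ndF/leq_maxr.
  - by move: x Gx; exact/subsetPset/ndG/leq_maxl.
move=> k; have [mF Fk] := Foo k; have [mG Gk] := Goo k.
have mFG := measurableX mF mG; split.
  by rewrite -[X in measurable X]setTI; exact: measurable_uncons.
rewrite /cons_measure /pushforward -comp_preimage.
rewrite (_ : uncons \o _ = id); last first.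
  by apply/funext => p; exact: uncons_cons.
by rewrite preimage_id product_measure1E// lte_mul_pinfty// ge0_fin_numE.
Qed.

HB.instance Definition _ := Measure_isSigmaFinite.Build _ _ _ cons_measure
  cons_measure_sigma_finite.

End cons_measure.

(* Lebesgue measure on R^n, by iterated products with the one-dimensional
   Lebesgue measure *)
Fixpoint lebesgue_rV n : {sigma_finite_measure set 'rV[R]_n -> \bar R} :=
  if n is m.+1 then cons_measure (lebesgue_rV m) else \d_(0%R : 'rV[R]_0).

Lemma lebesgue_rV_box n (A : 'I_n -> set (measurableTypeR R)) :
  (forall i, measurable (A i)) ->
  lebesgue_rV n [set x | forall i, A i (x ord0 i)] =
  \prod_(i < n) lebesgue_measure (A i).
Proof.
elim: n A => [|n ih] A mA.
  by rewrite big_ord0 /= diracE mem_set// => -[].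
rewrite big_ord_recl /= -ih//.
rewrite /cons_measure /pushforward.
rewrite (_ : _ @^-1` _ = A ord0 `*`
    [set x : 'rV[R]_n | forall i, A (lift ord0 i) (x ord0 i)]); last first.
  apply/seteqP; split => -[a x] /=.
    move=> Ax; split; first by have := Ax ord0; rewrite mxE unlift_none.
    by move=> i; have := Ax (lift ord0 i); rewrite mxE liftK.
  by move=> [A0 Ax] i; rewrite mxE; case: (unliftP ord0 i) => [j|] ->.
rewrite product_measure1E//.
rewrite (_ : [set _ | _] = \big[setI/setT]_(i < n)
  (coord_rV i @^-1` A (lift ord0 i))); last first.
  rewrite -bigcap_seq; apply/seteqP; split => x /=; first by move=> + i _; exact.
  by move=> + i; apply => /=; rewrite mem_index_enum.
elim/big_ind : _ => //; first by move=> *; exact: measurableI.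
move=> i _; rewrite -[X in measurable X]setTI.
exact: measurable_coord_rV.
Qed.

End lebesgue_rV.

Section calculus.
Context {R : realType} {n : nat}.
Implicit Types (Omega : set 'rV[R]_n) (f : 'rV[R]_n -> R).

Let mu := @lebesgue_rV R n.

Definition partial (i : 'I_n) f : 'rV[R]_n -> R :=
  fun x => 'D_(delta_mx ord0 i) f x.

(* |grad f|^2; for Lipschitz f the partial derivatives exist almost everywhere
   (Rademacher) and coincide with the weak ones *)
Definition grad_sq f : 'rV[R]_n -> R :=
  fun x => \sum_(i < n) partial i f x ^+ 2.

Definition laplacian f : 'rV[R]_n -> R :=
  fun x => \sum_(i < n) partial i (partial i f) x.

(* all iterated partial derivatives exist and are continuous *)
Definition smooth f := forall s : seq 'I_n,
  continuous (foldr partial f s) /\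
  forall (i : 'I_n) x, derivable (foldr partial f s) x (delta_mx ord0 i).

Definition domain Omega := [/\ Omega !=set0, open Omega & connected Omega].

(* Functions on Omega with compact support in Omega are represented by their
   extension by 0 to R^n. *)
Definition compact_support_in Omega f :=
  compact (closure [set x | f x != 0]) /\
  closure [set x | f x != 0] `<=` Omega.

Definition Cc_infty Omega f := smooth f /\ compact_support_in Omega f.

Definition W1infty_c Omega f :=
  [lipschitz f x | x in Omega] /\ compact_support_in Omega f.

Definition L1loc Omega f :=
  measurable_fun Omega f /\
  forall K : set 'rV[R]_n, compact K -> K `<=` Omega ->
    mu.-integrable K (EFin \o f).

Definition quadratic_form Omega (V xi : 'rV[R]_n -> R) : \bar R :=
  (\int[mu]_(x in Omega) (grad_sq xi x + V x * xi x ^+ 2)%:E)%E.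

(* - Laplacian Phi + V Phi >= h in the sense of distributions *)
Definition distr_supersolution Omega (V h Phi : 'rV[R]_n -> R) :=
  forall xi, Cc_infty Omega xi -> (forall x, 0 <= xi x) ->
  (\int[mu]_(x in Omega) (h x * xi x)%:E <=
   \int[mu]_(x in Omega) (Phi x * (- laplacian xi x + V x * xi x))%:E)%E.

End calculus.

(* Main.v *)
Require Import Defs.
From HB Require Import structures.
From mathcomp Require Import all_boot all_order all_algebra.
From mathcomp Require Import all_classical all_reals all_analysis.
From mathcomp Require Import measurable_realfun ring lra.
Set Implicit Arguments.
Unset Strict Implicit.
Unset Printing Implicit Defensive.
Import Order.TTheory GRing.Theory Num.Theory.
Import numFieldNormedType.Exports.
Local Open Scope classical_set_scope.
Local Open Scope ring_scope.

(* Extend Phi, h, V Phi by 0 outside a compact neighbourhood of the support of xi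
   and mollify: w = e + Phi * k_d satisfies - Delta w + (V Phi) * k_d >= h * k_d on
   the support of xi. Testing with xi^2 / w and completing the square gives
     int (h * k_d) xi^2 / w <= int |grad xi|^2 + int ((V Phi) * k_d) xi^2 / w,
   and d -> 0, then e -> 0 yields the inequality once Phi > 0 almost everywhere.
   For this strong maximum principle, the same test, keeping half of the square,
   bounds xi |grad w| / w in L^2 independently of e; dividing log (1 + Phi / e) by
   log (1 / e) and letting e -> 0, the indicator of {Phi <> 0} has zero
   distributional gradient, so it is locally almost everywhere constant, and the
   connectedness of Omega concludes. *)

(** The distributional inequality may be tested only with smooth functions, while [xi] is merely
    Lipschitz and [Phi] merely locally integrable. Translates of the kernel are admissible test
    functions, and they turn the inequality into a pointwise one between mollified functions, which
    may then be multiplied by any nonnegative Lipschitz function. The constant [e] keeps [w] away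
    from 0, so that [xi ^+ 2 / w] is Lipschitz; the existence almost everywhere of each single
    partial derivative is then enough to integrate by parts. The order of the limits matters: for
    fixed [e] the quotients are bounded, so convergence in L1 suffices for d -> 0; for e -> 0 the
    potential term is dominated by |V| xi^2, because Phi / (Phi + e) <= 1. Its limit is V xi^2 only
    where Phi is nonzero, and this is where positivity enters. In the strong maximum principle, log
    (1 + Phi / e) / log (1 / e) tends to 1 where Phi > 0 and to 0 where Phi = 0, while its gradient
    is a bounded quantity divided by log (1 / e). *)

Lemma rV_norm_leP (R : realType) n (x : 'rV[R]_n) (r : R) : 0 <= r ->
  `|x| <= r <-> forall i, `|x ord0 i| <= r.
Proof.
move=> r0; rewrite {1}/Num.norm/= mx_normrE; split.
  move=> /bigmax_leP[_ H] i; exact: (H (ord0, i)).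
by move=> H; apply/bigmax_leP; split => //= -[i j] _ /=; rewrite (ord1 i).
Qed.

Lemma rV_norm_ltP (R : realType) n (x : 'rV[R]_n) (r : R) : 0 < r ->
  `|x| < r <-> forall i, `|x ord0 i| < r.
Proof.
move=> r0; rewrite {1}/Num.norm/= mx_normrE; split.
  move=> /bigmax_ltP[_ H] i; exact: (H (ord0, i)).
by move=> H; apply/bigmax_ltP; split => //= -[i j] _ /=; rewrite (ord1 i).
Qed.

Lemma rV_coord_le (R : realType) n (x : 'rV[R]_n) i : `|x ord0 i| <= `|x|.
Proof. by move: i; apply/rV_norm_leP. Qed.

Lemma rV_ballE (R : realType) n (x : 'rV[R]_n) r :
  ball x r = [set y | `|x - y| < r].
Proof. by rewrite mx_norm_ball. Qed.

(** * Topological sets and continuous functions are measurable in R^n *)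

Section borel.
Context {R : realType} {n : nat}.
Local Notation E := 'rV[R]_n.

Lemma measurable_rV_ball (x : E) r : measurable (ball x r : set E).
Proof.
rewrite rV_ballE; have [r0|r0] := ltP 0 r; last first.
  rewrite (_ : [set _ | _] = set0); first exact: measurable0.
  by apply/seteqP; split => y //=; rewrite ltNge (le_trans r0).
rewrite (_ : [set _ | _] =
  \bigcap_(i in [set: 'I_n]) (coord_rV i @^-1` [set t | `|x ord0 i - t| < r])).
  apply: fin_bigcap_measurable => //= i _.
  rewrite -[X in measurable X]setTI.
  apply: measurable_coord_rV => //.
  rewrite (_ : [set _ | _] = ball (x ord0 i) r) //.
  exact: measurable_ball.
apply/seteqP; split => y /=.
  by move=> /(rV_norm_ltP _ r0) H i _ /=; have := H i; rewrite /coord_rV !mxE.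
move=> H; apply/(rV_norm_ltP _ r0) => i.
by have := H i I; rewrite /= /coord_rV !mxE.
Qed.

Lemma rV_rat_approx (x : E) (e : R) : 0 < e ->
  exists q : 'rV[rat]_n, `|x - map_mx ratr q| < e.
Proof.
move=> e0.
have H (i : 'I_n) : exists q : rat, `|x ord0 i - ratr q| < e.
  have [q _] : exists2 q : rat, True & ratr q \in `](x ord0 i - e), (x ord0 i + e)[.
    have [|q] := @rat_in_itvoo R (x ord0 i - e) (x ord0 i + e).
      by rewrite ltrD2l gtrN.
    by exists q.
  rewrite in_itv/= => /andP[a b]; exists q.
  by rewrite ltr_distlC; apply/andP; split.
have [f fP] := choice H.
exists (\row_i f i); apply/(rV_norm_ltP _ e0) => i.
by rewrite !mxE.
Qed.

(** The sigma-algebra is generated by the coordinates. A ball of the sup norm is a finite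
    intersection of coordinate preimages, and an open set is the union of the countably many balls
    with rational centre and radius [k.+1%:R^-1] that it contains. *)
Lemma open_measurable_rV (U : set E) : open U -> measurable U.
Proof.
move=> oU.
pose B (p : 'rV[rat]_n * nat) : set E :=
  ball (map_mx (@ratr R) p.1) p.2.+1%:R^-1.
rewrite (_ : U = \bigcup_(p in [set p | B p `<=` U]) B p).
  rewrite bigcup_mkcond; apply: countable_bigcupT_measurable => // p.
  by case: ifP => _; [exact: measurable_rV_ball|exact: measurable0].
apply/seteqP; split; last by move=> x [p pU]; exact: pU.
move=> x Ux.
have /nbhs_ballP[e /= e0 eU] : nbhs x U by rewrite nbhsE/=; exists U.
have [k k0] : exists k : nat, k.+1%:R^-1 < e / 2.
  have e20 : 0 < e / 2 by rewrite divr_gt0.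
  have [k _ H] := near_infty_natSinv_lt (PosNum e20).
  by exists k; apply: H => /=.
have [q qx] : exists q : 'rV[rat]_n, `|x - map_mx ratr q| < k.+1%:R^-1.
  by apply: rV_rat_approx; rewrite invr_gt0.
exists (q, k); last by rewrite /B /= rV_ballE /= distrC.
move=> y; rewrite /B /= rV_ballE /= => yq; apply: eU; rewrite rV_ballE /=.
have -> : x - y = (x - map_mx ratr q) + (map_mx ratr q - y).
  by rewrite addrA subrK.
apply: le_lt_trans (ler_normD _ _) _.
by rewrite (splitr e) ltrD// (lt_trans _ k0).
Qed.

Lemma closed_measurable_rV (U : set E) : closed U -> measurable U.
Proof.
by move=> cU; rewrite -(setCK U); apply: measurableC; apply: open_measurable_rV; exact: closed_openC.
Qed.

Lemma compact_measurable_rV (U : set E) : compact U -> measurable U.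
Proof. by move=> cU; apply: closed_measurable_rV; apply: compact_closed => //; exact: norm_hausdorff. Qed.

Lemma continuous_measurable_rV (f : E -> R) : continuous f -> measurable_fun setT f.
Proof.
move=> cf; apply: (measurability _ (RGenOpens.measurableE R)) => //.
move=> _ [_ [a [b ->] <-]]; rewrite setTI.
by apply: open_measurable_rV; apply: open_comp.
Qed.

End borel.

(** * Translation invariance of Lebesgue measure; measures of bounded and of open sets *)

Section translation.
Context {R : realType}.

Lemma lebesgue_measure_shift (a : R) (A : set (measurableTypeR R)) :
  measurable A ->
  lebesgue_measure ((fun t => t + a : measurableTypeR R) @^-1` A) =
  lebesgue_measure A.
Proof.
move=> mA.
have mf : measurable_fun setT (fun t : measurableTypeR R => t + a : measurableTypeR R).
  by apply: measurable_funD.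
pose f : {mfun measurableTypeR R >-> measurableTypeR R} :=
  HB.pack (fun t : measurableTypeR R => t + a : measurableTypeR R)
    (isMeasurableFun.Build _ _ _ _ _ mf).
rewrite -/(pushforward lebesgue_measure f A).
apply/esym/lebesgue_measure_unique => //= _ [[b c]] _ <-.
rewrite /pushforward (_ : _ @^-1` _ = `]b - a, c - a]%classic).
  rewrite !lebesgue_measure_itv/= !lte_fin ltrD2r; case: ifP => // _.
  by rewrite -!EFinD; congr EFin; ring.
by apply/seteqP; split => t /=; rewrite !in_itv/= ltrBlDr lerBrDr.
Qed.

Lemma measurable_shift_rV n (v : 'rV[R]_n) :
  measurable_fun setT (fun x : 'rV[R]_n => x + v).
Proof.
apply: measurable_fun_rVP => i.
rewrite (_ : _ \o _ = fun x => coord_rV i x + v ord0 i).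
  by apply: measurable_funD => //; exact: measurable_coord_rV.
by apply/funext => x; rewrite /coord_rV /= mxE.
Qed.

(** By induction on the dimension: a shift of R^(n+1) is a shift of R times a shift of R^n, and
    uniqueness of the product measure reduces the claim to rectangles, where the one-dimensional
    case and the induction hypothesis apply factor by factor. *)
Lemma lebesgue_rV_shift n (v : 'rV[R]_n) (A : set 'rV[R]_n) : measurable A ->
  lebesgue_rV n ((fun x => x + v) @^-1` A) = lebesgue_rV n A.
Proof.
elim: n v A => [|n ih] v A mA.
  by congr (lebesgue_rV 0 _); apply/seteqP; split => x /=; rewrite [v]thinmx0 addr0.
rewrite /= /cons_measure /pushforward.
pose v' : 'rV[R]_n := \row_j v ord0 (lift ord0 j).
pose sh (p : measurableTypeR R * 'rV[R]_n) : measurableTypeR R * 'rV[R]_n :=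
  (p.1 + v ord0 ord0, p.2 + v').
have msh : measurable_fun setT sh.
  apply/measurable_fun_pairP; split => /=.
    by apply: measurable_funD => //; exact: measurable_fst.
  by apply: (measurableT_comp (measurable_shift_rV v')); exact: measurable_snd.
rewrite (_ : _ @^-1` _ = sh @^-1` (@cons_rV R n @^-1` A)); last first.
  apply/seteqP; split => -[a x] /=; congr (A _); apply/rowP => i; rewrite !mxE;
  by case: (unliftP ord0 i) => [j|] -> //=; rewrite ?mxE.
have mA' : measurable (@cons_rV R n @^-1` A).
  by rewrite -[X in measurable X]setTI; exact: measurable_cons_rV.
pose f : {mfun (measurableTypeR R * 'rV[R]_n)%type >-> (measurableTypeR R * 'rV[R]_n)%type} :=
  HB.pack sh (isMeasurableFun.Build _ _ _ _ _ msh).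
apply/esym.
apply: (@product_measure_unique _ _ _ _ _ lebesgue_measure (lebesgue_rV n)
  (pushforward (lebesgue_measure \x lebesgue_rV n)%E f)) => //.
move=> B C mB mC.
transitivity ((lebesgue_measure \x lebesgue_rV n)%E
  (((fun t => t + v ord0 ord0 : measurableTypeR R) @^-1` B) `*` ((fun x => x + v') @^-1` C))) => //.
have mB' : measurable ((fun t => t + v ord0 ord0 : measurableTypeR R) @^-1` B).
  rewrite -[X in measurable X]setTI.
  by apply: (_ : measurable_fun setT (fun t : measurableTypeR R => t + v ord0 ord0 : measurableTypeR R)) => //; exact: measurable_funD.
have mC' : measurable ((fun x => x + v') @^-1` C).
  by rewrite -[X in measurable X]setTI; exact: measurable_shift_rV.
rewrite product_measure1E//; congr (_ * _)%E; last exact: ih.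
exact: lebesgue_measure_shift.
Qed.

Section n.
Variable n : nat.
Local Notation E := 'rV[R]_n.
Local Notation mu := (@lebesgue_rV R n).

Lemma ge0_integral_shift_rV (v : E) (f : E -> \bar R) :
  measurable_fun setT f -> (forall x, 0 <= f x)%E ->
  (\int[mu]_x f (x + v)%R = \int[mu]_x f x)%E.
Proof.
move=> mf f0.
have := @ge0_integral_pushforward _ _ E E R _ (measurable_shift_rV v) mu setT f
  measurableT mf (fun x _ => f0 x).
rewrite preimage_setT => <-.
pose g : {mfun E >-> E} := HB.pack (fun x : E => x + v)
  (isMeasurableFun.Build _ _ _ _ _ (measurable_shift_rV v)).
rewrite -[LHS]/(\int[pushforward mu g]_x f x)%E.
by apply: eq_measure_integral => A mA _; exact: lebesgue_rV_shift.
Qed.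

Lemma integral_shift_rV (v : E) (f : E -> \bar R) : measurable_fun setT f ->
  (\int[mu]_x f (x + v)%R = \int[mu]_x f x)%E.
Proof.
move=> mf; rewrite [LHS]integralE [RHS]integralE.
congr (_ - _)%E.
  have H x : (0 <= f^\+ x)%E by [].
  rewrite -[RHS](ge0_integral_shift_rV v (measurable_funepos mf) H).
  by apply: eq_integral => x _; rewrite !funeposE.
have H x : (0 <= f^\- x)%E by [].
rewrite -[RHS](ge0_integral_shift_rV v (measurable_funeneg mf) H).
by apply: eq_integral => x _; rewrite !funenegE.
Qed.

Lemma integrable_shift_rV (v : E) (f : E -> \bar R) :
  mu.-integrable setT f -> mu.-integrable setT (fun x => f (x + v)).
Proof.
move=> /integrableP[mf foo]; apply/integrableP; split.
  by apply: (measurableT_comp mf); exact: measurable_shift_rV.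
by rewrite (integral_shift_rV v (f := fun x => `|f x|%E))//; exact: measurableT_comp.
Qed.

Lemma measurable_rV_box (A : 'I_n -> set (measurableTypeR R)) :
  (forall i, measurable (A i)) -> measurable [set x : E | forall i, A i (x ord0 i)].
Proof.
move=> mA; rewrite (_ : [set _ | _] = \bigcap_(i in [set: 'I_n]) (coord_rV i @^-1` A i)).
  apply: fin_bigcap_measurable => //= i _.
  by rewrite -[X in measurable X]setTI; exact: measurable_coord_rV.
by apply/seteqP; split => x /= H i; [move=> _|]; exact: H.
Qed.

Lemma bounded_lebesgue_rV_fin (A : set E) (M : R) : measurable A ->
  (forall x, A x -> `|x| <= M) -> (mu A < +oo)%E.
Proof.
move=> mA AM.
have mI : measurable [set x : E | forall i, `[- M, M]%classic (x ord0 i)].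
  exact: (measurable_rV_box (A := fun=> `[- M, M]%classic)).
apply: (@le_lt_trans _ _ (mu [set x : E | forall i, `[- M, M]%classic (x ord0 i)])).
  apply: le_measure; rewrite ?inE// => x Ax i /=.
  by rewrite in_itv/= -ler_norml (le_trans (rV_coord_le _ _))// AM.
rewrite (lebesgue_rV_box (A := fun=> `[- M, M]%classic))//.
rewrite ltey_eq; apply/orP; left.
elim/big_ind : _ => //; first by move=> x y; exact: fin_numM.
by move=> i _; rewrite lebesgue_measure_itv/=; case: ifP.
Qed.

Lemma open_lebesgue_rV_gt0 (U : set E) x : open U -> U x -> (0 < mu U)%E.
Proof.
move=> oU Ux.
have /nbhs_ballP[e /= e0 eU] : nbhs x U by rewrite nbhsE/=; exists U.
have mI : measurable [set y : E | forall i, `](x ord0 i - e), (x ord0 i + e)[%classic (y ord0 i)].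
  exact: (measurable_rV_box (A := fun i => `](x ord0 i - e), (x ord0 i + e)[%classic)).
apply: (@lt_le_trans _ _ (mu [set y : E | forall i, `](x ord0 i - e), (x ord0 i + e)[%classic (y ord0 i)])).
  rewrite (lebesgue_rV_box (A := fun i => `](x ord0 i - e), (x ord0 i + e)[%classic))//.
  elim/big_ind : _ => //; first by move=> a b; exact: mule_gt0.
  move=> i _; rewrite lebesgue_measure_itv/= lte_fin ltrD2l gtrN// -EFinB lte_fin.
  by lra.
apply: le_measure; rewrite ?inE//; first exact: open_measurable_rV.
move=> y /= H; apply: eU; rewrite rV_ballE/=; apply/(rV_norm_ltP _ e0) => i.
by have := H i; rewrite !mxE in_itv/= => /andP[a b]; rewrite ltr_distlC a b.
Qed.

End n.
End translation.

(** * Almost everywhere differentiability of Lipschitz functions of one variable *)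

Lemma aeS d (T : measurableType d) (R : realType) (m : {measure set T -> \bar R})
    (P Q : T -> Prop) :
  (forall x, P x -> Q x) -> {ae m, forall x, P x} -> {ae m, forall x, Q x}.
Proof. by move=> PQ; apply: negligibleS => x /= nQ Px; apply/nQ/PQ. Qed.

Lemma aeI d (T : measurableType d) (R : realType) (m : {measure set T -> \bar R})
    (P Q : T -> Prop) :
  {ae m, forall x, P x} -> {ae m, forall x, Q x} -> {ae m, forall x, P x /\ Q x}.
Proof.
move=> aP aQ; apply: (negligibleS _ (negligibleU aP aQ)) => x /= nPQ.
by apply: contrapT => /not_orP[/contrapT Px /contrapT Qx]; exact: nPQ.
Qed.

(** Both [g] and c x - g(x) are nondecreasing and continuous, hence define Stieltjes measures. Their
    sum agrees with [c] times Lebesgue measure on half-open intervals, hence everywhere, and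
    dropping one summand gives the domination on all measurable sets. *)
Lemma stieltjes_dominated (R : realType) (g : R -> R) (c : R) :
  {homo g : x y / x <= y} -> (forall x y, x <= y -> g y - g x <= c * (y - x)) ->
  exists nu : {measure set (measurableTypeR R) -> \bar R},
    (forall a b, a <= b -> nu `]a, b]%classic = (g b - g a)%:E) /\
    (forall A, measurable A -> (nu A <= c%:E * lebesgue_measure A)%E).
Proof.
move=> ndg lipg.
have c0 : 0 <= c.
  have := lipg 0 1 ler01; rewrite subr0 mulr1; apply: le_trans.
  by rewrite subr_ge0 ndg.
have cg (f : R -> R) : (forall x y, x <= y -> 0 <= f y - f x <= c * (y - x)) ->
    isCumulative R _ R f.
  move=> H; split; first by move=> x y /H; rewrite subr_ge0 => /andP[].
  move=> x; apply/cvgrPdist_le => e e0.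
  have c1 : 0 < c + 1 by rewrite ltr_wpDl.
  near=> y.
  have xy : x <= y by near: y; exact: nbhs_right_ge.
  have /andP[a b] := H _ _ xy.
  rewrite distrC ger0_norm// (le_trans b)//.
  have yd : y <= x + e / (c + 1).
    by near: y; apply: nbhs_right_ltW; rewrite ltrDl divr_gt0.
  apply: (@le_trans _ _ (c * (e / (c + 1)))).
    by rewrite ler_wpM2l// lerBlDl.
  by rewrite mulrA ler_pdivrMr// mulrDr mulr1 mulrC lerDl ltW.
have Hg x y : x <= y -> 0 <= g y - g x <= c * (y - x).
  by move=> xy; rewrite subr_ge0 ndg//= lipg.
pose g' x := c * x - g x.
have Hg' x y : x <= y -> 0 <= g' y - g' x <= c * (y - x).
  move=> xy; have := Hg _ _ xy; rewrite /g'; lra.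
pose G : cumulative R R := HB.pack g (cg _ Hg).
pose G' : cumulative R R := HB.pack g' (cg _ Hg').
exists (lebesgue_stieltjes_measure G).
have nuE (F : cumulative R R) a b : a <= b ->
    lebesgue_stieltjes_measure F `]a, b]%classic = (F b - F a)%:E.
  move=> ab; rewrite /lebesgue_stieltjes_measure/= /measure_extension/= measurable_mu_extE//=.
    by rewrite wlength_itv_bnd.
  by exists (a, b).
split; first by move=> a b ab; exact: (nuE G).
move=> A mA.
have Hid x y : x <= y -> 0 <= c * y - c * x <= c * (y - x).
  by move=> xy; rewrite -mulrBr lexx andbT mulr_ge0// subr_ge0.
pose H : cumulative R R := HB.pack (fun x : R => c * x) (cg (fun x => c * x) Hid).
have ocE (X : set R) : ocitv X -> X = set0 \/ exists a b, a <= b /\ X = `]a, b]%classic.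
  by case/ocitvP => [->|[[a b] /= ab ->]]; [left|right; exists a, b; rewrite ltW].
have e1 : lebesgue_stieltjes_measure H A =
    measure_add (lebesgue_stieltjes_measure G) (lebesgue_stieltjes_measure G') A.
  apply: lebesgue_stieltjes_measure_unique => // X /ocE[->|[a [b [ab ->]]]].
    by rewrite !measure0.
  transitivity (lebesgue_stieltjes_measure G `]a, b]%classic +
      lebesgue_stieltjes_measure G' `]a, b]%classic)%E; last exact/esym/measure_addE.
  transitivity (H b - H a)%:E; first exact: (nuE H).
  transitivity ((G b - G a)%:E + (G' b - G' a)%:E)%E.
    by rewrite -EFinD; congr EFin; rewrite /= /g'; ring.
  by congr (_ + _)%E; apply/esym; [exact: (nuE G)|exact: (nuE G')].
have e2 : lebesgue_stieltjes_measure H A =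
    mscale (NngNum c0) lebesgue_measure A.
  apply: lebesgue_stieltjes_measure_unique => // X /ocE[->|[a [b [ab ->]]]].
    by rewrite !measure0.
  transitivity (H b - H a)%:E; first exact: (nuE H).
  transitivity (c%:E * lebesgue_measure (`]a, b]%classic : set (measurableTypeR R)))%E => //.
  rewrite lebesgue_measure_itv/= lte_fin.
  case: ifPn => [_|]; first by rewrite -EFinD -EFinM mulrBr.
  rewrite -leNgt mule0 => ba; have -> : a = b by apply/eqP; rewrite eq_le ab.
  by rewrite subrr.
have -> : (c%:E * lebesgue_measure A)%E = mscale (NngNum c0) lebesgue_measure A by [].
by rewrite -e2 e1 measure_addE leeDl.
Unshelve. all: by end_near. Qed.

(** The Stieltjes measure of [g] is absolutely continuous, so by Radon-Nikodym [g] is, up to a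
    constant, the indefinite integral of a density; Lebesgue's differentiation theorem, in the form
    of [FTC1Ny], then gives the derivative. *)
Lemma monotone_lipschitz_ae_derivable (R : realType) (g : R -> R) (c M : R) :
  {homo g : x y / x <= y} -> (forall x y, x <= y -> g y - g x <= c * (y - x)) ->
  {ae lebesgue_measure, forall x, - M < x < M -> derivable g x 1}.
Proof.
move=> ndg lipg.
have [nu [nuE nu_le]] := stieltjes_dominated ndg lipg.
(* Restricting to a bounded interval makes the measure finite, so that its density is integrable on
   the whole line. *)
pose I : set (measurableTypeR R) := `]- M, M]%classic.
have mI : measurable I by exact: measurable_itv.
have [M0|M0] := leP 0 M; last first.
  by apply: aeW => x /andP[a b]; lra.
have nuI : (nu I < +oo)%E by rewrite nuE ?ltry//; lra.
pose nuM := mfrestr mI nuI.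
have dom : nuM `<< lebesgue_measure.
  apply/null_content_dominatesP => A mA A0.
  have := nu_le (A `&` I) (measurableI _ _ mA mI).
  have -> : lebesgue_measure (A `&` I) = 0%E.
    apply/eqP; rewrite eq_le measure_ge0 andbT -A0.
    by apply: le_measure; rewrite ?inE//; exact: measurableI.
  rewrite mule0 => H; apply/eqP; rewrite eq_le measure_ge0 andbT.
  exact: H.
have [f [f0 ffin intf fE]] := radon_nikodym_sigma_finite dom.
pose F x := (\int[lebesgue_measure]_(t in `]-oo, x]) fine (f t))%R.
have efine : EFin \o (fine \o f) = f by apply/funext => x /=; rewrite fineK.
have intff : (@lebesgue_measure R).-integrable setT (EFin \o (fine \o f)) by rewrite efine.
have FgE x : - M < x < M -> F x = g x - g (- M).
  move=> /andP[a b]; rewrite /F /Rintegral.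
  under eq_integral do rewrite fineK//.
  have /= <- := fE `]-oo, x]%classic (measurable_itv _).
  have -> : mfrestr mI nuI `]-oo, x]%classic = nu `](- M), x]%classic.
    rewrite /mfrestr/= /mrestr; congr (nu _).
    apply/seteqP; split => t; rewrite /I /= !in_itv/=.
      by move=> [-> /andP[-> _]].
    by move=> /andP[-> tx]; rewrite tx (le_trans tx)// ltW.
  by rewrite nuE//; exact: ltW.
have H1 y : (@lebesgue_measure R).-integrable `]-oo, y] (EFin \o (fine \o f)).
  by apply: integrableS intff => //; exact: measurable_itv.
have H2 : locally_integrable setT (fine \o f).
  split => //.
  - by apply/measurable_EFinP; rewrite efine; case/integrableP : intf.
  - exact: openT.
  - move=> K _ cK.
    have iK : (@lebesgue_measure R).-integrable K (EFin \o (fine \o f)).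
      by apply: integrableS intff => //; exact: compact_measurable.
    by case/integrableP : iK.
have := FTC1Ny H1 H2; apply: aeS => x /= [dF _] xM.
have : derivable (fun x => F x + g (- M)) x 1.
  by apply: derivableD => //; exact: derivable_cst.
apply: near_eq_derivable.
have : nbhs x (`]- M, M[%classic : set R).
  by apply: open_nbhs_nbhs; split; [exact: interval_open|rewrite /= in_itv].
by apply: filterS => y /=; rewrite in_itv/= => yM; rewrite FgE// subrK.
Qed.

(** Adding c x makes [f] nondecreasing with increments at most 2c (y - x), and does not affect
    derivability. *)
Lemma lipschitz_ae_derivable (R : realType) (f : R -> R) (c : R) :
  (forall x y, `|f y - f x| <= c * `|y - x|) ->
  {ae lebesgue_measure, forall x, derivable f x 1}.
Proof.
move=> lf.
have H (n : nat) : {ae lebesgue_measure, forall x, - n%:R < x < n%:R ->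
    derivable (fun x => f x + c * x) x 1}.
  apply: (@monotone_lipschitz_ae_derivable _ _ (c + c)) => x y xy.
    have := lf x y; rewrite ler_norml => /andP[+ _].
    by rewrite (@ger0_norm _ (y - x)) ?subr_ge0//; lra.
  have := lf x y; rewrite ler_norml => /andP[_].
  by rewrite (@ger0_norm _ (y - x)) ?subr_ge0//; lra.
have := ae_foralln H; apply: aeS => x Hx.
have {}Hx : derivable (fun x => f x + c * x) x 1.
  have [n xn] : exists n : nat, `|x| < n%:R.
    by exists (Num.bound `|x : R|); exact: archi_boundP.
  by apply: (Hx n); rewrite -ltr_norml.
have -> : f = (fun x => f x + c * x) - (fun x => c * x).
  by apply/funext => y /=; rewrite fctE addrK.
by apply: derivableB => //; apply: derivableM.
Qed.

(** * Directional derivatives as derivatives along lines *)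

Section line_restriction.
Context {R : realType} {V : normedModType R}.
Variables (f : V -> R) (x v : V) (t : R).

Let line_quotientE :
  (fun h : R => h^-1 *: ((f \o shift (x + t *: v)) (h *: v) - f (x + t *: v))) =
  (fun h : R => h^-1 *: (((fun s : R => f (x + s *: v)) \o shift t) (h *: (1 : R)) -
    f (x + t *: v))).
Proof.
apply/funext => h /=; congr (_ *: (f _ - _)).
by rewrite [h *: 1]mulr1 scalerDl addrCA.
Qed.

Lemma derivable_line :
  derivable f (x + t *: v) v <-> derivable (fun s : R => f (x + s *: v)) t 1.
Proof. by rewrite /derivable line_quotientE. Qed.

Lemma is_derive_line df :
  is_derive (x + t *: v) v f df <-> is_derive t 1 (fun s : R => f (x + s *: v)) df.
Proof.
split=> -[H1 H2]; split; try exact/derivable_line.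
- by rewrite /derive -line_quotientE.
- by rewrite /derive line_quotientE.
Qed.

End line_restriction.

(** * Directional derivatives of Lipschitz functions on R^n *)

Section lipschitz_partial.
Context {R : realType} {n : nat}.
Local Notation E := 'rV[R]_n.
Local Notation mu := (@lebesgue_rV R n).
Implicit Types (f : E -> R) (c : R) (v : E).

Lemma rV_continuousP f : continuous f <->
  forall x e, 0 < e -> exists2 d, 0 < d & forall y, `|x - y| < d -> `|f x - f y| < e.
Proof.
split=> H x.
  move=> e e0; have /nbhs_ballP[d /= d0 Hd] : nbhs x (f @^-1` ball (f x) e).
    by apply: H; exact: nbhsx_ballx.
  by exists d => // y xy; apply: Hd; rewrite rV_ballE.
move=> A /nbhs_ballP[e /= e0 eA].
have [d d0 Hd] := H x e e0.
by apply/nbhs_ballP; exists d => //= y; rewrite rV_ballE => xy; apply: eA; exact: Hd.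
Qed.

Lemma rV_continuousB f g : continuous f -> continuous g ->
  continuous (fun x => f x - g x).
Proof. by move=> cf cg x; exact: (cvgB (cf x) (cg x)). Qed.

Lemma rV_continuousM f g : continuous f -> continuous g ->
  continuous (fun x => f x * g x).
Proof. by move=> cf cg x; exact: (cvgM (cf x) (cg x)). Qed.

Lemma rV_continuous_norm f : continuous f -> continuous (fun x => `|f x|).
Proof. by move=> cf x; exact: (cvg_norm (cf x)). Qed.

Lemma lipschitz_continuous f c : (forall x y, `|f x - f y| <= c * `|x - y|) ->
  continuous f.
Proof.
move=> lf; apply/rV_continuousP => x e e0.
have c1 : 0 < `|c| + 1 by rewrite ltr_wpDl.
exists (e / (`|c| + 1)); first by rewrite divr_gt0.
move=> y xy; apply: le_lt_trans (lf _ _) _.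
apply: (@le_lt_trans _ _ ((`|c| + 1) * `|x - y|)).
  by rewrite ler_wpM2r// (le_trans (ler_norm c))// lerDl.
by rewrite mulrC -ltr_pdivlMr.
Qed.

Definition diff_quotient f v (h : R) (x : E) : R := h^-1 * (f (h *: v + x) - f x).

Lemma diff_quotient_continuous f v h : continuous f ->
  continuous (diff_quotient f v h).
Proof.
move=> cf.
have cg : continuous (fun x : E => f (h *: v + x)).
  move=> x; apply: (@continuous_comp _ _ _ (fun x : E => h *: v + x) f); last exact: cf.
  by apply: continuousD; [exact: cst_continuous|].
apply: rV_continuousM; first by move=> x; exact: cst_continuous.
exact: rV_continuousB.
Qed.

(** The Cauchy criterion, arranged for measurability: for fixed [k] and [m] the condition on [x] is
    an intersection of closed sets when [f] is continuous, so the uncountable range of [h] and [s]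
    is harmless and only countable operations over [k] and [m] remain. *)
Lemma derivable_quotientP f x v : derivable f x v <->
  forall k : nat, exists m : nat, forall h s, h != 0 -> s != 0 ->
    `|h| < m.+1%:R^-1 -> `|s| < m.+1%:R^-1 ->
    `|diff_quotient f v h x - diff_quotient f v s x| <= k.+1%:R^-1.
Proof.
have dqE : (fun h : R => h^-1 *: ((f \o shift x) (h *: v) - f x)) =
    (diff_quotient f v ^~ x) by apply/funext.
split.
  move=> /cvg_ex[/= l fl] k.
  have k20 : 0 < k.+1%:R^-1 / 2 :> R by rewrite divr_gt0.
  have := @cvgr_dist_lt _ _ _ _ _ _ _ fl _ k20.
  have FF : Filter (0 : R)^' by exact: _.
  move=> /(_ FF); rewrite near_withinE => /nbhs_ballP[e /= e0 He].
  have [m _ Hm] := near_infty_natSinv_lt (PosNum e0).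
  exists m => h s h0 s0 hm sm.
  have Hq t : t != 0 -> `|t| < m.+1%:R^-1 ->
      `|l - diff_quotient f v t x| < k.+1%:R^-1 / 2.
    move=> t0 tm; apply: He => //; rewrite /ball/= sub0r normrN.
    by apply: lt_trans tm _; apply: Hm => /=.
  rewrite (_ : _ - _ = (l - diff_quotient f v s x) - (l - diff_quotient f v h x)); last ring.
  apply: le_trans (ler_normB _ _) _.
  by rewrite (splitr k.+1%:R^-1) lerD// ltW// Hq.
move=> H; apply/cauchy_cvgP; rewrite dqE; apply: cauchy_exP => e e0.
have [k _ Hk] := near_infty_natSinv_lt (PosNum e0).
have [m Hm] := H k.
have m0 : 0 < m.+1%:R^-1 / 2 :> R by rewrite divr_gt0.
(* Any admissible increment may serve as the centre of the Cauchy ball; half of the threshold is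
   nonzero and strictly below it. *)
exists (diff_quotient f v (m.+1%:R^-1 / 2) x).
change (\forall h \near (0 : R)^', ball (diff_quotient f v (m.+1%:R^-1 / 2) x) e (diff_quotient f v h x)).
rewrite near_withinE; near=> h => h0; rewrite /ball /=.
apply: (@le_lt_trans _ _ k.+1%:R^-1); last by apply: Hk => /=.
apply: Hm => //.
- by rewrite gtr0_norm// ltr_pdivrMr// ltr_pMr ?invr_gt0// ltr1n.
Unshelve. all: by end_near. Qed.

Lemma measurable_derivable f v : continuous f ->
  measurable [set x | derivable f x v].
Proof.
move=> cf.
pose C (k m : nat) := \bigcap_(p in [set p : R * R | [/\ p.1 != 0, p.2 != 0,
    `|p.1| < m.+1%:R^-1 & `|p.2| < m.+1%:R^-1]])
  [set x | `|diff_quotient f v p.1 x - diff_quotient f v p.2 x| <= k.+1%:R^-1].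
rewrite (_ : [set _ | _] = \bigcap_k \bigcup_m C k m); last first.
  apply/seteqP; split => x.
    move/derivable_quotientP => H k _; have [m Hm] := H k; exists m => // p [*].
    exact: Hm.
  move=> H; apply/derivable_quotientP => k; have [m _ Hm] := H k I; exists m => h s h0 s0 hm sm.
  exact: (Hm (h, s)).
apply: bigcapT_measurable => k; apply: bigcupT_measurable => m.
apply: closed_measurable_rV; apply: closed_bigI => p _.
have cg : continuous (fun x => `|diff_quotient f v p.1 x - diff_quotient f v p.2 x|).
  by apply: rV_continuous_norm; apply: rV_continuousB; exact: diff_quotient_continuous.
apply: (@closed_comp _ _ _ [set t : R | t <= k.+1%:R^-1]); last exact: closed_le.
by move=> x _; exact: cg.
Qed.

Lemma lipschitz_derive_le f c v x : 0 <= c ->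
  (forall x y, `|f x - f y| <= c * `|x - y|) -> `|'D_v f x| <= c * `|v|.
Proof.
move=> c0 lf; have [df|ndf] := pselect (derivable f x v); last first.
  (* Where the limit does not exist, ['D_v f x] has the default value 0. *)
  by rewrite /derive (dvgP ndf) normr0 mulr_ge0.
have H : h^-1 *: ((f \o shift x) (h *: v) - f x) @[h --> 0^'] --> 'D_v f x.
  exact: df.
have FF : ProperFilter (0 : R)^' by exact: _.
have {}H := cvg_norm H; apply: (cvgr_to_le (H _)).
rewrite near_withinE; near=> h => h0 /=.
rewrite normrM normfV ler_pdivrMl ?normr_gt0// (le_trans (lf _ _))//.
by rewrite addrK mx_normZ mulrCA.
Unshelve. all: by end_near. Qed.

(** Let B be the set where the derivative along [v] does not exist. Instead of slicing R^n by lines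
    parallel to [v], which would need a change of coordinates, Tonelli's theorem is applied to the
    indicator of x + t v in B on R x R^n. Integrating in [x] first gives the measure of B for every
    [t]; integrating in [t] first gives 0 by the one-dimensional theorem. *)
Lemma lipschitz_derivable_ae f c v : 0 <= c ->
  (forall x y, `|f x - f y| <= c * `|x - y|) ->
  {ae mu, forall x, derivable f x v}.
Proof.
move=> c0 lf; have cf := lipschitz_continuous lf.
have mD : measurable [set x | derivable f x v] by exact: measurable_derivable.
pose B := ~` [set x | derivable f x v].
have mB : measurable B by exact: measurableC.
exists B; split => //.
pose g (p : measurableTypeR R * E) : E := p.2 + p.1 *: v.
have mg : measurable_fun setT g.
  apply: measurable_fun_rVP => i; rewrite /comp /coord_rV /g.
  under eq_fun do rewrite !mxE.
  apply: measurable_funD.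
    by apply: (measurableT_comp (measurable_coord_rV i)); exact: measurable_snd.
  by apply: measurable_funM => //; exact: measurable_fst.
have mgB : measurable_fun setT (fun p => (\1_B (g p))%:E : \bar R).
  apply/measurable_EFinP; apply: (measurableT_comp _ mg).
  exact: measurable_indic.
have := @fubini_tonelli _ _ _ _ _ lebesgue_measure mu _ mgB.
have g0 p : (0 <= (\1_B (g p))%:E :> \bar R)%E by rewrite lee_fin.
move=> /(_ g0).
rewrite /g /=.
under eq_integral => t _.
  rewrite (integral_shift_rV (t *: v) (f := fun x => (\1_B x)%:E)); last first.
    by apply/measurable_EFinP; exact: measurable_indic.
  rewrite integral_indic// setIT.
  over.
rewrite integral_cst//=.
rewrite [RHS]integral0_eq; last first.
  move=> x _.
  have : {ae lebesgue_measure, forall t : R, derivable (fun s : R => f (x + s *: v)) t 1}.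
    apply: (@lipschitz_ae_derivable _ _ (c * `|v|)) => s t.
    apply: le_trans (lf _ _) _.
    rewrite opprD addrACA subrr add0r -scalerBl mx_normZ.
    by rewrite -mulrA ler_wpM2l// mulrC.
  move=> ae; rewrite -(@integral0 _ _ _ lebesgue_measure setT).
  apply: ae_eq_integral => //.
    have mphi : measurable_fun setT (fun t : measurableTypeR R => x + t *: v : E).
      apply: measurable_fun_rVP => i; rewrite /comp /coord_rV.
      under eq_fun do rewrite !mxE.
      by apply: measurable_funD => //; exact: measurable_funM.
    have mi : measurable_fun setT (\1_B : E -> R) by exact: measurable_indic.
    apply/measurable_EFinP; exact: (measurableT_comp mi mphi).
  have nB (t : measurableTypeR R) : derivable (fun s : R => f (x + s *: v)) t 1 -> \1_B (x + t *: v) = 0 :> R.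
    by move=> /(derivable_line f x v t).2 dt; rewrite indicE memNset //; apply.
  have H := @aeS _ (measurableTypeR R) R lebesgue_measure _ _ nB ae.
  by apply: (@aeS _ (measurableTypeR R) R lebesgue_measure _ _ _ H) => t Ht _; rewrite Ht.
(* The measure of B times the infinite length of the line is 0, so B is null. *)
move/eqP; rewrite mule_eq0 => /orP[/eqP//|].
have -> : [set: measurableTypeR R] = ([set` `]-oo, +oo[] : set R) by rewrite set_itvE.
by rewrite lebesgue_measure_itv.
Qed.

Lemma measurable_derive f c v : 0 <= c ->
  (forall x y, `|f x - f y| <= c * `|x - y|) -> measurable_fun setT (fun x => 'D_v f x).
Proof.
move=> c0 lf; have cf := lipschitz_continuous lf.
have mD : measurable [set x | derivable f x v] by exact: measurable_derivable.
apply: (@measurable_fun_cvg _ _ _ _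
  (fun (k : nat) x => \1_[set x | derivable f x v] x * diff_quotient f v k.+1%:R^-1 x)).
  move=> k; apply: measurable_funM; first exact: measurable_indic.
  by apply: continuous_measurable_rV; exact: diff_quotient_continuous.
move=> x _; have [df|ndf] := pselect (derivable f x v); last first.
  rewrite /derive (dvgP ndf) indicE memNset//.
  by under eq_fun do rewrite mul0r; exact: cvg_cst.
rewrite indicE mem_set//; under eq_fun do rewrite mul1r.
have /cvgr_dnbhsP H : diff_quotient f v h x @[h --> 0^'] --> 'D_v f x by exact: df.
apply: H; split; first by move=> k; rewrite invr_eq0 pnatr_eq0.
exact: cvg_harmonic.
Qed.

End lipschitz_partial.

(** * Real-valued integrable functions on a measure space *)

Section integrable_toolkit.
Context d (T : measurableType d) (R : realType) (m : {measure set T -> \bar R}).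
Implicit Types f g : T -> R.
Local Notation L1 f := (m.-integrable setT (EFin \o f)).

Lemma L1_measurable f : L1 f -> measurable_fun setT f.
Proof. by move=> /integrableP[/measurable_EFinP]. Qed.

Lemma L1D f g : L1 f -> L1 g -> L1 (fun x => f x + g x).
Proof.
move=> Lf Lg; exact: (@integrableD _ _ _ m setT measurableT _ _ Lf Lg).
Qed.

Lemma L1B f g : L1 f -> L1 g -> L1 (fun x => f x - g x).
Proof.
move=> Lf Lg; exact: (@integrableB _ _ _ m setT measurableT _ _ Lf Lg).
Qed.

Lemma L1Z (c : R) f : L1 f -> L1 (fun x => c * f x).
Proof.
move=> Lf; exact: (@integrableZl _ _ _ m setT measurableT c _ Lf).
Qed.

Lemma L1_sum (I : Type) (s : seq I) (F : I -> T -> R) :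
  (forall i, L1 (F i)) -> L1 (fun x => \sum_(i <- s) F i x).
Proof.
move=> LF; elim: s => [|i s ih].
  under [X in EFin \o X]eq_fun do rewrite big_nil.
  exact: integrable0.
under [X in EFin \o X]eq_fun do rewrite big_cons.
exact: L1D.
Qed.

Lemma L1_abs f : L1 f -> L1 (fun x => `|f x|).
Proof. exact: integrable_norm. Qed.

Lemma L1_le f g : measurable_fun setT f -> (forall x, `|f x| <= g x) -> L1 g -> L1 f.
Proof.
move=> mf fg Lg; apply: (le_integrable _ _ _ Lg) => //; first exact/measurable_EFinP.
by move=> x _ /=; rewrite lee_fin (le_trans (fg x))// ler_norm.
Qed.

Lemma L1_bounded (h : T -> R) (C : R) f : measurable_fun setT h ->
  (forall x, `|h x| <= C) -> L1 f -> L1 (fun x => f x * h x).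
Proof.
move=> mh hC Lf; apply: (L1_le _ _ (L1Z C (L1_abs Lf))).
  by apply: measurable_funM => //; exact: L1_measurable.
by move=> x; rewrite normrM mulrC ler_wpM2r.
Qed.

Lemma Rint_ae f g : {ae m, forall x, f x = g x} ->
  measurable_fun setT f -> measurable_fun setT g ->
  \int[m]_x f x = \int[m]_x g x.
Proof.
move=> fg mf mg; congr fine; apply: ae_eq_integral => //; try exact/measurable_EFinP.
by apply: aeS fg => x fgx _; rewrite fgx.
Qed.

Lemma Rintegral_sum (I : Type) (s : seq I) (F : I -> T -> R) :
  (forall i, L1 (F i)) ->
  \int[m]_x (\sum_(i <- s) F i x) = \sum_(i <- s) \int[m]_x F i x.
Proof.
move=> LF; elim: s => [|i s ih].
  rewrite big_nil; under eq_Rintegral do rewrite big_nil.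
  by rewrite Rintegral_cst// mul0r.
rewrite big_cons -ih -RintegralD//; last exact: L1_sum.
by apply: eq_Rintegral => x _; rewrite big_cons.
Qed.

Lemma Rintegral_dct (F : nat -> T -> R) f g :
  (forall k, measurable_fun setT (F k)) -> measurable_fun setT f ->
  {ae m, forall x, F k x @[k --> \oo] --> f x} -> L1 g ->
  (forall k x, `|F k x| <= g x) ->
  L1 f /\ \int[m]_x F k x @[k --> \oo] --> \int[m]_x f x.
Proof.
move=> mF mf Ff Lg Fg.
have mF' k : measurable_fun setT (EFin \o F k) by exact/measurable_EFinP.
have mf' : measurable_fun setT (EFin \o f) by exact/measurable_EFinP.
have Ff' : {ae m, forall x, setT x -> (EFin \o F k) x @[k --> \oo] --> (EFin \o f) x}.
  by apply: aeS Ff => x Fx _; apply: cvg_EFin => //; apply: nearW.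
have Fg' : {ae m, forall x (k : nat), setT x -> (`|(EFin \o F k) x| <= (EFin \o g) x)%E}.
  by apply: aeW => x k _ /=; rewrite lee_fin.
have [Lf _ H] := dominated_convergence measurableT mF' mf' Ff' Lg Fg'.
split => //; apply: fine_cvg; rewrite fineK; first exact: H.
exact: integrable_fin_num.
Qed.

End integrable_toolkit.

(** * Integrals over R^n of boundedly supported functions *)

Section rV_integrals.
Context {R : realType} {n : nat}.
Local Notation E := 'rV[R]_n.
Local Notation mu := (@lebesgue_rV R n).
Local Notation L1 f := (mu.-integrable setT (EFin \o f)).
Implicit Types (f g : E -> R).

Lemma measurable_rV_normball (M : R) : measurable [set x : E | `|x| <= M].
Proof.
apply: closed_measurable_rV.
apply: (@closed_comp _ _ (fun x : E => `|x|) [set t : R | t <= M]); last exact: closed_le.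
by move=> x _; exact: norm_continuous.
Qed.

Lemma L1_normball (M : R) : L1 (\1_[set x : E | `|x| <= M]).
Proof.
apply/integrableP; split.
  by apply/measurable_EFinP; exact: measurable_indic (measurable_rV_normball M).
under eq_integral do rewrite gee0_abs ?lee_fin//.
rewrite integral_indic// ?setIT; last exact: measurable_rV_normball.
by apply: (@bounded_lebesgue_rV_fin _ _ _ M); first exact: measurable_rV_normball.
Qed.

Lemma L1_bounded_support f (C M : R) : measurable_fun setT f ->
  (forall x, `|f x| <= C) -> (forall x, M < `|x| -> f x = 0) -> L1 f.
Proof.
move=> mf fC fM; apply: (L1_le mf _ (L1Z C (L1_normball M))) => x.
rewrite indicE; have [xM|xM] := leP `|x| M.
  by rewrite mem_set// mulr1.
by rewrite fM// normr0 memNset ?mulr0//= leNgt xM.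
Qed.

Lemma Rintegral_shift f (v : E) : measurable_fun setT f ->
  \int[mu]_x f (x + v) = \int[mu]_x f x.
Proof.
move=> mf; congr fine; rewrite (integral_shift_rV v (f := EFin \o f))//.
exact/measurable_EFinP.
Qed.

Lemma L1_shift f (v : E) : L1 f -> L1 (fun x => f (x + v)).
Proof. exact: (integrable_shift_rV v). Qed.

(** The source of every integration by parts below: difference quotients have integral 0 by
    translation invariance, and dominated convergence passes this on to the derivative. *)
Lemma integral_derive0 f c (M : R) v : 0 <= c -> (forall x, `|f x| <= c) ->
  (forall x y, `|f x - f y| <= c * `|x - y|) -> (forall x, M < `|x| -> f x = 0) ->
  L1 (fun x => 'D_v f x) /\ \int[mu]_x 'D_v f x = 0.
Proof.
move=> c0 fc lf fM; have cf := lipschitz_continuous lf.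
have mf := continuous_measurable_rV cf.
have Lf : L1 f by exact: (@L1_bounded_support _ c M).
pose F (k : nat) x := diff_quotient f v k.+1%:R^-1 x.
have mF k : measurable_fun setT (F k).
  by apply: continuous_measurable_rV; exact: diff_quotient_continuous.
have md : measurable_fun setT (fun x => 'D_v f x) by exact: measurable_derive lf.
have FD : {ae mu, forall x, F k x @[k --> \oo] --> 'D_v f x}.
  apply: aeS (lipschitz_derivable_ae v c0 lf) => x df.
  have /cvgr_dnbhsP H : diff_quotient f v h x @[h --> 0^'] --> 'D_v f x by exact: df.
  by apply: H; split; [move=> k; rewrite invr_eq0 pnatr_eq0|exact: cvg_harmonic].
(* The increments are at most 1, so the translated supports stay in the ball of radius M + |v|. *)
have FB k x : `|F k x| <= c * `|v| * \1_[set x : E | `|x| <= M + `|v|] x.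
  rewrite indicE; have [xM|xM] := leP `|x| (M + `|v|).
    rewrite mem_set// mulr1 /F /diff_quotient normrM normfV.
    rewrite ler_pdivrMl ?normr_gt0 ?invr_eq0 ?pnatr_eq0//.
    by rewrite (le_trans (lf _ _))// addrK mx_normZ mulrCA.
  rewrite memNset/=; last by apply/negP; rewrite -ltNge.
  rewrite mulr0 /F /diff_quotient !fM ?subrr ?mulr0 ?normr0//.
    by apply: le_lt_trans xM; rewrite lerDl.
  rewrite -ltrBrDr in xM; apply: lt_le_trans xM _.
  have : `|x| <= `|k.+1%:R^-1 *: v + x| + `|- (k.+1%:R^-1 *: v)|.
    by rewrite (le_trans _ (ler_normD _ _))// addrAC subrr add0r.
  rewrite -lerBlDr => /(le_trans _); apply.
  rewrite lerB// normrN mx_normZ ger0_norm ?invr_ge0//.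
  by rewrite ler_piMl// invf_le1// ler1n.
have [LD H] := Rintegral_dct mF md FD (L1Z (c * `|v|) (L1_normball (M + `|v|))) FB.
split => //.
have F0 k : \int[mu]_x F k x = 0.
  have Lfs : L1 (fun x => f (k.+1%:R^-1 *: v + x)).
    rewrite (_ : (fun _ => _) = (fun x => f (x + k.+1%:R^-1 *: v))); first exact: L1_shift.
    by apply/funext => x; rewrite addrC.
  rewrite /F /diff_quotient RintegralZl//; last exact: L1B.
  rewrite RintegralB//.
  under eq_Rintegral do rewrite addrC.
  by rewrite Rintegral_shift// subrr mulr0.
move: H; under eq_fun do rewrite F0.
by move=> H; apply/esym; apply: (cvg_unique _ (cvg_cst _) H).
Qed.

End rV_integrals.

(** A remainder of order h^2 with an explicit constant can be integrated over a parameter. This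
    gives differentiation of convolutions under the integral, and also covers affine functions (C =
    0) and the flat functions at the origin. *)
Lemma is_derive_quadratic (R : realType) (V : normedModType R) (f : V -> R) (x v : V)
    (l C : R) :
  (forall h : R, `|f (h *: v + x) - f x - h * l| <= C * h ^+ 2) -> is_derive x v f l.
Proof.
move=> H.
have C0 : 0 <= C.
  by have := H 1; rewrite expr1n mulr1; apply: le_trans.
have cf : (fun h : R => h^-1 *: ((f \o shift x) (h *: v) - f x)) h @[h --> 0^'] --> l.
  apply/cvgrPdist_lt => e e0.
  have C1 : 0 < C + 1 by rewrite ltr_wpDl.
  rewrite near_withinE; near=> h => h0.
  have -> : l - h^-1 *: ((f \o shift x) (h *: v) - f x) = - h^-1 * (f (h *: v + x) - f x - h * l).
    by rewrite /GRing.scale /=; field.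
  rewrite normrM normrN normfV ltr_pdivrMl ?normr_gt0//.
  apply: le_lt_trans (H h) _.
  rewrite -real_normK ?num_real// expr2 mulrCA ltr_pM2l ?normr_gt0//.
  apply: (@le_lt_trans _ _ ((C + 1) * `|h|)); first by rewrite ler_wpM2r// lerDl.
  rewrite mulrC -ltr_pdivlMr//.
  near: h; apply/nbhs_ballP; exists (e / (C + 1)) => /=; first by rewrite divr_gt0.
  by move=> y; rewrite /ball/= sub0r normrN.
split; first by apply/cvg_ex; exists l.
by apply/cvg_lim.
Unshelve. all: by end_near. Qed.

Lemma is_derive_chain (R : realType) (V : normedModType R) (f : V -> R) (phi : R -> R)
    (x v : V) (df dphi : R) :
  is_derive x v f df -> is_derive (f x) 1 phi dphi ->
  is_derive x v (fun y => phi (f y)) (dphi * df).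
Proof.
move=> Hf Hphi.
have xE : x + 0 *: v = x by rewrite scale0r addr0.
pose line (s : R) := f (x + s *: v).
have Hline : is_derive (0 : R) 1 line df.
  by apply: (is_derive_line f x v 0 df).1; rewrite xE.
have Hcomp : is_derive (0 : R) 1 (phi \o line) (dphi * df).
  by apply: is_derive1_comp; rewrite /line xE.
by have := (is_derive_line (phi \o f) x v 0 (dphi * df)).2 Hcomp; rewrite xE.
Qed.

(** * A smooth function vanishing on the negative half-line *)

Section flat_function.
Context {R : realType}.
Implicit Types (m : nat) (t s : R).

(** The powers of [t^-1] make the family closed under derivation: the derivative of [flat m] is a
    combination of [flat m.+2] and [flat m.+1]. *)
Definition flat m t : R := if 0 < t then t^-1 ^+ m * expR (- t^-1) else 0.

Lemma flat_ge0 m t : 0 <= flat m t.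
Proof.
rewrite /flat; case: ifP => // t0.
by rewrite mulr_ge0 ?expR_ge0// exprn_ge0// invr_ge0 ltW.
Qed.

Lemma flat0_gt0 t : 0 < t -> 0 < flat 0 t.
Proof. by move=> t0; rewrite /flat t0 expr0 mul1r expR_gt0. Qed.

Lemma flat_le0 m t : t <= 0 -> flat m t = 0.
Proof. by move=> t0; rewrite /flat ltNge t0. Qed.

(** For m > 0, exp(s) is the m-th power of exp(s / m), and exp(s / m) is at least s / m. *)
Lemma expR_dominates m s : 0 <= s -> s ^+ m * expR (- s) <= m%:R ^+ m.
Proof.
move=> s0; case: m => [|m]; first by rewrite !expr0 mul1r -[leRHS]expR0 ler_expR oppr_le0.
rewrite expRN ler_pdivrMr ?expR_gt0//.
have -> : expR s = expR (s / m.+1%:R) ^+ m.+1.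
  by rewrite -expRM_natl; congr expR; rewrite mulrC divfK.
rewrite -exprMn lerXn2r ?nnegrE ?mulr_ge0 ?expR_ge0//.
rewrite mulrC -ler_pdivrMr// (le_trans _ (expR_ge1Dx _))//.
by rewrite lerDr.
Qed.

Lemma flat_le m t : flat m t <= m%:R ^+ m.
Proof.
rewrite /flat; case: ifP => t0; first by apply: expR_dominates; rewrite invr_ge0 ltW.
by rewrite exprn_ge0.
Qed.

(** Since [flat m.+2] is bounded, this shows that [flat m] vanishes to second order at 0, which is
    the quadratic remainder needed for its derivative there. *)
Lemma flat_sqr m t : flat m t = t ^+ 2 * flat m.+2 t.
Proof.
rewrite /flat; case: ifPn => t0; last by rewrite mulr0.
rewrite mulrA; congr (_ * _).
by rewrite -(addn2 m) exprD mulrCA -exprMn divff ?gt_eqF// expr1n mulr1.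
Qed.

Definition dflat m t : R := flat m.+2 t - m%:R * flat m.+1 t.

Lemma is_derive_flat m t : is_derive t 1 (flat m) (dflat m t).
Proof.
have [t0|t0|->] := ltrgtP t 0.
- have -> : dflat m t = 0 by rewrite /dflat !flat_le0 ?ltW// mulr0 subrr.
  apply: (near_eq_is_derive _ (is_derive_cst 0 t 1)).
  have : nbhs t [set s : R | s < 0] by apply: open_nbhs_nbhs; split=> //; exact: open_lt.
  by apply: filterS => s /= s0; rewrite flat_le0// ltW.
- have Hu : is_derive t 1 (fun s : R => s^-1) (- t ^- 2 *: 1).
    by apply: is_deriveV; rewrite gt_eqF.
  have He : is_derive t 1 (expR \o (fun s : R => - s^-1)) (expR (- t^-1) * (- (- t ^- 2 *: 1))).
    by apply: is_derive1_comp; exact: is_deriveN.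
  have H := is_deriveM (is_deriveX m Hu) He.
  apply: (near_eq_is_derive (f := (fun s : R => s^-1) ^+ m * (expR \o (fun s : R => - s^-1)))).
    have : nbhs t [set s : R | 0 < s] by apply: open_nbhs_nbhs; split=> //; exact: open_gt.
    by apply: filterS => s /= s0; rewrite /flat s0 !fctE.
  apply: is_derive_eq H _; rewrite !fctE /= /dflat /flat t0.
  rewrite -exprVn /GRing.scale /=; case: m => [|m]; first by rewrite !expr0; ring.
  by rewrite /= !exprS; ring.
- have -> : dflat m 0 = 0 by rewrite /dflat !flat_le0// mulr0 subrr.
  apply: (@is_derive_quadratic _ _ _ _ _ _ (m.+2%:R ^+ m.+2)) => h.
  rewrite addr0 [h *: 1]mulr1 (@flat_le0 _ 0)// mulr0 !subr0 ger0_norm ?flat_ge0//.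
  by rewrite flat_sqr mulrC ler_wpM2r ?sqr_ge0// flat_le.
Qed.

Lemma flat_lipschitz m t s :
  `|flat m t - flat m s| <= (m.+2%:R ^+ m.+2 + m%:R * m.+1%:R ^+ m.+1) * `|t - s|.
Proof.
have dle r : `|dflat m r| <= m.+2%:R ^+ m.+2 + m%:R * m.+1%:R ^+ m.+1.
  apply: le_trans (ler_normB _ _) _; rewrite normrM !ger0_norm ?flat_ge0//.
  by rewrite lerD ?flat_le// ler_wpM2l ?flat_le.
have H (a b : R) : a < b -> `|flat m b - flat m a| <=
    (m.+2%:R ^+ m.+2 + m%:R * m.+1%:R ^+ m.+1) * `|b - a|.
  move=> ab.
  have cflat : {within `[a, b], continuous (flat m)}.
    apply: derivable_within_continuous => r _.
    by have [] := is_derive_flat m r.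
  have [r _ ->] := MVT ab (fun r _ => is_derive_flat m r) cflat.
  by rewrite normrM ler_wpM2r.
case: (ltgtP s t) => [st|st|->].
- exact: H.
- by rewrite distrC (distrC t); exact: H.
- by rewrite !subrr !normr0 mulr0.
Qed.

End flat_function.

(** * The algebra of bounded Lipschitz functions *)

Section bounded_lipschitz.
Context {R : realType} {n : nat}.
Local Notation E := 'rV[R]_n.
Implicit Types (f g : E -> R).

(** Boundedness is included so that the class is closed under products; one constant serves both
    bounds. *)
Definition bounded_lipschitz f := exists2 C : R, 0 <= C &
  (forall x, `|f x| <= C) /\ (forall x y, `|f x - f y| <= C * `|x - y|).

Lemma bounded_lipschitz_continuous f : bounded_lipschitz f -> continuous f.
Proof. by case=> C _ [_]; exact: lipschitz_continuous. Qed.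

Lemma bounded_lipschitz_measurable f : bounded_lipschitz f -> measurable_fun setT f.
Proof. by move=> /bounded_lipschitz_continuous; exact: continuous_measurable_rV. Qed.

Lemma bounded_lipschitz_cst (c : R) : bounded_lipschitz (fun=> c).
Proof.
exists `|c| => //; split => // x y.
by rewrite subrr normr0 mulr_ge0.
Qed.

Lemma bounded_lipschitz_comp f (phi : R -> R) (K : R) : 0 <= K ->
  (forall x y, `|phi (f x) - phi (f y)| <= K * `|f x - f y|) ->
  bounded_lipschitz f -> bounded_lipschitz (fun x => phi (f x)).
Proof.
move=> K0 Hphi [C C0 [fC lf]].
exists (`|phi (f 0)| + K * (C + C)) => //; first by rewrite addr_ge0// mulr_ge0// addr_ge0.
split=> [x|x y].
  have -> : phi (f x) = phi (f 0) + (phi (f x) - phi (f 0)) by ring.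
  rewrite (le_trans (ler_normD _ _))// lerD2l (le_trans (Hphi _ _))// ler_wpM2l//.
  by rewrite (le_trans (ler_normB _ _))// lerD.
rewrite (le_trans (Hphi _ _))//.
apply: (@le_trans _ _ (K * (C * `|x - y|))); first by rewrite ler_wpM2l.
rewrite mulrA ler_wpM2r//.
have : 0 <= K * C by rewrite mulr_ge0.
have : 0 <= `|phi (f 0)| by [].
by rewrite mulrDr; lra.
Qed.

Lemma bounded_lipschitzD f g : bounded_lipschitz f -> bounded_lipschitz g ->
  bounded_lipschitz (fun x => f x + g x).
Proof.
move=> [C C0 [fC lf]] [D D0 [gD lg]]; exists (C + D); first exact: addr_ge0.
split=> [x|x y]; first by rewrite (le_trans (ler_normD _ _))// lerD.
by rewrite opprD addrACA (le_trans (ler_normD _ _))// mulrDl lerD.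
Qed.

Lemma bounded_lipschitzM f g : bounded_lipschitz f -> bounded_lipschitz g ->
  bounded_lipschitz (fun x => f x * g x).
Proof.
move=> [C C0 [fC lf]] [D D0 [gD lg]].
exists (C * D + C * D); first by rewrite addr_ge0// mulr_ge0.
split=> [x|x y].
  by rewrite normrM (@le_trans _ _ (C * D))// ?ler_pM// lerDl mulr_ge0.
have -> : f x * g x - f y * g y = f x * (g x - g y) + (f x - f y) * g y by ring.
apply: le_trans (ler_normD _ _) _; rewrite [leRHS]mulrDl !normrM lerD//.
  by rewrite -mulrA ler_pM.
by rewrite [C * D * _]mulrAC ler_pM.
Qed.

Lemma bounded_lipschitzN f : bounded_lipschitz f -> bounded_lipschitz (fun x => - f x).
Proof.
move=> Lf; rewrite (_ : (fun _ => _) = (fun x => -1 * f x)).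
  exact: bounded_lipschitzM (bounded_lipschitz_cst _) Lf.
by apply/funext => x; rewrite mulN1r.
Qed.

Lemma bounded_lipschitzB f g : bounded_lipschitz f -> bounded_lipschitz g ->
  bounded_lipschitz (fun x => f x - g x).
Proof. by move=> Lf Lg; exact/bounded_lipschitzD/bounded_lipschitzN. Qed.

Lemma bounded_lipschitz_norm f : bounded_lipschitz f -> bounded_lipschitz (fun x => `|f x|).
Proof.
apply: (@bounded_lipschitz_comp _ (fun t => `|t|) 1) => // x y.
by rewrite mul1r; exact: ler_dist_dist.
Qed.

Lemma bounded_lipschitzV f (e : R) : 0 < e -> (forall x, e <= f x) ->
  bounded_lipschitz f -> bounded_lipschitz (fun x => (f x)^-1).
Proof.
move=> e0 fe; apply: (@bounded_lipschitz_comp _ (fun t => t^-1) (e ^- 2)).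
  by rewrite invr_ge0 exprn_ge0// ltW.
move=> x y.
have fx0 z : 0 < f z by exact: lt_le_trans (fe z).
have -> : (f x)^-1 - (f y)^-1 = (f x)^-1 * (f y)^-1 * (f y - f x).
  by field; rewrite !gt_eqF.
rewrite normrM (distrC (f y)) ler_wpM2r// normrM !normfV !gtr0_norm//.
rewrite expr2 invfM; apply: ler_pM; by rewrite ?invr_ge0 ?lef_pV2 ?posrE ?(ltW (fx0 _)).
Qed.

Lemma bounded_lipschitz_coord_flat m (a b : R) (i : 'I_n) :
  bounded_lipschitz (fun x : E => flat m (a * x ord0 i + b)).
Proof.
pose L : R := m.+2%:R ^+ m.+2 + m%:R * m.+1%:R ^+ m.+1.
have L0 : 0 <= L by rewrite addr_ge0// ?mulr_ge0// exprn_ge0.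
exists (m%:R ^+ m + L * `|a|); first by rewrite addr_ge0 ?exprn_ge0 ?mulr_ge0.
split=> [x|x y].
  by rewrite ger0_norm ?flat_ge0// (le_trans (flat_le _ _))// lerDl mulr_ge0.
rewrite (le_trans (flat_lipschitz _ _ _))// -/L.
have -> : a * x ord0 i + b - (a * y ord0 i + b) = a * (x - y) ord0 i by rewrite !mxE; ring.
rewrite normrM mulrA; apply: ler_pM => //; [by rewrite mulr_ge0| |exact: rV_coord_le].
by rewrite lerDr exprn_ge0.
Qed.

End bounded_lipschitz.

(** * Smooth bumps and their derivatives *)

Section bump_expressions.
Context {R : realType} {n : nat}.
Local Notation E := 'rV[R]_n.

(* Mollifiers are represented by terms over the functions [flat m] of affine
   functions of one coordinate, a class closed under partial derivatives, so that
   smoothness reduces to a structural recursion. *)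
Inductive bexp : Type :=
| BConst of R
| BFlat of nat & R & R & 'I_n
| BAdd of bexp & bexp
| BMul of bexp & bexp.

Fixpoint beval (e : bexp) (x : E) : R :=
  match e with
  | BConst c => c
  | BFlat m a b i => flat m (a * x ord0 i + b)
  | BAdd e1 e2 => beval e1 x + beval e2 x
  | BMul e1 e2 => beval e1 x * beval e2 x
  end.

Fixpoint bderiv (i : 'I_n) (e : bexp) : bexp :=
  match e with
  | BConst _ => BConst 0
  | BFlat m a b j => BMul (BConst (if i == j then a else 0))
      (BAdd (BFlat m.+2 a b j) (BMul (BConst (- m%:R)) (BFlat m.+1 a b j)))
  | BAdd e1 e2 => BAdd (bderiv i e1) (bderiv i e2)
  | BMul e1 e2 => BAdd (BMul e1 (bderiv i e2)) (BMul e2 (bderiv i e1))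
  end.

(** The test functions are translates of a mollifier, so translation has to stay within the
    terms. *)
Fixpoint bshift (v : E) (e : bexp) : bexp :=
  match e with
  | BConst c => BConst c
  | BFlat m a b i => BFlat m a (a * v ord0 i + b) i
  | BAdd e1 e2 => BAdd (bshift v e1) (bshift v e2)
  | BMul e1 e2 => BMul (bshift v e1) (bshift v e2)
  end.

Lemma beval_shift v e x : beval (bshift v e) x = beval e (x + v).
Proof.
elim: e => [c|m a b i|e1 IH1 e2 IH2|e1 IH1 e2 IH2] //=; last 2 first.
- by rewrite IH1 IH2.
- by rewrite IH1 IH2.
by rewrite mxE mulrDr addrA.
Qed.

Lemma bderiv_shift v e i : bderiv i (bshift v e) = bshift v (bderiv i e).
Proof.
elim: e => [c|m a b j|e1 IH1 e2 IH2|e1 IH1 e2 IH2] //=.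
- by rewrite IH1 IH2.
- by rewrite IH1 IH2.
Qed.

Lemma bounded_lipschitz_beval e : bounded_lipschitz (beval e).
Proof.
elim: e => [c|m a b i|e1 IH1 e2 IH2|e1 IH1 e2 IH2] /=.
- exact: bounded_lipschitz_cst.
- exact: bounded_lipschitz_coord_flat.
- exact: bounded_lipschitzD.
- exact: bounded_lipschitzM.
Qed.

Lemma is_derive_beval e i (x : E) :
  is_derive x (delta_mx ord0 i) (beval e) (beval (bderiv i e) x).
Proof.
elim: e => [c|m a b j|e1 IH1 e2 IH2|e1 IH1 e2 IH2] /=.
- exact: is_derive_cst.
- have H : is_derive x (delta_mx ord0 i) (fun x : E => a * x ord0 j + b) (if i == j then a else 0).
    apply: (@is_derive_quadratic _ _ _ _ _ _ 0) => h.
    rewrite !mxE /= mul0r.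
    have z (w : R) : w = 0 -> `|w| <= 0 by move=> ->; rewrite normr0.
    by apply: z; rewrite (eq_sym j i); case: (i == j) => /=; ring.
  have := is_derive_chain H (is_derive_flat m (a * x ord0 j + b)).
  by move=> H1; apply: is_derive_eq H1 _; rewrite /dflat; ring.
- exact: is_deriveD.
- by apply: is_derive_eq (is_deriveM IH1 IH2) _.
Qed.

Lemma partial_beval e i : partial i (beval e) = beval (bderiv i e).
Proof. by apply/funext => x; rewrite /partial; have [_ ->] := is_derive_beval e i x. Qed.

Lemma smooth_beval e : smooth (beval e).
Proof.
move=> s; have -> : foldr partial (beval e) s = beval (foldr bderiv e s).
  by elim: s => [//|i s IH] /=; rewrite IH partial_beval.
split; first exact/bounded_lipschitz_continuous/bounded_lipschitz_beval.
by move=> i x; have [] := is_derive_beval (foldr bderiv e s) i x.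
Qed.

Lemma laplacian_beval e x : laplacian (beval e) x = \sum_(i < n) beval (bderiv i (bderiv i e)) x.
Proof. by rewrite /laplacian; apply: eq_bigr => i _; rewrite !partial_beval. Qed.

Definition bprod (s : seq 'I_n) (e : 'I_n -> bexp) : bexp :=
  foldr (fun i b => BMul (e i) b) (BConst 1) s.

Lemma beval_prod s e x : beval (bprod s e) x = \prod_(i <- s) beval (e i) x.
Proof.
elim: s => [|i s IH] /=; first by rewrite big_nil.
by rewrite big_cons IH.
Qed.

(** For d > 0 the two factors of index [i] are both positive exactly when -d < x_i < d, so the
    product is positive on the open ball of radius [d] of the sup norm and vanishes outside. It is
    not yet normalised. *)
Definition bump_expr (d : R) : bexp :=
  bprod (enum 'I_n) (fun i => BMul (BFlat 0 d^-1 1 i) (BFlat 0 (- d^-1) 1 i)).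

Lemma bumpE d x : beval (bump_expr d) x =
  \prod_(i < n) (flat 0 (d^-1 * x ord0 i + 1) * flat 0 (- d^-1 * x ord0 i + 1)).
Proof. by rewrite /bump_expr beval_prod big_enum. Qed.

Lemma bump_ge0 d x : 0 <= beval (bump_expr d) x.
Proof. by rewrite bumpE; apply: prodr_ge0 => i _; rewrite mulr_ge0 ?flat_ge0. Qed.

Lemma bump_even d x : beval (bump_expr d) (- x) = beval (bump_expr d) x.
Proof.
rewrite !bumpE; apply: eq_bigr => i _; rewrite !mxE mulrC; congr (flat 0 _ * flat 0 _).
  by rewrite mulrNN.
by rewrite mulrN mulNr.
Qed.

Lemma bump_gt0 d x : 0 < d -> `|x| < d -> 0 < beval (bump_expr d) x.
Proof.
move=> d0 /(rV_norm_ltP _ d0) xd; rewrite bumpE; apply: prodr_gt0 => i _.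
have /[!ltr_norml]/andP[a b] := xd i.
rewrite mulr_gt0// flat0_gt0//.
  by rewrite -ltrBlDr sub0r mulrC ltr_pdivlMr// mulN1r.
by rewrite mulNr addrC subr_gt0 mulrC ltr_pdivrMr// mul1r.
Qed.

Lemma bump_eq0 d x : 0 < d -> d <= `|x| -> beval (bump_expr d) x = 0.
Proof.
move=> d0 dx; rewrite bumpE.
have [i di] : exists i, d <= `|x ord0 i|.
  apply: contrapT => /forallNP H.
  have : `|x| < d by apply/(rV_norm_ltP _ d0) => i; rewrite ltNge; apply/negP/H.
  by rewrite ltNge dx.
rewrite (bigD1 i)//=.
move: di; rewrite ler_normr => /orP[di|di].
  rewrite (@flat_le0 _ 0 (- d^-1 * x ord0 i + 1)) ?mulr0 ?mul0r//.
  by rewrite mulNr addrC subr_le0 mulrC ler_pdivlMr// mul1r.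
rewrite (@flat_le0 _ 0 (d^-1 * x ord0 i + 1)) ?mul0r//.
by rewrite -lerBrDr sub0r mulrC ler_pdivrMr// mulN1r lerNr.
Qed.

(** The inequality on [x] is strict because vanishing of the derivative needs a whole neighbourhood
    on which the function is 0. *)
Lemma bderiv_eq0 e d s x : (forall y, d <= `|y| -> beval e y = 0) -> d < `|x| ->
  beval (foldr bderiv e s) x = 0.
Proof.
move=> e0; elim: s x => [|i s IH] x dx /=; first by rewrite e0// ltW.
have [_ <-] := is_derive_beval (foldr bderiv e s) i x.
have H0 : is_derive x (delta_mx ord0 i) (cst 0 : E -> R) 0 by exact: is_derive_cst.
have [] // := near_eq_is_derive _ H0 (g := beval (foldr bderiv e s)).
have oU : open [set y : E | d < `|y|].
  apply: (@open_comp _ _ (fun y : E => `|y|) [set t | d < t]); last exact: open_gt.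
  by move=> y _; exact: norm_continuous.
have : nbhs x [set y : E | d < `|y|] by apply: open_nbhs_nbhs; split.
by apply: filterS => y /= dy; rewrite IH.
Qed.

End bump_expressions.

(** * Convolution of an integrable function with a bump term *)

Section convolution.
Context {R : realType} {n : nat}.
Local Notation E := 'rV[R]_n.
Local Notation mu := (@lebesgue_rV R n).
Local Notation L1 f := (mu.-integrable setT (EFin \o f)).
Implicit Types (f g p : E -> R) (e : @bexp R n).

Lemma taylor1_lipschitz f g (v x : E) (L h : R) :
  (forall y, is_derive y v f (g y)) ->
  (forall y z, `|g y - g z| <= L * `|y - z|) -> 0 <= L ->
  `|f (h *: v + x) - f x - h * g x| <= L * `|v| * h ^+ 2.
Proof.
move=> dfg lg L0.
pose phi (t : R) := f (x + t *: v).
have dphi (t : R) : is_derive t 1 phi (g (x + t *: v)).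
  exact: (is_derive_line f x v t _).1.
have H (a b : R) : a < b -> exists2 c, a < c < b & phi b - phi a = g (x + c *: v) * (b - a).
  move=> ab; have cphi : {within `[a, b], continuous phi}.
    by apply: derivable_within_continuous => r _; have [] := dphi r.
  have [c cab ->] := MVT ab (fun r _ => dphi r) cphi.
  by exists c => //; move: cab; rewrite in_itv.
have -> : f (h *: v + x) = phi h by rewrite /phi addrC.
have -> : f x = phi 0 by rewrite /phi scale0r addr0.
have K (c : R) : `|c| <= `|h| -> phi h - phi 0 = g (x + c *: v) * h ->
    `|phi h - phi 0 - h * g x| <= L * `|v| * h ^+ 2.
  move=> ch ->; rewrite mulrC -mulrBr normrM.
  rewrite -(@real_normK _ h) ?num_real// expr2 mulrA mulrC ler_wpM2r//.
  rewrite (le_trans (lg _ _))// addrAC subrr add0r mx_normZ.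
  by rewrite -mulrA ler_wpM2l// mulrC ler_wpM2l.
case: (ltgtP h 0) => [h0|h0|->].
- have [c /andP[hc c0] E0] := H _ _ h0; apply: (K c).
    by rewrite !ltr0_norm// lerN2 ltW.
  by rewrite -opprB E0 sub0r mulrN opprK.
- have [c /andP[c0 ch] E0] := H _ _ h0; apply: (K c).
    by rewrite !gtr0_norm// ltW.
  by rewrite E0 subr0.
- by rewrite subrr mul0r subr0 normr0 expr0n/= mulr0.
Qed.

(* convolution of [p] with the reflection of [e] *)
Definition convol p e (x : E) : R := \int[mu]_y (p y * beval e (y - x)).

Lemma bounded_lipschitz_beval_sub e (x : E) : bounded_lipschitz (fun y => beval e (y - x)).
Proof.
rewrite (_ : (fun _ => _) = beval (bshift (- x) e)); first exact: bounded_lipschitz_beval.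
by apply/funext => y; rewrite beval_shift.
Qed.

Lemma L1_bounded_lipschitz f g : bounded_lipschitz g -> L1 f -> L1 (fun x => f x * g x).
Proof.
move=> bg; have mg := bounded_lipschitz_measurable bg.
by case: bg => C _ [gC _]; exact: (L1_bounded mg gC).
Qed.

Lemma L1_convol p e x : L1 p -> L1 (fun y => p y * beval e (y - x)).
Proof. exact/L1_bounded_lipschitz/bounded_lipschitz_beval_sub. Qed.

Lemma convol_ge0 p e x : (forall y, 0 <= p y) -> (forall y, 0 <= beval e y) -> 0 <= convol p e x.
Proof. by move=> p0 e0; apply: Rintegral_ge0 => y _; rewrite mulr_ge0. Qed.

Lemma bounded_lipschitz_convol p e : L1 p -> bounded_lipschitz (convol p e).
Proof.
move=> Lp; have [C C0 [eC le]] := bounded_lipschitz_beval e.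
have Lap := L1_abs Lp.
have I0 : 0 <= \int[mu]_y `|p y| by exact: Rintegral_ge0.
exists (C * \int[mu]_y `|p y|); first by rewrite mulr_ge0.
have bnd (F : E -> R) (D : R) : L1 (fun y => p y * F y) -> (forall y, `|F y| <= D) ->
    `|\int[mu]_y (p y * F y)| <= D * \int[mu]_y `|p y|.
  move=> LF FD; rewrite (le_trans (le_normr_Rintegral _ LF))//.
  rewrite -RintegralZl//; apply: le_Rintegral => //.
  - exact: (L1_abs LF).
  - exact: L1Z.
  - by move=> y _; rewrite normrM mulrC ler_wpM2r.
split=> [x|x y]; first by apply: bnd; [exact: L1_convol|move=> y; exact: eC].
rewrite /convol -RintegralB//; [|exact: L1_convol|exact: L1_convol].
under eq_Rintegral do rewrite -mulrBr.
rewrite [leRHS]mulrAC; apply: bnd => [|z].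
  apply: L1_bounded_lipschitz => //; apply: bounded_lipschitzB; exact: bounded_lipschitz_beval_sub.
by rewrite (le_trans (le _ _))// opprD addrACA subrr add0r opprK addrC distrC.
Qed.

Lemma norm_delta_mx_le (i : 'I_n) : `|delta_mx ord0 i : E| <= 1.
Proof.
apply/(rV_norm_leP _ ler01) => j; rewrite !mxE eqxx /=.
by case: (j == i); rewrite ?normr1 ?normr0.
Qed.

(** The Taylor remainder of the kernel is bounded by L h^2 uniformly in [y], hence integrates
    against [p] to a quadratic remainder. The sign comes from the kernel being evaluated at
    [y - x]. *)
Lemma is_derive_convol p e i x : L1 p ->
  is_derive x (delta_mx ord0 i) (convol p e) (- convol p (bderiv i e) x).
Proof.
move=> Lp; have [L L0 [_ le]] := bounded_lipschitz_beval (bderiv i e).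
set v := delta_mx ord0 i.
have Lap := L1_abs Lp.
apply: (@is_derive_quadratic _ _ _ _ _ _ (L * \int[mu]_y `|p y|)) => h.
have -> : convol p e (h *: v + x) - convol p e x - h * - convol p (bderiv i e) x =
    \int[mu]_y (p y * (beval e (y - (h *: v + x)) - beval e (y - x) + h * beval (bderiv i e) (y - x))).
  rewrite /convol mulrN opprK -RintegralZl//; last exact: L1_convol.
  rewrite -RintegralB//; [|exact: L1_convol|exact: L1_convol].
  rewrite -RintegralD//.
  - by apply: eq_Rintegral => y _; ring.
  - by apply: L1B; exact: L1_convol.
  - by apply: L1Z; exact: L1_convol.
have Lq : L1 (fun y => p y * (beval e (y - (h *: v + x)) - beval e (y - x) + h * beval (bderiv i e) (y - x))).
  apply: L1_bounded_lipschitz => //; apply: bounded_lipschitzD.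
    by apply: bounded_lipschitzB; exact: bounded_lipschitz_beval_sub.
  by apply: bounded_lipschitzM; [exact: bounded_lipschitz_cst|exact: bounded_lipschitz_beval_sub].
rewrite (le_trans (le_normr_Rintegral _ Lq))//.
rewrite [leRHS]mulrAC -RintegralZl//; apply: le_Rintegral => //.
- exact: (L1_abs Lq).
- exact: L1Z.
move=> y _; rewrite normrM mulrC ler_wpM2r//.
have := @taylor1_lipschitz (beval e) (beval (bderiv i e)) v (y - x) L (- h)
   (fun z => is_derive_beval e i z) le L0.
rewrite sqrrN mulNr opprK.
have -> : - h *: v + (y - x) = y - (h *: v + x) by rewrite scaleNr opprD addrCA.
by move=> /le_trans; apply; rewrite ler_wpM2r ?sqr_ge0// ler_piMr// norm_delta_mx_le.
Qed.

End convolution.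

(** * Density of bounded Lipschitz functions in L1 of a ball *)

Section density.
Import HBSimple.
Context {R : realType} {n : nat} (M : R).
Local Notation E := 'rV[R]_n.
Local Notation mu := (@lebesgue_rV R n).
Local Notation L1 f := (mu.-integrable setT (EFin \o f)).
Local Notation B := [set x : E | `|x| <= M].
Implicit Types (f g b : E -> R).

(** The approximation is asked only on the ball: constants are integrable there, so the class
    contains 1 and is stable under complements of indicators. *)
Definition L1_approx f := L1 (fun x => \1_B x * f x) /\ measurable_fun setT f /\
  forall t, 0 < t -> exists2 b, bounded_lipschitz b & \int[mu]_x (\1_B x * `|f x - b x|) <= t.

Let mB : measurable_fun setT (\1_B : E -> R).
Proof. by apply: measurable_indic; exact: measurable_rV_normball. Qed.

Let B0 x : 0 <= \1_B x :> R. Proof. by []. Qed.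

Let LB b : bounded_lipschitz b -> L1 (fun x => \1_B x * b x).
Proof. by move=> bb; exact: (L1_bounded_lipschitz bb (L1_normball M)). Qed.

Let Labs f : L1 (fun x => \1_B x * f x) -> L1 (fun x => \1_B x * `|f x|).
Proof.
move=> /L1_abs; congr (integrable _ _ _); apply/funext => x /=.
by rewrite normrM (ger0_norm (B0 x)).
Qed.

Let Ldiff f g : L1 (fun x => \1_B x * f x) -> L1 (fun x => \1_B x * g x) ->
  L1 (fun x => \1_B x * `|f x - g x|).
Proof.
move=> Lf Lg; apply: Labs.
rewrite (_ : (fun _ => _) = (fun x => \1_B x * f x - \1_B x * g x)); first exact: L1B.
by apply/funext => x; rewrite mulrBr.
Qed.

Lemma L1_approx_bounded_lipschitz b : bounded_lipschitz b -> L1_approx b.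
Proof.
move=> bb; split; first exact: LB.
split; first exact: bounded_lipschitz_measurable.
move=> t t0; exists b => //.
under eq_Rintegral do rewrite subrr normr0 mulr0.
by rewrite Rintegral_cst// mul0r ltW.
Qed.

Lemma L1_approxD f g : L1_approx f -> L1_approx g -> L1_approx (fun x => f x + g x).
Proof.
move=> [Lf [mf af]] [Lg [mg ag]]; split.
  by under [X in EFin \o X]eq_fun do rewrite mulrDr; exact: L1D.
split; first exact: measurable_funD.
move=> t t0; have t20 : 0 < t / 2 by rewrite divr_gt0.
have [b bb fb] := af _ t20; have [c bc gc] := ag _ t20.
exists (fun x => b x + c x); first exact: bounded_lipschitzD.
rewrite (splitr t); apply: le_trans (lerD fb gc).
rewrite -RintegralD//; [|exact/Ldiff/LB|exact/Ldiff/LB].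
apply: le_Rintegral => //.
- apply: Ldiff; last exact/LB/bounded_lipschitzD.
  by under [X in EFin \o X]eq_fun do rewrite mulrDr; exact: L1D.
- by apply: L1D; exact/Ldiff/LB.
- move=> x _; rewrite -mulrDr ler_wpM2l// opprD addrACA.
  exact: ler_normD.
Qed.

Lemma L1_approxZ (c : R) f : L1_approx f -> L1_approx (fun x => c * f x).
Proof.
move=> [Lf [mf af]]; have Lcf : L1 (fun x => \1_B x * (c * f x)).
  by under [X in EFin \o X]eq_fun do rewrite mulrCA; exact: L1Z.
split=> //; split; first exact: measurable_funM.
move=> t t0; have c1 : 0 < `|c| + 1 by rewrite ltr_wpDl.
have t20 : 0 < t / (`|c| + 1) by rewrite divr_gt0.
have [b bb fb] := af _ t20.
have bcb : bounded_lipschitz (fun x => c * b x).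
  by apply: bounded_lipschitzM => //; exact: bounded_lipschitz_cst.
exists (fun x => c * b x) => //.
apply: (@le_trans _ _ ((`|c| + 1) * \int[mu]_x (\1_B x * `|f x - b x|))); last first.
  by rewrite mulrC -ler_pdivlMr.
rewrite -RintegralZl//; last exact/Ldiff/LB.
apply: le_Rintegral => //.
- exact/Ldiff/LB.
- exact/L1Z/Ldiff/LB.
- move=> x _; rewrite -mulrBr normrM mulrCA.
  by rewrite ler_wpM2r ?mulr_ge0// lerDl.
Qed.

Lemma L1_approx_norm f : L1_approx f -> L1_approx (fun x => `|f x|).
Proof.
move=> [Lf [mf af]]; split; first exact: Labs.
split; first exact: measurableT_comp.
move=> t t0; have [b bb fb] := af _ t0.
exists (fun x => `|b x|); first exact: bounded_lipschitz_norm.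
apply: le_trans fb; apply: le_Rintegral => //.
- apply: Ldiff; first exact: Labs.
  exact/LB/bounded_lipschitz_norm.
- exact/Ldiff/LB.
- by move=> x _; rewrite ler_wpM2l// ler_dist_dist.
Qed.

Lemma L1_approx_cvg (F : nat -> E -> R) f :
  (forall k, L1_approx (F k)) -> L1 (fun x => \1_B x * f x) -> measurable_fun setT f ->
  \int[mu]_x (\1_B x * `|F k x - f x|) @[k --> \oo] --> 0 -> L1_approx f.
Proof.
move=> aF Lf mf F0; split => //; split => // t t0.
have t20 : 0 < t / 2 by rewrite divr_gt0.
have /cvgrPdist_lt/(_ _ t20)[k _ /(_ k (leqnn k))/=] := F0.
rewrite sub0r normrN => H.
have [LF [mF]] := aF k; move=> /(_ _ t20)[b bb Fb].
exists b => //; rewrite (splitr t); apply: le_trans (lerD (ltW (le_lt_trans (ler_norm _) H)) Fb).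
rewrite -RintegralD//; [|exact: Ldiff|exact/Ldiff/LB].
apply: le_Rintegral => //.
- exact/Ldiff/LB.
- by apply: L1D; [exact: Ldiff|exact/Ldiff/LB].
- move=> x _; rewrite -mulrDr ler_wpM2l// (distrC (F k x)).
  by apply: le_trans (ler_normD _ _); rewrite addrA subrK.
Qed.

Lemma L1_approx_dominated (F : nat -> E -> R) f (C : R) :
  (forall k, L1_approx (F k)) -> (forall k x, `|F k x| <= C) ->
  (forall x, F k x @[k --> \oo] --> f x) -> L1_approx f.
Proof.
move=> aF FC Ff.
have mF k : measurable_fun setT (F k) by have [_ []] := aF k.
have mf : measurable_fun setT f by apply: (measurable_fun_cvg mF) => x _; exact: Ff.
have fC x : `|f x| <= C.
  by apply: (cvgr_to_le (cvg_norm (Ff x))); apply: nearW => k; exact: FC.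
have Lf : L1 (fun x => \1_B x * f x) by exact: (L1_bounded mf fC (L1_normball M)).
apply: (L1_approx_cvg aF Lf mf).
have : 0 = \int[mu]_x (cst 0 x : R) by rewrite Rintegral_cst// mul0r.
move=> ->.
have [] // := @Rintegral_dct _ _ _ mu (fun k x => \1_B x * `|F k x - f x|) (cst 0)
  (fun x => (C + C) * \1_B x).
- move=> k; apply: measurable_funM => //; apply: measurableT_comp => //.
  exact: measurable_funB.
- apply: aeW => x /=; rewrite -(mulr0 (\1_B x)); apply: cvgM; first exact: cvg_cst.
  rewrite -(normr0 R); apply: cvg_norm; rewrite -(subrr (f x)); apply: cvgB; first exact: Ff.
  exact: cvg_cst.
- exact: L1Z (L1_normball M).
- move=> k x; rewrite normrM normr_id (ger0_norm (B0 x)) mulrC ler_wpM2r//.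
  by rewrite (le_trans (ler_normB _ _))// lerD.
Qed.

Lemma L1_approx_indicC A : L1_approx (\1_A) -> L1_approx (\1_(~` A)).
Proof.
move=> aA; rewrite (_ : \1_(~` A) = (fun x => 1 + -1 * \1_A x)).
  apply: L1_approxD; last exact: L1_approxZ.
  exact/L1_approx_bounded_lipschitz/bounded_lipschitz_cst.
apply/funext => x; rewrite !indicE; have [xA|xA] := pselect (A x).
  by rewrite memNset ?mem_set//=; ring.
by rewrite mem_set ?memNset//=; ring.
Qed.

Lemma L1_approx_indicU A D : L1_approx (\1_A) -> L1_approx (\1_D) -> L1_approx (\1_(A `|` D)).
Proof.
(* The indicator of a union is a maximum, and max(a, b) = (a + b + |a - b|) / 2 stays in the class,
   which is closed under absolute values. *)
move=> aA aD; rewrite (_ : \1_(A `|` D) =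
  (fun x => 2^-1 * (\1_A x + \1_D x + `|\1_A x + -1 * \1_D x|))).
  apply: L1_approxZ; apply: L1_approxD; first exact: L1_approxD.
  by apply: L1_approx_norm; apply: L1_approxD => //; exact: L1_approxZ.
apply/funext => x; rewrite !indicE in_setU.
case: (x \in A); case: (x \in D); rewrite /= ?mulr0 ?addr0 ?add0r ?mulr1 ?subrr ?normr0 ?normr1 ?normrN1; lra.
Qed.

(** The sets with approximable indicator form a sigma-algebra, by complements, finite unions and
    dominated convergence. It therefore suffices to treat the half-spaces {x_i > a}, which generate
    the Borel sets through the coordinates. *)
Lemma L1_approx_indic A : measurable A -> L1_approx (\1_A).
Proof.
pose D : set (set E) := [set A | L1_approx (\1_A)].
have sD : sigma_algebra setT D.
  split.
  - rewrite /D /= indic0; exact/L1_approx_bounded_lipschitz/bounded_lipschitz_cst.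
  - by move=> Z DZ; rewrite setTD; exact: L1_approx_indicC.
  - move=> F DF.
    apply: (@L1_approx_dominated (fun k => \1_(\bigcup_(i < k) F i)) _ 1).
    + elim=> [|k ih]; first by rewrite bigcup_mkord big_ord0 indic0; exact/L1_approx_bounded_lipschitz/bounded_lipschitz_cst.
      rewrite bigcup_mkord big_ord_recr/= -bigcup_mkord.
      exact: (L1_approx_indicU ih (DF k)).
    + by move=> k x; rewrite indicE; case: (_ \in _); rewrite ?normr1 ?normr0.
    + move=> x; rewrite !indicE; have [[k _ Fkx]|nF] := pselect ((\bigcup_i F i) x).
        rewrite [in X in _ --> X]mem_set; last by exists k.
        apply: cvg_near_cst; exists k.+1 => // m /= km.
        by rewrite indicE mem_set//; exists k.
      rewrite [in X in _ --> X]memNset//; apply: cvg_near_cst; apply: nearW => m.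
      by rewrite indicE memNset// => -[i _ Fix]; apply: nF; exists i.
suff : (g_sigma_preimage (@coord_rV R n)) `<=` D by apply.
apply: smallest_sub => //; rewrite -bigcup_seq; apply: bigcup_sub => i _ _ [Y mY <-].
rewrite setTI.
pose Di : set (set (measurableTypeR R)) := [set Y | D (coord_rV i @^-1` Y)].
have sDi : sigma_algebra setT Di.
  have [D0 DC DU] := sD; split.
  - by rewrite /Di /= preimage_set0.
  - by move=> Z DZ; rewrite /Di /= setTD preimage_setC -setTD; exact: DC.
  - by move=> F DF; rewrite /Di /= preimage_bigcup; exact: DU.
suff : measurable `<=` Di by move=> /(_ _ mY).
rewrite RGenOInfty.measurableE; apply: smallest_sub => // _ [a ->].
rewrite /Di /D /=.
(* With n = k + 1, the value is exp(-1 / (n (x_i - a))), which tends to 1 when x_i > a, and it is 0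
   otherwise. *)
apply: (@L1_approx_dominated (fun k (x : E) => flat 0 (k.+1%:R * x ord0 i + - (k.+1%:R * a))) _ 1).
- move=> k; exact/L1_approx_bounded_lipschitz/bounded_lipschitz_coord_flat.
- by move=> k x; rewrite ger0_norm ?flat_ge0// (le_trans (flat_le _ _))// expr0.
- move=> x; rewrite indicE.
  under eq_fun do rewrite -mulrBr.
  have [xa|xa] := ltP a (x ord0 i).
    rewrite mem_set; last by rewrite /= /coord_rV in_itv/= xa.
    have xa0 : 0 < x ord0 i - a by rewrite subr_gt0.
    have -> : (fun k : nat => flat 0 (k.+1%:R * (x ord0 i - a))) =
        (fun k => expR (- (harmonic k * (x ord0 i - a)^-1))).
      by apply/funext => k; rewrite /flat mulr_gt0// expr0 mul1r invfM.
    suff : expR (- (harmonic k * (x ord0 i - a)^-1)) @[k --> \oo] --> expR (0 : R) by rewrite expR0.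
    apply: (@cvg_comp _ _ _ (fun k => - (harmonic k * (x ord0 i - a)^-1)) expR _ (nbhs (0 : R))); last exact: continuous_expR.
    have H0 : harmonic k * (x ord0 i - a)^-1 @[k --> \oo] --> 0 * (x ord0 i - a)^-1.
      by apply: cvgM; [exact: cvg_harmonic|exact: cvg_cst].
    have := cvgN H0; rewrite mul0r oppr0; exact.
  rewrite memNset; last by rewrite /= /coord_rV in_itv/= andbT ltNge xa.
  apply: cvg_near_cst; apply: nearW => k; rewrite flat_le0//.
  by rewrite mulr_ge0_le0// subr_le0.
Qed.

Lemma L1_approx_L1 f : L1 f -> L1_approx f.
Proof.
move=> Lf.
have [g [Lg gf gI]] := approximation_sfun_integrable measurableT Lf.
have LBf (h : E -> R) : L1 h -> L1 (fun x => \1_B x * h x).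
  move=> Lh; under [X in EFin \o X]eq_fun do rewrite mulrC.
  apply: (L1_bounded (C := 1)) => // x.
  by rewrite indicE; case: (_ \in _); rewrite ?normr1 ?normr0.
have aG k : L1_approx (fun x => g k x).
  rewrite (_ : (fun x => _) = (fun x => \sum_(r <- finmap.enum_fset (fset_set (range (g k)))) r * \1_(g k @^-1` [set r]) x)).
    elim: (finmap.enum_fset _) => [|r s ih].
      under eq_fun do rewrite big_nil; exact/L1_approx_bounded_lipschitz/bounded_lipschitz_cst.
    under eq_fun do rewrite big_cons.
    by apply: L1_approxD => //; apply: L1_approxZ; exact: L1_approx_indic.
  by apply/funext => x; rewrite [LHS]fimfunE fsbig_finite//=.
have gI' : \int[mu]_x `|f x - g k x| @[k --> \oo] --> 0 by exact: (fine_cvg gI).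
apply: (L1_approx_cvg aG (LBf _ Lf) (L1_measurable Lf)).
apply: (squeeze_cvgr _ (cvg_cst 0) gI'); apply: nearW => k.
apply/andP; split; first by apply: Rintegral_ge0 => x _; rewrite mulr_ge0.
have Ld : L1 (fun x => `|f x - g k x|) by apply: L1_abs; apply: L1B => //; exact: Lg.
apply: le_Rintegral => //.
- rewrite (_ : (fun x => _) = (fun x => \1_B x * `|f x - g k x|)); first exact: LBf.
  by apply/funext => x; rewrite distrC.
- by move=> x _; rewrite distrC ler_piMl// indicE; case: (_ \in _).
Qed.

End density.

(** * Normalised mollifiers and convergence in L1 *)

Section mollifier.
Context {R : realType} {n : nat}.
Local Notation E := 'rV[R]_n.
Local Notation mu := (@lebesgue_rV R n).
Local Notation L1 f := (mu.-integrable setT (EFin \o f)).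
Implicit Types (f g p : E -> R) (d : R).

Definition bmass d : R := \int[mu]_x beval (bump_expr d) (x : E).

Lemma L1_beval (e : @bexp R n) d : (forall y, d <= `|y| -> beval e y = 0) -> L1 (beval e).
Proof.
move=> e0; have be := bounded_lipschitz_beval e.
have [C _ [eC _]] := be.
apply: (@L1_bounded_support _ _ _ C d) => //; first exact: bounded_lipschitz_measurable.
by move=> x dx; rewrite e0// ltW.
Qed.

Lemma bmass_gt0 d : 0 < d -> 0 < bmass d.
Proof.
move=> d0; have Lb := L1_beval (fun y => @bump_eq0 R n d y d0).
have b0 x : 0 <= beval (bump_expr d) (x : E) by exact: bump_ge0.
rewrite lt_neqAle Rintegral_ge0// andbT; apply/negP => /eqP I0.
have I1 : (\int[mu]_x `|(beval (bump_expr d) x)%:E|)%E = 0%E.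
  under eq_integral do rewrite gee0_abs ?lee_fin//.
  by have <- := fineK (integrable_fin_num measurableT Lb); rewrite -/(Rintegral mu setT _) -/(bmass d) -I0.
have mb : measurable_fun setT (fun x : E => (beval (bump_expr d) x)%:E).
  by apply/measurable_EFinP; exact: (L1_measurable Lb).
have /(ae_eq_integral_abs mu measurableT mb) [N [mN N0 NS]] := I1.
have oB : open (ball (0 : E) d) by exact: ball_open.
have := @open_lebesgue_rV_gt0 R n _ 0 oB (ballxx _ d0).
suff -> : mu (ball (0 : E) d) = 0%E by rewrite ltxx.
apply/eqP; rewrite eq_le measure_ge0 andbT -N0 le_measure ?inE//.
  exact: measurable_rV_ball.
move=> x; rewrite rV_ballE /= sub0r normrN => xd; apply: NS => /= /(_ I)[] bx0.
by have := bump_gt0 d0 xd; rewrite bx0 ltxx.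
Qed.

Definition nbump d : @bexp R n := BMul (BConst (bmass d)^-1) (bump_expr d).

Lemma nbump_ge0 d x : 0 < d -> 0 <= beval (nbump d) x.
Proof. by move=> d0; rewrite mulr_ge0 ?bump_ge0// invr_ge0 ltW// bmass_gt0. Qed.

Lemma nbump_eq0 d x : 0 < d -> d <= `|x| -> beval (nbump d) x = 0.
Proof. by move=> d0 dx; rewrite /= bump_eq0// mulr0. Qed.

Lemma nbump_even d x : beval (nbump d) (- x) = beval (nbump d) x.
Proof. by rewrite /= bump_even. Qed.

Lemma L1_nbump d : 0 < d -> L1 (beval (nbump d)).
Proof. by move=> d0; apply: (@L1_beval _ d) => y; exact: nbump_eq0. Qed.

Lemma L1_nbump_sub d x : 0 < d -> L1 (fun y => beval (nbump d) (y - x)).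
Proof. by move=> d0; exact: (L1_shift (- x) (L1_nbump d0)). Qed.

Lemma Rintegral_nbump d x : 0 < d -> \int[mu]_y beval (nbump d) (y - x) = 1.
Proof.
move=> d0; rewrite (Rintegral_shift (- x) (L1_measurable (L1_nbump d0))).
rewrite /= RintegralZl//; last by apply: (@L1_beval _ d) => y; exact: bump_eq0.
by rewrite -/(bmass d) mulVf// gt_eqF// bmass_gt0.
Qed.

(** Mollification is a contraction of L1: by Tonelli's theorem the kernel may be integrated in [x]
    first, and since it is even this integral is again 1. *)
Lemma L1_moll f d : 0 < d -> L1 f ->
  L1 (convol f (nbump d)) /\ \int[mu]_x `|convol f (nbump d) x| <= \int[mu]_x `|f x|.
Proof.
move=> d0 Lf; have Laf := L1_abs Lf.
have bf := bounded_lipschitz_convol (nbump d) Lf.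
have mcf : measurable_fun setT (convol f (nbump d)) := bounded_lipschitz_measurable bf.
pose F (z : E * E) : \bar R := (`|f z.2| * beval (nbump d) (z.2 - z.1))%:E.
have mk : measurable_fun setT (fun z : E * E => beval (nbump d) (z.2 - z.1)).
  have ms : measurable_fun setT (fun z : E * E => z.2 - z.1).
    apply: measurable_fun_rVP => i; rewrite /comp /coord_rV.
    under eq_fun do rewrite !mxE.
    apply: measurable_funB.
      by apply: (measurableT_comp (measurable_coord_rV i)); exact: measurable_snd.
    by apply: (measurableT_comp (measurable_coord_rV i)); exact: measurable_fst.
  exact: (measurableT_comp (bounded_lipschitz_measurable (bounded_lipschitz_beval (nbump d))) ms).
have mF : measurable_fun setT F.
  apply/measurable_EFinP; apply: measurable_funM => //.
  have := measurableT_comp (L1_measurable Laf) (@measurable_snd _ _ E E).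
  exact.
have F0 z : (0 <= F z)%E by rewrite lee_fin mulr_ge0// nbump_ge0.
have tonelli := @fubini_tonelli _ _ _ _ _ mu mu F mF F0.
have rhs : (\int[mu]_y \int[mu]_x F (x, y) = \int[mu]_y `|f y|%:E)%E.
  apply: eq_integral => y _; rewrite /F.
  pose k x := beval (nbump d) (x - y).
  have Lk : L1 k by exact: L1_nbump_sub.
  transitivity (\int[mu]_x (`|f y|%:E * (k x)%:E))%E.
    by apply: eq_integral => x _; rewrite EFinM /k -opprB nbump_even.
  rewrite (integralZl measurableT Lk) -[X in (_ * X)%E](fineK (integrable_fin_num measurableT Lk)).
  have E1 : fine (\int[mu]_x (EFin \o k) x) = 1 by exact: (Rintegral_nbump y d0).
  by rewrite E1 mule1.
have le : (\int[mu]_x `|convol f (nbump d) x|%:E <= \int[mu]_y `|f y|%:E)%E.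
  rewrite -rhs -tonelli.
  have m1 : measurable_fun setT (fun x => `|convol f (nbump d) x|%:E).
    by apply/measurable_EFinP; apply: measurableT_comp; [exact: normr_measurable|exact: mcf].
  have m2 : measurable_fun setT (fun x => \int[mu]_y F (x, y))%E.
    exact: (@measurable_fun_fubini_tonelli_F _ _ _ _ _ mu F mF F0).
  have le12 x : setT x -> (`|convol f (nbump d) x|%:E <= \int[mu]_y F (x, y))%E.
    move=> _.
    have LF : L1 (fun y => `|f y| * beval (nbump d) (y - x)) by exact: (L1_convol (nbump d) x Laf).
    rewrite -(fineK (integrable_fin_num measurableT LF)) lee_fin.
    apply: le_trans (le_normr_Rintegral measurableT (L1_convol (nbump d) x Lf)) _.
    rewrite le_eqVlt; apply/orP; left; apply/eqP; apply: eq_Rintegral => y _.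
    by rewrite normrM (ger0_norm (nbump_ge0 _ d0)).
  by apply: (ge0_le_integral _ measurableT _ m1 m2 le12) => x _; rewrite lee_fin.
have fin : ((\int[mu]_y `|f y|%:E) \is a fin_num)%E by exact: integrable_fin_num.
have L : L1 (convol f (nbump d)).
  apply/integrableP; split; first exact/measurable_EFinP.
  by apply: le_lt_trans le _; rewrite ltey_eq fin.
split; first exact: L.
apply: (fine_le _ fin le).
exact: (integrable_fin_num measurableT (L1_abs L)).
Qed.

Lemma convol_sub_cst (c : R) f d x : 0 < d -> L1 f -> convol f (nbump d) x - c =
  \int[mu]_y ((f y - c) * beval (nbump d) (y - x)).
Proof.
move=> d0 Lf; have Lk := L1_nbump_sub x d0; have I1 := Rintegral_nbump x d0.
rewrite -[X in _ - X]mulr1 -I1 -RintegralZl// -RintegralB//; [|exact: L1_convol|exact: L1Z].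
by apply: eq_Rintegral => y _; rewrite mulrBl.
Qed.

(** The kernel of radius [d] sees [f] only near [x], so [f] may be a truncation of [b], which need
    not itself be integrable. *)
Lemma moll_lipschitz_le b d x (C : R) : 0 < d -> 0 <= C -> bounded_lipschitz b ->
  (forall y z, `|b y - b z| <= C * `|y - z|) ->
  forall f, L1 f -> (forall y, `|y - x| < d -> f y = b y) ->
  `|convol f (nbump d) x - b x| <= C * d.
Proof.
move=> d0 C0 bb lb f Lf fb.
have Lk := L1_nbump_sub x d0; have I1 := Rintegral_nbump x d0.
rewrite convol_sub_cst//.
have LF : L1 (fun y => (f y - b x) * beval (nbump d) (y - x)).
  under [X in EFin \o X]eq_fun do rewrite mulrBl.
  by apply: L1B; [exact: L1_convol|exact: L1Z].
rewrite (le_trans (le_normr_Rintegral _ LF))//.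
rewrite -[leRHS]mulr1 -I1 -RintegralZl//; apply: le_Rintegral => //.
- exact: L1_abs LF.
- exact: L1Z.
move=> y _; rewrite normrM (ger0_norm (nbump_ge0 _ d0)).
have [yx|yx] := ltP `|y - x| d; last by rewrite (@nbump_eq0 d)// !mulr0.
rewrite ler_wpM2r ?nbump_ge0// fb// (le_trans (lb _ _))// ler_wpM2l//.
exact: ltW.
Qed.

(** Write f = g + r with [g] a truncated Lipschitz function and [r] small in L1. The error is at
    most C d for [g] on the ball of radius [M]; for [r] the contraction property bounds it by twice
    the norm of [r]. Hence the three thirds of [t]. *)
Lemma moll_cvg f M t : 0 <= M -> L1 f -> (forall x, M < `|x| -> f x = 0) -> 0 < t ->
  exists2 d0, 0 < d0 & forall d, 0 < d -> d < d0 ->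
    \int[mu]_x (\1_[set x : E | `|x| <= M] x * `|convol f (nbump d) x - f x|) <= t.
Proof.
move=> M0 Lf fM t0.
have t30 : 0 < t / 3 by rewrite divr_gt0.
(* The approximation is made on the ball of radius M + 1: as d < 1, mollifying at a point of the
   ball of radius [M] involves only values where [g] equals [b]. *)
have [_ [_ /(_ _ t30)[b bb bI]]] := L1_approx_L1 (M + 1) Lf.
have [C C0 [_ lb]] := bb.
pose I := \int[mu]_x (\1_[set x : E | `|x| <= M] x : R).
have I0 : 0 <= I by exact: Rintegral_ge0.
have CI : 0 < C * I + 1 by rewrite ltr_wpDl// mulr_ge0.
exists (Num.min 1 (t / 3 / (C * I + 1))).
  by rewrite lt_min ltr01/= divr_gt0.
move=> d d0; rewrite lt_min => /andP[d1 dt].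
pose B1 : set E := [set x | `|x| <= M + 1].
pose g x := \1_B1 x * b x.
pose r x := f x - g x.
have Lg : L1 g by exact: (L1_bounded_lipschitz bb (L1_normball (M + 1))).
have Lr : L1 r by exact: L1B.
have rI : \int[mu]_x `|r x| <= t / 3.
  apply: le_trans bI; rewrite le_eqVlt; apply/orP; left; apply/eqP.
  apply: eq_Rintegral => x _; rewrite /r /g indicE; have [xM|xM] := leP `|x| (M + 1).
    by rewrite mem_set// !mul1r.
  rewrite memNset; last by apply/negP; rewrite -ltNge.
  rewrite !mul0r subr0 fM ?normr0//.
  by apply: le_lt_trans xM; rewrite lerDl.
have [Lcr crI] := L1_moll d0 Lr.
have L1B' := L1_normball (R := R) (n := n) M.
have LA : L1 (fun x => \1_[set x : E | `|x| <= M] x * (C * d)).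
  by under [X in EFin \o X]eq_fun do rewrite mulrC; exact: L1Z.
apply: (@le_trans _ _ (\int[mu]_x (\1_[set x : E | `|x| <= M] x * (C * d) + `|convol r (nbump d) x| + `|r x|))).
  apply: le_Rintegral => //.
  - have LD : L1 (fun x => convol f (nbump d) x - f x).
      by apply: L1B => //; have [] := L1_moll d0 Lf.
    under [X in EFin \o X]eq_fun do rewrite mulrC.
    apply: (L1_bounded (C := 1)) (L1_abs LD) => //; first exact: L1_measurable L1B'.
    by move=> x; rewrite indicE; case: (_ \in _); rewrite ?normr1 ?normr0.
  - by apply: L1D; [apply: L1D => //|]; exact: L1_abs.
  move=> x _; rewrite indicE; have [xM|xM] := leP `|x| M; last first.
    rewrite memNset; last by apply/negP; rewrite -ltNge.
    by rewrite !mul0r add0r addr_ge0.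
  rewrite mem_set// !mul1r.
  have cE : convol f (nbump d) x = convol g (nbump d) x + convol r (nbump d) x.
    rewrite /convol -RintegralD//; [|exact: L1_convol|exact: L1_convol].
    by apply: eq_Rintegral => y _; rewrite /r; ring.
  have gb y : `|y - x| < d -> g y = b y.
    move=> yx; rewrite /g indicE mem_set ?mul1r//= /B1 /=.
    rewrite -(subrK x y) (le_trans (ler_normD _ _))// addrC lerD// ltW//.
    exact: lt_trans d1.
  have gx : g x = b x by apply: gb; rewrite subrr normr0.
  have -> : convol f (nbump d) x - f x = (convol g (nbump d) x - b x) + convol r (nbump d) x - r x.
    by rewrite cE /r gx; ring.
  rewrite (le_trans (ler_normB _ _))// lerD2r (le_trans (ler_normD _ _))// lerD2r.
  exact: (moll_lipschitz_le d0 C0 bb lb Lg gb).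
rewrite RintegralD//; last 2 first.
- by apply: L1D => //; exact: L1_abs.
- exact: L1_abs.
rewrite RintegralD//; last exact: L1_abs.
have -> : t = t / 3 + t / 3 + t / 3 by field.
rewrite lerD// lerD//; last exact: le_trans rI.
under eq_Rintegral do rewrite mulrC.
rewrite RintegralZl// -/I mulrAC.
apply: (@le_trans _ _ ((C * I + 1) * d)); first by rewrite ler_wpM2r ?lerDl// ltW.
by rewrite mulrC -ler_pdivlMr// ltW.
Qed.

End mollifier.

(** * Integration by parts against xi^2 / w and completion of the square *)

Section logarithmic_energy.
Context {R : realType} {n : nat}.
Local Notation E := 'rV[R]_n.
Local Notation mu := (@lebesgue_rV R n).
Local Notation L1 f := (mu.-integrable setT (EFin \o f)).
Implicit Types (f g p xi w : E -> R) (i : 'I_n).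

Lemma near_rV_norm_gt (M : R) (x : E) : M < `|x| -> \forall y \near x, M < `|y|.
Proof.
move=> Mx; have oU : open [set y : E | M < `|y|].
  apply: (@open_comp _ _ (fun y : E => `|y|) [set t | M < t]); last exact: open_gt.
  by move=> y _; exact: norm_continuous.
by have : nbhs x [set y : E | M < `|y|] by apply: open_nbhs_nbhs; split.
Qed.

Lemma partial_eq0 f (M : R) i x : (forall y, M < `|y| -> f y = 0) -> M < `|x| ->
  partial i f x = 0.
Proof.
move=> f0 Mx.
have H0 : is_derive x (delta_mx ord0 i) (cst 0 : E -> R) 0 by exact: is_derive_cst.
have [] // := near_eq_is_derive _ H0 (g := f).
by apply: filterS (near_rV_norm_gt Mx) => y My; rewrite f0.
Qed.

Section partial_bounded_lipschitz.
Variables (xi : E -> R) (M : R).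
Hypotheses (bxi : bounded_lipschitz xi) (xiM : forall x, M < `|x| -> xi x = 0).

Lemma measurable_partial i : measurable_fun setT (partial i xi).
Proof. by case: bxi => C C0 [_ l]; exact: (measurable_derive _ C0 l). Qed.

Lemma partial_bounded : exists2 C, 0 <= C & forall i x, `|partial i xi x| <= C.
Proof.
case: bxi => C C0 [_ l]; exists C => // i x.
rewrite (le_trans (lipschitz_derive_le _ _ C0 l))//.
by rewrite ler_piMr// norm_delta_mx_le.
Qed.

Lemma ae_is_derive_partial i :
  {ae mu, forall x, is_derive x (delta_mx ord0 i) xi (partial i xi x)}.
Proof.
case: bxi => C C0 [_ l]; apply: aeS (lipschitz_derivable_ae (delta_mx ord0 i) C0 l) => x.
exact: derivableP.
Qed.

Lemma L1_partial_sq i : L1 (fun x => partial i xi x ^+ 2).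
Proof.
have [C C0 pC] := partial_bounded; apply: (@L1_bounded_support _ _ _ (C ^+ 2) M).
- by apply: measurable_funX; exact: measurable_partial.
- by move=> x; rewrite normrX lerXn2r ?nnegrE// pC.
- by move=> x Mx; rewrite (partial_eq0 _ xiM Mx) expr0n.
Qed.

Lemma L1_grad_sq : L1 (grad_sq xi).
Proof. by apply: L1_sum => i; exact: L1_partial_sq. Qed.

End partial_bounded_lipschitz.

Section identity.
Variables (xi w : E -> R) (W W2 : 'I_n -> E -> R) (M e : R).
Hypotheses (bxi : bounded_lipschitz xi) (xiM : forall x, M < `|x| -> xi x = 0).
Hypotheses (e0 : 0 < e) (we : forall x, e <= w x).
Hypotheses (bw : bounded_lipschitz w) (bW : forall i, bounded_lipschitz (W i))
  (bW2 : forall i, bounded_lipschitz (W2 i)).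
Hypotheses (dw : forall i x, is_derive x (delta_mx ord0 i) w (W i x))
  (dW : forall i x, is_derive x (delta_mx ord0 i) (W i) (W2 i x)).

Let bV : bounded_lipschitz (fun x => (w x)^-1).
Proof. exact: bounded_lipschitzV e0 we bw. Qed.

Let w0 x : w x != 0.
Proof. by rewrite gt_eqF// (lt_le_trans e0). Qed.

Let G i x := 2 * (xi x * partial i xi x * (W i x / w x)) - xi x ^+ 2 * (W i x / w x) ^+ 2.

Let bWw i : bounded_lipschitz (fun x => W i x / w x).
Proof. exact: bounded_lipschitzM. Qed.

Lemma L1_xi2 f : bounded_lipschitz f -> L1 (fun x => xi x ^+ 2 * f x).
Proof.
move=> bf; have b : bounded_lipschitz (fun x => xi x ^+ 2 * f x).
  exact: (bounded_lipschitzM (bounded_lipschitzM bxi bxi) bf).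
have [C _ [bC _]] := b.
apply: (L1_bounded_support (bounded_lipschitz_measurable b) bC (M := M)) => x Mx.
by rewrite xiM// expr0n mul0r.
Qed.

Let LWw i : L1 (fun x => xi x ^+ 2 * (W i x / w x) ^+ 2).
Proof. by apply: L1_xi2; exact: (bounded_lipschitzM (bWw i) (bWw i)). Qed.

Let LG i : L1 (G i).
Proof.
apply: L1B; last exact: LWw.
apply: L1Z.
have [C C0 pC] := partial_bounded bxi.
have [D D0 [WD _]] := bWw i.
have [K K0 [xK _]] := bxi.
apply: (@L1_bounded_support _ _ _ (K * C * D) M).
- apply: measurable_funM; last exact: bounded_lipschitz_measurable.
  apply: measurable_funM; first exact: bounded_lipschitz_measurable.
  exact: measurable_partial.
- move=> x; rewrite normrM; apply: ler_pM => //.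
  by rewrite normrM; apply: ler_pM.
- by move=> x Mx; rewrite xiM// !mul0r.
Qed.

(** The integral of the derivative of W xi^2 / w along direction [i] vanishes, and expanding this
    derivative by the product rule gives the identity. [xi] is differentiable only almost
    everywhere, hence [Rint_ae]. *)
Lemma log_energy_identity i :
  \int[mu]_x (- W2 i x * (xi x ^+ 2 / w x)) = \int[mu]_x G i x.
Proof.
pose F x := W i x * (xi x * xi x) * (w x)^-1.
have bF : bounded_lipschitz F.
  exact: bounded_lipschitzM (bounded_lipschitzM (bW i) (bounded_lipschitzM bxi bxi)) bV.
have [C C0 [FC lF]] := bF.
have FM x : M < `|x| -> F x = 0 by move=> Mx; rewrite /F xiM// mul0r mulr0 mul0r.
have [LF F0] := integral_derive0 (delta_mx ord0 i) C0 FC lF FM.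
have LH : L1 (fun x => - W2 i x * (xi x ^+ 2 / w x)).
  rewrite (_ : (fun _ => _) = (fun x => xi x ^+ 2 * (- W2 i x / w x))); last first.
    by apply/funext => x; rewrite mulrCA mulrA.
  by apply: L1_xi2; apply: bounded_lipschitzM => //; exact: bounded_lipschitzN.
apply/eqP; rewrite -subr_eq0 -oppr_eq0 opprB -RintegralB//; apply/eqP.
rewrite -[RHS]F0; apply: Rint_ae.
- apply: aeS (ae_is_derive_partial bxi i) => x dx.
  have d1 := is_deriveM (dW i x) (is_deriveM dx dx).
  have dV : is_derive x (delta_mx ord0 i) (fun y => (w y)^-1) (- w x ^- 2 * W i x).
    apply: (is_derive_chain (dw i x)).
    by have := @is_deriveV R id (w x) 1 1 (w0 x) (is_derive_id _ _); rewrite [_ *: 1]mulr1.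
  have [_ dF] := is_deriveM d1 dV.
  rewrite [RHS]dF /G /GRing.scale /= !fctE.
  by field; exact: w0.
- by apply: measurable_funB; [exact: L1_measurable (LG i)|exact: L1_measurable LH].
- exact: L1_measurable LF.
Qed.

Let LH i : L1 (fun x => - W2 i x * (xi x ^+ 2 / w x)).
Proof.
rewrite (_ : (fun _ => _) = (fun x => xi x ^+ 2 * (- W2 i x / w x))); last first.
  by apply/funext => x; rewrite mulrCA mulrA.
by apply: L1_xi2; apply: bounded_lipschitzM => //; exact: bounded_lipschitzN.
Qed.

Let sum_identity : \int[mu]_x ((\sum_(i < n) - W2 i x) * (xi x ^+ 2 / w x)) =
  \sum_(i < n) \int[mu]_x G i x.
Proof.
under eq_Rintegral do rewrite big_distrl /=.
by rewrite Rintegral_sum//; apply: eq_bigr => i _; exact: log_energy_identity.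
Qed.

Let grad_sum : \int[mu]_x grad_sq xi x = \sum_(i < n) \int[mu]_x (partial i xi x ^+ 2).
Proof. by rewrite /grad_sq Rintegral_sum// => i; exact: (L1_partial_sq bxi xiM). Qed.

Lemma log_energy_le :
  \int[mu]_x ((\sum_(i < n) - W2 i x) * (xi x ^+ 2 / w x)) <= \int[mu]_x grad_sq xi x.
Proof.
rewrite sum_identity grad_sum; apply: ler_sum => i _; apply: le_Rintegral => //.
- exact: (L1_partial_sq bxi xiM).
- move=> x _; rewrite /G -subr_ge0.
  (* The difference of the two integrands is exactly this square. *)
  by have := sqr_ge0 (partial i xi x - xi x * (W i x / w x)); congr (0 <= _); ring.
Qed.

(** Doubling the gradient term leaves half of xi^2 (W / w)^2 on the left, since 2 a^2 - 2 a b + b^2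
    / 2 = (2 a - b)^2 / 2. This controls the gradient of log w with weight xi^2. *)
Lemma log_energy_gradient :
  2^-1 * \int[mu]_x (\sum_(i < n) xi x ^+ 2 * (W i x / w x) ^+ 2) +
  \int[mu]_x ((\sum_(i < n) - W2 i x) * (xi x ^+ 2 / w x)) <= 2 * \int[mu]_x grad_sq xi x.
Proof.
rewrite sum_identity grad_sum Rintegral_sum// !mulr_sumr -big_split /=.
apply: ler_sum => i _; have Lp := L1_partial_sq bxi xiM i.
rewrite -RintegralZl// -RintegralZl// -RintegralD//; last exact: L1Z.
apply: le_Rintegral => //.
- by apply: L1D => //; exact: L1Z.
- exact: L1Z.
- move=> x _; rewrite /G -subr_ge0.
  have := mulr_ge0 (_ : 0 <= 2^-1 :> R) (sqr_ge0 (2 * partial i xi x - xi x * (W i x / w x))).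
  by rewrite invr_ge0 ler0n => /(_ isT); congr (0 <= _); field.
Qed.

End identity.
End logarithmic_energy.

(** * Removing the mollification at a fixed regularisation *)

Section mollified_limit.
Context {R : realType} {n : nat}.
Local Notation E := 'rV[R]_n.
Local Notation mu := (@lebesgue_rV R n).
Local Notation L1 f := (mu.-integrable setT (EFin \o f)).
Implicit Types (f g p xi w eta : E -> R) (i : 'I_n).

Lemma measurable_invr : measurable_fun setT (fun x : R => x^-1).
Proof.
(* The power with exponent -1 inverts a nonnegative base, hence the square; at 0 both sides are
   0. *)
rewrite (_ : (fun _ => _) = (fun x : R => x * (x ^+ 2) `^ (-1))).
  apply: measurable_funM => //; apply: (measurableT_comp (measurable_powR (-1))).
  exact: measurable_funX.
apply/funext => x; rewrite powR_inv1 ?sqr_ge0//.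
by have [->|x0] := eqVneq x 0; [rewrite mul0r invr0|field].
Qed.

Lemma measurable_funV f : measurable_fun setT f -> measurable_fun setT (fun x => (f x)^-1).
Proof. by move=> mf; exact: (measurableT_comp measurable_invr mf). Qed.

(** Here [b] is the value of an unbounded integrable function, so b (1/u - 1/v) has no useful bound
    in terms of |u - v|. The bounded substitute [z] carries that factor, while the rest b - z is
    small in L1 and only meets |1/u - 1/v| <= 1/e. *)
Lemma quotient_dist_le (a b c u v z e : R) : 0 < e -> e <= u -> e <= v ->
  `|a * (c / u) - b * (c / v)| <=
  `|c| * (e^-1 * `|a - b| + e^-1 * `|b - z| + `|z| * e ^- 2 * `|u - v|).
Proof.
move=> e0 eu ev; have u0 := lt_le_trans e0 eu; have v0 := lt_le_trans e0 ev.
have iu : u^-1 <= e^-1 by rewrite lef_pV2 ?posrE.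
have iv : v^-1 <= e^-1 by rewrite lef_pV2 ?posrE.
have iu0 : 0 < u^-1 by rewrite invr_gt0.
have iv0 : 0 < v^-1 by rewrite invr_gt0.
have -> : a * (c / u) - b * (c / v) =
    c * ((a - b) / u + (b - z) * (u^-1 - v^-1) + z * (u^-1 - v^-1)) by ring.
rewrite normrM ler_wpM2l// (le_trans (ler_normD _ _))// lerD//.
  rewrite (le_trans (ler_normD _ _))// lerD// normrM mulrC ler_wpM2r//.
    by rewrite gtr0_norm.
  by rewrite ler_norml; apply/andP; split; lra.
rewrite normrM -mulrA ler_wpM2l//.
have -> : u^-1 - v^-1 = u^-1 * v^-1 * (v - u) by field; rewrite !gt_eqF.
rewrite normrM distrC ler_wpM2r// gtr0_norm ?mulr_gt0//.
by rewrite expr2 invfM ler_pM// ltW.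
Qed.

Lemma ler_Rintegral_mollified f p eta (M C e t : R) : 0 <= M -> 0 < e -> 0 <= C -> 0 < t ->
  L1 f -> L1 p -> (forall x, M < `|x| -> f x = 0) -> (forall x, M < `|x| -> p x = 0) ->
  (forall x, 0 <= p x) -> measurable_fun setT eta -> (forall x, `|eta x| <= C) ->
  (forall x, M < `|x| -> eta x = 0) ->
  exists2 d0, 0 < d0 & forall d, 0 < d -> d < d0 ->
    `|\int[mu]_x (convol f (nbump d) x * (eta x / (convol p (nbump d) x + e))) -
      \int[mu]_x (f x * (eta x / (p x + e)))| <= t.
Proof.
move=> M0 e0 C0 t0 Lf Lp fM pM p0 meta etaC etaM.
have mp := L1_measurable Lp.
pose K := C * e^-1 + 1.
have Ce : 0 <= C * e^-1 by rewrite divr_ge0// ltW.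
have K0 : 0 < K by rewrite ltr_wpDl.
have t3K : 0 < t / 3 / K by rewrite !divr_gt0.
have [_ [_ /(_ _ t3K)[b bb bI]]] := L1_approx_L1 M Lf.
(* The bound of [b] determines how close the mollification of [p] has to be to [p], so [b] is chosen
   before [d]. *)
have [B B0 [bB _]] := bb.
pose K' := C * (B * e ^- 2) + 1.
have CB : 0 <= C * (B * e ^- 2) by rewrite !mulr_ge0 ?invr_ge0 ?exprn_ge0// ltW.
have K'0 : 0 < K' by rewrite ltr_wpDl.
have t3K' : 0 < t / 3 / K' by rewrite !divr_gt0.
have [d1 d10 H1] := moll_cvg M0 Lf fM t3K.
have [d2 d20 H2] := moll_cvg M0 Lp pM t3K'.
exists (Num.min d1 d2); first by rewrite lt_min d10.
move=> d d0; rewrite lt_min => /andP[dd1 dd2].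
have {}H1 := H1 _ d0 dd1; have {}H2 := H2 _ d0 dd2.
have [Lfd _] := L1_moll d0 Lf.
have [Lpd _] := L1_moll d0 Lp.
have pd0 x : 0 <= convol p (nbump d) x.
  by apply: convol_ge0 => // y; exact: nbump_ge0.
move: (convol f (nbump d)) (convol p (nbump d)) H1 H2 Lfd Lpd pd0 => fd pd H1 H2 Lfd Lpd pd0.
have we x : e <= pd x + e by rewrite lerDr.
have pe x : e <= p x + e by rewrite lerDr.
have frac (q : E -> R) : measurable_fun setT q -> (forall x, e <= q x + e) ->
    measurable_fun setT (fun x => eta x / (q x + e)) /\ (forall x, `|eta x / (q x + e)| <= C * e^-1).
  move=> mq qe; split.
    by apply: measurable_funM => //; apply: measurable_funV; exact: measurable_funD.
  move=> x; have q0 := lt_le_trans e0 (qe x).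
  by rewrite normrM; apply: ler_pM => //; rewrite gtr0_norm ?invr_gt0// lef_pV2 ?posrE.
have [m1 b1] := frac pd (L1_measurable Lpd) we.
have [m2 b2] := frac p mp pe.
have LA : L1 (fun x => fd x * (eta x / (pd x + e))) by exact: (L1_bounded m1 b1).
have LB : L1 (fun x => f x * (eta x / (p x + e))) by exact: (L1_bounded m2 b2).
rewrite -RintegralB//.
pose I x : R := \1_[set x : E | `|x| <= M] x.
have mI : measurable_fun setT I by apply: measurable_indic; exact: measurable_rV_normball.
have IC x : `|I x| <= 1 by rewrite /I indicE; case: (_ \in _); rewrite ?normr1 ?normr0.
have LI (r : E -> R) : L1 r -> L1 (fun x => I x * `|r x|).
  move=> Lr; under [X in EFin \o X]eq_fun do rewrite mulrC.
  exact: (L1_bounded mI IC (L1_abs Lr)).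
have L1' : L1 (fun x => I x * `|fd x - f x|) by apply: LI; exact: L1B.
have L3' : L1 (fun x => I x * `|pd x - p x|) by apply: LI; exact: L1B.
have L2' : L1 (fun x => I x * `|f x - b x|).
  have LIb : L1 (fun x => I x * b x) by exact: (L1_bounded_lipschitz bb (L1_normball M)).
  have := LI _ (L1B Lf LIb); congr (integrable _ _ _); apply/funext => x /=.
  rewrite /I indicE; case: (_ \in _) => //=; rewrite ?mul1r ?mul0r//.
rewrite (le_trans (le_normr_Rintegral _ (L1B LA LB)))//.
apply: (@le_trans _ _ (\int[mu]_x (C * e^-1 * (I x * `|fd x - f x|) +
   C * e^-1 * (I x * `|f x - b x|) + C * (B * e ^- 2) * (I x * `|pd x - p x|)))).
  apply: le_Rintegral => //.
  - exact: L1_abs (L1B LA LB).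
  - by apply: L1D; [apply: L1D|]; exact: L1Z.
  move=> x _; rewrite /I indicE; have [xM|xM] := leP `|x| M; last first.
    rewrite memNset; last by apply/negP; rewrite -ltNge.
    by rewrite etaM// !mul0r !mulr0 subrr normr0 !addr0.
  rewrite mem_set// !mul1r.
  apply: (le_trans (quotient_dist_le _ _ _ (b x) e0 (we x) (pe x))).
  have -> : pd x + e - (p x + e) = pd x - p x by ring.
  apply: (@le_trans _ _ (C * (e^-1 * `|fd x - f x| + e^-1 * `|f x - b x| +
     B * e ^- 2 * `|pd x - p x|))); last by rewrite !mulrDr !mulrA.
  have ei : 0 <= e^-1 by rewrite invr_ge0 ltW.
  have ei2 : 0 <= e ^- 2 by rewrite invr_ge0 exprn_ge0// ltW.
  apply: ler_pM => //.
    by rewrite !addr_ge0// !mulr_ge0.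
  by rewrite lerD2l ler_wpM2r// ler_wpM2r.
rewrite RintegralD//; [|by apply: L1D; exact: L1Z|exact: L1Z].
rewrite RintegralD//; [|exact: L1Z|exact: L1Z].
rewrite !RintegralZl//.
have -> : t = t / 3 + t / 3 + t / 3 by field.
have aux (k J : R) : 0 <= k -> 0 <= J -> J <= t / 3 / (k + 1) -> k * J <= t / 3.
  move=> k0 J0; rewrite ler_pdivlMr ?ltr_wpDl// mulrDr mulr1 mulrC => /(le_trans _); apply.
  by rewrite lerDl.
have J0 (r : E -> R) : 0 <= \int[mu]_x (I x * `|r x|).
  by apply: Rintegral_ge0 => x _; rewrite mulr_ge0.
by rewrite lerD// ?lerD//; apply: aux.
Qed.

End mollified_limit.

(** * The function log (1 + s / e) *)

Section logarithm.
Context {R : realType}.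
Implicit Types a b e s : R.

Lemma ln1D_dist_le e a b : 0 < e -> 0 <= a -> 0 <= b ->
  `|ln (1 + a / e) - ln (1 + b / e)| <= e^-1 * `|a - b|.
Proof.
move=> e0; wlog ba : a b / b <= a.
  move=> H a0 b0; have [/H|/ltW/H] := leP b a; first exact.
  by move=> /(_ b0 a0); rewrite distrC (distrC b).
move=> a0 b0.
have pos s : 0 <= s -> 0 < 1 + s / e by move=> s0; rewrite ltr_pwDl// divr_ge0// ltW.
have be0 : 0 < b + e by rewrite ltr_wpDl.
have ab0 : 0 <= a - b by rewrite subr_ge0.
rewrite -ln_div ?posrE ?pos// ger0_norm; last first.
  by apply: ln_ge0; rewrite ler_pdivlMr ?pos// mul1r lerD2l ler_wpM2r// invr_ge0 ltW.
have -> : (1 + a / e) / (1 + b / e) = 1 + (a - b) / (b + e).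
  by field; rewrite !gt_eqF// addrC.
rewrite (le_trans (le_ln1Dx _))//.
  by rewrite (@lt_le_trans _ _ 0) ?oppr_lt0// divr_ge0// ltW.
rewrite (ger0_norm ab0) mulrC ler_wpM2r// lef_pV2 ?posrE//.
by rewrite lerDr.
Qed.

Lemma is_derive_ln1D e s : 0 < e -> 0 <= s ->
  is_derive s 1 (fun t => ln (1 + t / e)) (s + e)^-1.
Proof.
move=> e0 s0; have p0 : 0 < 1 + s / e by rewrite ltr_pwDl// divr_ge0// ltW.
have d1 : is_derive s 1 (fun t : R => 1 + t / e) e^-1.
  apply: (@is_derive_quadratic _ _ _ _ _ _ 0) => h.
  rewrite [h *: 1]mulr1 mul0r normr_le0; apply/eqP; ring.
have := is_derive_chain d1 (is_derive1_ln p0).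
rewrite (_ : (1 + s / e)^-1 * e^-1 = (s + e)^-1)//.
by field; rewrite !gt_eqF// ?ltr_wpDl// addrC ltr_wpDl.
Qed.

End logarithm.

(** * Consequences of the mollified inequality for globally integrable data *)

Section supersolution.
Context {R : realType} {n : nat}.
Local Notation E := 'rV[R]_n.
Local Notation mu := (@lebesgue_rV R n).
Local Notation L1 f := (mu.-integrable setT (EFin \o f)).
Variables (p g Vt xi : E -> R) (M r : R).
Local Notation q := (fun x => Vt x * p x).
Hypotheses (Lp : L1 p) (Lg : L1 g) (LV : L1 Vt) (Lq : L1 q).
Hypotheses (p0 : forall x, 0 <= p x) (g0 : forall x, 0 <= g x).
Hypotheses (M0 : 0 <= M) (pM : forall x, M < `|x| -> p x = 0)
  (gM : forall x, M < `|x| -> g x = 0).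
Hypotheses (bxi : bounded_lipschitz xi) (xiM : forall x, M < `|x| -> xi x = 0).
Hypothesis r0 : 0 < r.
Hypothesis super : forall d x, 0 < d -> d < r -> xi x != 0 ->
  convol g (nbump d) x <=
  - (\sum_(i < n) convol p (bderiv i (bderiv i (nbump d))) x) + convol q (nbump d) x.

Let qM x : M < `|x| -> q x = 0. Proof. by move=> /pM ->; rewrite mulr0. Qed.

Let mxi2 : measurable_fun setT (fun x => xi x ^+ 2).
Proof. by apply: measurable_funX; exact: bounded_lipschitz_measurable. Qed.

Let xi2C : exists2 C, 0 <= C & forall x, `|xi x ^+ 2| <= C.
Proof.
case: bxi => C C0 [xC _]; exists (C ^+ 2); first exact: exprn_ge0.
by move=> x; rewrite normrX lerXn2r ?nnegrE.
Qed.

Let xi2M x : M < `|x| -> xi x ^+ 2 = 0.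
Proof. by move=> /xiM ->; rewrite expr0n. Qed.

Let mxp e : measurable_fun setT (fun x => xi x ^+ 2 / (p x + e)).
Proof.
apply: measurable_funM => //; apply: measurable_funV; apply: measurable_funD => //.
exact: L1_measurable Lp.
Qed.

Let xpC e : 0 < e -> exists C, forall x, `|xi x ^+ 2 / (p x + e)| <= C.
Proof.
move=> e0; have [C C0 xC] := xi2C; exists (C * e^-1) => x.
have pe : 0 < p x + e by rewrite ltr_wpDl.
rewrite normrM ler_pM// gtr0_norm ?invr_gt0// lef_pV2 ?posrE//.
by rewrite lerDr.
Qed.

Lemma L1_quotient f e : 0 < e -> L1 f -> L1 (fun x => f x * (xi x ^+ 2 / (p x + e))).
Proof. by move=> e0 Lf; have [C xC] := xpC e0; exact: (L1_bounded (mxp e) xC Lf). Qed.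

Let w e d x := convol p (nbump d) x + e.
(** First partial derivatives of [w]; the reflected kernel produces the sign, and it cancels in the
    second derivatives [W2]. *)
Let W i d x := - convol p (bderiv i (nbump d)) x.
Let W2 i d x := convol p (bderiv i (bderiv i (nbump d))) x.

Let we e d x : 0 < d -> e <= w e d x.
Proof. by move=> d0; rewrite lerDr convol_ge0// => y; exact: nbump_ge0. Qed.

Let bw e d : bounded_lipschitz (w e d).
Proof.
apply: bounded_lipschitzD; first exact: bounded_lipschitz_convol.
exact: bounded_lipschitz_cst.
Qed.

Let bW i d : bounded_lipschitz (W i d).
Proof. exact/bounded_lipschitzN/bounded_lipschitz_convol. Qed.

Let bW2 i d : bounded_lipschitz (W2 i d).
Proof. exact: bounded_lipschitz_convol. Qed.

Let dw e d i x : is_derive x (delta_mx ord0 i) (w e d) (W i d x).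
Proof.
have := is_deriveD (is_derive_convol (nbump d) i x Lp) (is_derive_cst e x (delta_mx ord0 i)).
by rewrite addr0.
Qed.

Let dW d i x : is_derive x (delta_mx ord0 i) (W i d) (W2 i d x).
Proof.
have := is_deriveN (is_derive_convol (bderiv i (nbump d)) i x Lp).
by rewrite opprK.
Qed.

Let bxw e d : 0 < e -> 0 < d -> bounded_lipschitz (fun x => xi x ^+ 2 / w e d x).
Proof.
move=> e0 d0; apply: bounded_lipschitzM; first exact: (bounded_lipschitzM bxi bxi).
by apply: (bounded_lipschitzV e0) => // x; exact: we.
Qed.

Let LW e d : 0 < e -> 0 < d ->
  L1 (fun x => (\sum_(i < n) - W2 i d x) * (xi x ^+ 2 / w e d x)).
Proof.
move=> e0 d0; have b0 := bxw e0 d0.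
under [X in EFin \o X]eq_fun do rewrite big_distrl /=.
apply: L1_sum => i.
have b : bounded_lipschitz (fun x => - W2 i d x * (xi x ^+ 2 / w e d x)).
  by apply: bounded_lipschitzM => //; exact: bounded_lipschitzN.
have [C C0 [bC _]] := b.
apply: (L1_bounded_support (bounded_lipschitz_measurable b) bC (M := M)) => x Mx.
by rewrite xi2M// mul0r mulr0.
Qed.

Let Ldw f e d : 0 < e -> 0 < d -> L1 f -> L1 (fun x => f x * (xi x ^+ 2 / w e d x)).
Proof. by move=> e0 d0; exact: (L1_bounded_lipschitz (bxw e0 d0)). Qed.

Let mollified_super e d : 0 < e -> 0 < d -> d < r ->
  \int[mu]_x (convol g (nbump d) x * (xi x ^+ 2 / w e d x)) -
  \int[mu]_x (convol q (nbump d) x * (xi x ^+ 2 / w e d x)) <=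
  \int[mu]_x ((\sum_(i < n) - W2 i d x) * (xi x ^+ 2 / w e d x)).
Proof.
move=> e0 d0 dr.
have [Lgd _] := L1_moll d0 Lg; have [Lqd _] := L1_moll d0 Lq.
rewrite -RintegralB//; [|exact: Ldw|exact: Ldw].
apply: le_Rintegral => //; [by apply: L1B; exact: Ldw|exact: LW|].
move=> x _; have [->|x0] := eqVneq (xi x) 0; first by rewrite expr0n !mul0r !mulr0 subrr.
rewrite -mulrBl ler_wpM2r//.
  by rewrite divr_ge0 ?sqr_ge0// ltW// (lt_le_trans e0)// we.
by rewrite lerBlDr sumrN super.
Qed.

Let approx_le (a b c d s G t : R) : `|a - b| <= t / 2 -> `|c - d| <= t / 2 ->
  a - c <= s -> s <= G -> b <= G + d + t.
Proof. by rewrite !ler_norml => /andP[? ?] /andP[? ?] ? ?; lra. Qed.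

Let approx_energy_le (a c d s G S V k : R) : 0 <= a -> `|c - d| <= k -> a - c <= s ->
  2^-1 * S + s <= 2 * G -> d <= V -> S <= 4 * G + 2 * V + 2 * k.
Proof. by rewrite !ler_norml => ? /andP[? ?] ? ? ?; lra. Qed.

Let le_1D_sqr (a : R) : a <= 1 + a ^+ 2.
Proof. by have := sqr_ge0 (2 * a - 1); nra. Qed.

Let approx_log_le (x y K X S G V k t : R) : `|x| <= K * (X + S) -> `|y - x| <= t / 2 ->
  K * S <= K * (4 * G + 2 * V + 2 * k) -> K * (2 * k) <= t / 2 ->
  `|y| <= K * (X + 4 * G + 2 * V) + t.
Proof.
move=> xS xy KS Kk; rewrite -(subrK x y) (le_trans (ler_normD _ _))//.
by have := lerD xy xS; move: KS; rewrite !mulrDr; lra.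
Qed.

Lemma supersolution_le_regularized e : 0 < e ->
  \int[mu]_x (g x * (xi x ^+ 2 / (p x + e))) <=
  \int[mu]_x grad_sq xi x + \int[mu]_x (q x * (xi x ^+ 2 / (p x + e))).
Proof.
move=> e0; apply/ler_addgt0Pr => t t0; have t20 : 0 < t / 2 by rewrite divr_gt0.
have [C C0 xC] := xi2C.
have [d1 d10 H1] := ler_Rintegral_mollified M0 e0 C0 t20 Lg Lp gM pM p0 mxi2 xC xi2M.
have [d2 d20 H2] := ler_Rintegral_mollified M0 e0 C0 t20 Lq Lp qM pM p0 mxi2 xC xi2M.
pose d := Num.min r (Num.min d1 d2) / 2.
have m0 : 0 < Num.min r (Num.min d1 d2) by rewrite !lt_min r0 d10.
have d0 : 0 < d by rewrite divr_gt0.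
have : d < Num.min r (Num.min d1 d2) by rewrite ltr_pdivrMr// ltr_pMr// ltr1n.
rewrite !lt_min => /and3P[dr dd1 dd2].
have {}H1 := H1 _ d0 dd1; have {}H2 := H2 _ d0 dd2.
have H3 := mollified_super e0 d0 dr.
have H4 := log_energy_le bxi xiM e0 (fun x => we e x d0) (bw e d) (bW^~ d) (bW2^~ d) (dw e d) (dW d).
exact: approx_le H1 H2 H3 H4.
Qed.

Let L1_xi2' : L1 (fun x => xi x ^+ 2).
Proof. by have [C C0 xC] := xi2C; exact: (L1_bounded_support mxi2 xC xi2M). Qed.

Let LVxi : L1 (fun x => `|Vt x| * xi x ^+ 2).
Proof. by have [C C0 xC] := xi2C; exact: (L1_bounded mxi2 xC (L1_abs LV)). Qed.

(** The factor p / (p + e) is at most 1, which makes the bound independent of [e]. *)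
Lemma regularized_potential_le e : 0 < e ->
  \int[mu]_x (q x * (xi x ^+ 2 / (p x + e))) <= \int[mu]_x (`|Vt x| * xi x ^+ 2).
Proof.
move=> e0; apply: le_Rintegral => //; first exact: L1_quotient.
move=> x _; have pe : 0 < p x + e by rewrite ltr_wpDl.
have -> : Vt x * p x * (xi x ^+ 2 / (p x + e)) = Vt x * xi x ^+ 2 * (p x / (p x + e)) by ring.
apply: (@le_trans _ _ (`|Vt x| * xi x ^+ 2 * (p x / (p x + e)))).
  by rewrite ler_wpM2r ?ler_wpM2r ?ler_norm ?sqr_ge0// divr_ge0// ltW.
rewrite -[leRHS]mulr1 ler_wpM2l//.
  by rewrite mulr_ge0// sqr_ge0.
by rewrite ler_pdivrMr// mul1r lerDl ltW.
Qed.

(** The point is that the bound does not depend on [e]. After mollification, 1 + p / e becomes w /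
    e, whose logarithm has derivative W / w. Integrating by parts moves the derivative off [b]; then
    |W / w| <= 1 + (W / w)^2, and the square with weight xi^2 is controlled by [log_energy_gradient]
    and [regularized_potential_le]. *)
Lemma log_derivative_le e (i : 'I_n) (b : @bexp R n) (K : R) : 0 < e -> 0 <= K ->
  (forall x, `|beval b x| <= K * xi x ^+ 2) ->
  `|\int[mu]_x (ln (1 + p x / e) * beval (bderiv i b) x)| <=
  K * (\int[mu]_x (xi x ^+ 2) + 4 * \int[mu]_x grad_sq xi x +
       2 * \int[mu]_x (`|Vt x| * xi x ^+ 2)).
Proof.
move=> e0 K0 bK.
have bM x : M < `|x| -> beval b x = 0.
  by move=> /xi2M Mx; apply/eqP; rewrite -normr_le0 (le_trans (bK x))// Mx mulr0.
have dbM x : M < `|x| -> beval (bderiv i b) x = 0.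
  by move=> Mx; rewrite -partial_beval (partial_eq0 _ bM Mx).
have [D D0 [dbD _]] := bounded_lipschitz_beval (bderiv i b).
have mdb := bounded_lipschitz_measurable (bounded_lipschitz_beval (bderiv i b)).
have ln0 a : 0 <= a -> 0 <= ln (1 + a / e).
  by move=> a0; apply: ln_ge0; rewrite lerDl divr_ge0// ltW.
have Lln f : L1 f -> (forall x, 0 <= f x) -> L1 (fun x => ln (1 + f x / e)).
  move=> Lf f0; apply: (L1_le _ _ (L1Z e^-1 Lf)).
    have mf : measurable_fun setT (fun x => 1 + f x / e).
      by apply: measurable_funD => //; apply: measurable_funM => //; exact: L1_measurable Lf.
    exact: (measurableT_comp (@measurable_ln R) mf).
  move=> x; rewrite ger0_norm ?ln0// mulrC le_ln1Dx//.
  by rewrite (@lt_le_trans _ _ 0) ?oppr_lt0// mulr_ge0// invr_ge0 ltW.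
have Llb f : L1 f -> (forall x, 0 <= f x) ->
    L1 (fun x => ln (1 + f x / e) * beval (bderiv i b) x).
  by move=> Lf f0; apply: (L1_bounded mdb dbD); exact: Lln.
apply/ler_addgt0Pr => t t0.
(* The error of the energy estimate is multiplied by [2 * K], and the L1 error of the mollification
   by [D * e^-1], the bound of the test function times the Lipschitz constant of the logarithm. Both
   products must stay below [t / 2]. *)
have K2 : 0 < 4 * K + 1 by rewrite ltr_wpDl// mulr_ge0.
have De : 0 < D * e^-1 + 1 by rewrite ltr_wpDl// divr_ge0// ltW.
have t1 : 0 < t / 2 / (4 * K + 1) by rewrite !divr_gt0.
have t2 : 0 < t / 2 / (D * e^-1 + 1) by rewrite !divr_gt0.
have [C C0 xC] := xi2C.
have [d1 d10 H1] := ler_Rintegral_mollified M0 e0 C0 t1 Lq Lp qM pM p0 mxi2 xC xi2M.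
have [d2 d20 H2] := moll_cvg M0 Lp pM t2.
pose d := Num.min r (Num.min d1 d2) / 2.
have m0 : 0 < Num.min r (Num.min d1 d2) by rewrite !lt_min r0 d10.
have d0 : 0 < d by rewrite divr_gt0.
have : d < Num.min r (Num.min d1 d2) by rewrite ltr_pdivrMr// ltr_pMr// ltr1n.
rewrite !lt_min => /and3P[dr dd1 dd2].
have {}H1 := H1 _ d0 dd1; have {}H2 := H2 _ d0 dd2.
have H3 := mollified_super e0 d0 dr.
have H4 := log_energy_gradient bxi xiM e0 (fun x => we e x d0) (bw e d) (bW^~ d) (bW2^~ d) (dw e d) (dW d).
have H5 := regularized_potential_le e0.
have pd0 x : 0 <= convol p (nbump d) x by apply: convol_ge0 => // y; exact: nbump_ge0.
have [Lpd _] := L1_moll d0 Lp.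
have [Lgd _] := L1_moll d0 Lg.
have w0 x : 0 < w e d x by rewrite (lt_le_trans e0)// we.
(* The source term has a favourable sign and is dropped from the energy estimate. *)
have G0 : 0 <= \int[mu]_x (convol g (nbump d) x * (xi x ^+ 2 / w e d x)).
  apply: Rintegral_ge0 => x _; rewrite mulr_ge0 ?divr_ge0 ?sqr_ge0 ?(ltW (w0 x))//.
  by apply: convol_ge0 => // y; exact: nbump_ge0.
pose S x := \sum_(j < n) xi x ^+ 2 * (W j d x / w e d x) ^+ 2.
have bWw j : bounded_lipschitz (fun x => W j d x / w e d x).
  apply: bounded_lipschitzM => //; apply: (bounded_lipschitzV e0) => // x; exact: we.
have LS : L1 S.
  by apply: L1_sum => j; apply: L1_bounded_lipschitz => //; exact: (bounded_lipschitzM (bWw j) (bWw j)).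
pose ld x := ln (1 + convol p (nbump d) x / e).
have bld : bounded_lipschitz ld.
  apply: (@bounded_lipschitz_comp _ _ _ (fun s => ln (1 + s / e)) e^-1).
  - by rewrite invr_ge0 ltW.
  - by move=> x y; apply: ln1D_dist_le.
  - exact: bounded_lipschitz_convol.
have bF := bounded_lipschitzM bld (bounded_lipschitz_beval b).
have [cF cF0 [FC lF]] := bF.
have FM x : M < `|x| -> ld x * beval b x = 0 by move=> /bM ->; rewrite mulr0.
have [LF F0] := integral_derive0 (delta_mx ord0 i) cF0 FC lF FM.
have dF x : is_derive x (delta_mx ord0 i) (fun x => ld x * beval b x)
    (ld x * beval (bderiv i b) x + W i d x / w e d x * beval b x).
  have dl : is_derive x (delta_mx ord0 i) ld ((w e d x)^-1 * W i d x).
    exact: (is_derive_chain (is_derive_convol (nbump d) i x Lp) (is_derive_ln1D e0 (pd0 x))).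
  have := is_deriveM dl (is_derive_beval b i x).
  rewrite (_ : _ + _ = ld x * beval (bderiv i b) x + W i d x / w e d x * beval b x)//.
  by rewrite /GRing.scale/=; ring.
have L2 : L1 (fun x => W i d x / w e d x * beval b x).
  have bWb := bounded_lipschitzM (bWw i) (bounded_lipschitz_beval b).
  have [c c0 [cb _]] := bWb.
  apply: (L1_bounded_support (bounded_lipschitz_measurable bWb) cb (M := M)) => x /bM ->.
  by rewrite mulr0.
have HF : \int[mu]_x (ld x * beval (bderiv i b) x) = - \int[mu]_x (W i d x / w e d x * beval b x).
  apply/eqP; rewrite -subr_eq0 opprK -RintegralD//; last exact: Llb.
  rewrite -F0; apply/eqP; apply: eq_Rintegral => x _.
  by have [_ ->] := dF x.
have HS : `|\int[mu]_x (ld x * beval (bderiv i b) x)| <= K * (\int[mu]_x (xi x ^+ 2) + \int[mu]_x S x).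
  rewrite HF normrN (le_trans (le_normr_Rintegral _ L2))//.
  rewrite -RintegralD// -RintegralZl//; last exact: L1D.
  apply: le_Rintegral => //; [exact: L1_abs L2|by apply: L1Z; exact: L1D|].
  move=> x _; rewrite normrM.
  apply: (@le_trans _ _ (`|W i d x / w e d x| * (K * xi x ^+ 2))); first by rewrite ler_wpM2l.
  rewrite mulrCA ler_wpM2l// mulrC.
  have -> : xi x ^+ 2 + S x = xi x ^+ 2 * (1 + \sum_(j < n) (W j d x / w e d x) ^+ 2).
    by rewrite mulrDr mulr1 mulr_sumr.
  rewrite ler_wpM2l ?sqr_ge0//.
  rewrite (bigD1 i)//= addrA (@le_trans _ _ (1 + (W i d x / w e d x) ^+ 2))//.
    by rewrite -[X in _ <= 1 + X]real_normK ?num_real.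
  by rewrite lerDl sumr_ge0// => j _; exact: sqr_ge0.
have HD : `|\int[mu]_x (ln (1 + p x / e) * beval (bderiv i b) x) -
     \int[mu]_x (ld x * beval (bderiv i b) x)| <= t / 2.
  have LB := Llb _ Lp p0; have LBd := Llb _ Lpd pd0.
  rewrite -RintegralB// (le_trans (le_normr_Rintegral _ (L1B LB LBd)))//.
  pose I x : R := \1_[set x : E | `|x| <= M] x.
  have LI : L1 (fun x => I x * `|convol p (nbump d) x - p x|).
    have mI : measurable_fun setT I by apply: measurable_indic; exact: measurable_rV_normball.
    have IC x : `|I x| <= 1 by rewrite /I indicE; case: (_ \in _); rewrite ?normr1 ?normr0.
    under [X in EFin \o X]eq_fun do rewrite mulrC.
    exact: (L1_bounded mI IC (L1_abs (L1B Lpd Lp))).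
  apply: (@le_trans _ _ (D * e^-1 * \int[mu]_x (I x * `|convol p (nbump d) x - p x|))).
    rewrite -RintegralZl//; apply: le_Rintegral => //.
    - exact: L1_abs (L1B LB LBd).
    - exact: L1Z.
    move=> x _; rewrite /I indicE; have [xM|xM] := leP `|x| M; last first.
      rewrite memNset; last by apply/negP; rewrite -ltNge.
      by rewrite dbM// !mulr0 subrr normr0 mul0r mulr0.
    rewrite mem_set// mul1r -mulrBl normrM mulrC -mulrA ler_pM//.
    by rewrite distrC [in leRHS]distrC distrC [in leRHS]distrC distrC; exact: ln1D_dist_le.
  have I0 : 0 <= \int[mu]_x (I x * `|convol p (nbump d) x - p x|).
    by apply: Rintegral_ge0 => x _; rewrite mulr_ge0.
  move: H2; rewrite -/I ler_pdivlMr// mulrDr mulr1 mulrC => /(le_trans _); apply.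
  by rewrite lerDl.
have HS2 : \int[mu]_x S x <= 4 * \int[mu]_x grad_sq xi x +
    2 * \int[mu]_x (`|Vt x| * xi x ^+ 2) + 2 * (t / 2 / (4 * K + 1)).
  exact: approx_energy_le G0 H1 H3 H4 H5.
have HK : K * (2 * (t / 2 / (4 * K + 1))) <= t / 2.
  have -> : K * (2 * (t / 2 / (4 * K + 1))) = t / 2 * (2 * K / (4 * K + 1)).
    by field; rewrite gt_eqF.
  rewrite -[leRHS]mulr1 ler_wpM2l//; first by rewrite divr_ge0// ltW.
  rewrite ler_pdivrMr// mul1r (le_trans (_ : _ <= 4 * K)) ?lerDl//.
  by rewrite ler_wpM2r// ler_nat.
exact: approx_log_le HS HD (ler_wpM2l K0 HS2) HK.
Qed.

Let P := [set x | 0 < p x].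

Let mP : measurable P.
Proof.
have := L1_measurable Lp measurableT (measurable_itv `]0, +oo[).
rewrite setTI; congr (measurable _); apply/seteqP.
by split => x; rewrite /P /= in_itv/= andbT.
Qed.

Let mIP : measurable_fun setT (\1_P : E -> R).
Proof. exact: measurable_indic. Qed.

Let IP1 x : `|\1_P x : R| <= 1.
Proof. by rewrite indicE; case: (_ \in _); rewrite ?normr1 ?normr0. Qed.

(** As [e] decreases to 0, the left side increases and monotone convergence applies in the extended
    reals, without knowing beforehand that the limit is finite. The potential term converges by
    dominated convergence; p / (p + e) tends to 1 only where p > 0, hence the hypothesis. *)
Lemma supersolution_le : {ae mu, forall x, xi x != 0 -> 0 < p x} ->
  (\int[mu]_x (g x / p x * xi x ^+ 2)%:E <=
   (\int[mu]_x grad_sq xi x + \int[mu]_x (Vt x * xi x ^+ 2))%:E)%E.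
Proof.
move=> aep.
pose e (k : nat) : R := harmonic k.
have e0 k : 0 < e k by exact: harmonic_gt0.
have pe0 k x : 0 < p x + e k by rewrite ltr_wpDl.
(* Where [p x] is 0 the quotient by [e k] could blow up, whereas [g x / p x] is 0 by the convention
   on inverses; the indicator reconciles the two. *)
pose F k x : \bar R := (\1_P x * (g x * (xi x ^+ 2 / (p x + e k))))%:E.
have Fk k : L1 (fun x => \1_P x * (g x * (xi x ^+ 2 / (p x + e k)))).
  under [X in EFin \o X]eq_fun do rewrite mulrC.
  exact: (L1_bounded mIP IP1 (L1_quotient (e0 k) Lg)).
have lim_e x : p x + e k @[k --> \oo] --> p x.
  by rewrite -[X in _ --> X]addr0; apply: cvgD; [exact: cvg_cst|exact: cvg_harmonic].
have F0 k x : setT x -> (0 <= F k x)%E.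
  by move=> _; rewrite lee_fin mulr_ge0// mulr_ge0// divr_ge0 ?sqr_ge0 ?(ltW (pe0 _ _)).
have ndF x : setT x -> {homo F^~ x : k m / (k <= m)%N >-> (k <= m)%E}.
  move=> _ k m km; rewrite lee_fin !ler_wpM2l ?sqr_ge0//.
  rewrite lef_pV2 ?posrE// lerD2l /e /= lef_pV2 ?posrE ?ltr0n// ler_nat ltnS.
  exact: km.
have mF k : measurable_fun setT (F k) by apply/measurable_EFinP; exact: L1_measurable (Fk k).
have limF x : limn (F^~ x) = (g x / p x * xi x ^+ 2)%:E.
  apply: cvg_lim => //; apply: cvg_EFin; first exact: nearW.
  rewrite /F indicE /=; have [Px|nPx] := pselect (P x).
    rewrite mem_set//= -mulrA [_^-1 * _]mulrC; under eq_fun do rewrite mul1r.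
    apply: cvgM; first exact: cvg_cst.
    apply: cvgM; first exact: cvg_cst.
    by apply: cvgV; [rewrite gt_eqF|exact: lim_e].
  have -> : p x = 0 by apply/eqP; rewrite eq_le p0 andbT leNgt; apply/negP.
  rewrite memNset//= invr0 mulr0 mul0r; under eq_fun do rewrite mul0r; exact: cvg_cst.
have cvgF := cvg_monotone_convergence measurableT mF F0 ndF.
under eq_integral do rewrite -limF.
pose Q k x := q x * (xi x ^+ 2 / (p x + e k)).
have [C C0 xC] := xi2C.
have [LQ cvgQ] : L1 (fun x => Vt x * xi x ^+ 2) /\
    \int[mu]_x Q k x @[k --> \oo] --> \int[mu]_x (Vt x * xi x ^+ 2).
  apply: (Rintegral_dct (g := fun x => `|Vt x| * xi x ^+ 2)) => //.
  - by move=> k; exact: L1_measurable (L1_quotient (e0 k) Lq).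
  - by apply: measurable_funM => //; exact: L1_measurable LV.
  - apply: aeS aep => x; have [xi0|x0 /(_ isT) Px] := eqVneq (xi x) 0.
      move=> _; rewrite xi0 expr0n mulr0; apply: cvg_near_cst; apply: nearW => k.
      by rewrite /Q xi0 expr0n mul0r mulr0.
    have -> : Vt x * xi x ^+ 2 = q x * (xi x ^+ 2 / p x) by field; rewrite gt_eqF.
    apply: cvgM; first exact: cvg_cst.
    apply: cvgM; first exact: cvg_cst.
    by apply: cvgV; [rewrite gt_eqF|exact: lim_e].
  - move=> k x; rewrite /Q.
    have -> : Vt x * p x * (xi x ^+ 2 / (p x + e k)) = Vt x * xi x ^+ 2 * (p x / (p x + e k)).
      by ring.
    rewrite normrM (normrM (Vt x)) (ger0_norm (sqr_ge0 _)) -[leRHS]mulr1 ler_wpM2l//.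
      by rewrite mulr_ge0// sqr_ge0.
    by rewrite ger0_norm ?divr_ge0 ?(ltW (pe0 _ _))// ler_pdivrMr// mul1r lerDl ltW.
have cvgR : (\int[mu]_x grad_sq xi x + \int[mu]_x Q k x)%:E @[k --> \oo] -->
    (\int[mu]_x grad_sq xi x + \int[mu]_x (Vt x * xi x ^+ 2))%:E.
  by apply: cvg_EFin; [exact: nearW|apply: cvgD => //; exact: cvg_cst].
apply: (lee_cvg_to (cvgF mu) cvgR); apply: nearW => k.
rewrite /F -(fineK (integrable_fin_num measurableT (Fk k))) lee_fin.
apply: le_trans (supersolution_le_regularized (e0 k)).
apply: le_Rintegral => //; first exact: L1_quotient.
move=> x _; rewrite -[leRHS]mul1r ler_wpM2r//.
  by rewrite mulr_ge0// divr_ge0 ?sqr_ge0 ?(ltW (pe0 _ _)).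
Qed.

(** The logarithms divided by k + 1 converge to the indicator of {p > 0} and are dominated by 1 + p,
    while their derivatives, tested against [b], are bounded by a constant over k + 1. The limit
    therefore has zero distributional derivative where such [b] can test it. *)
Lemma positivity_set_derive0 (i : 'I_n) (b : @bexp R n) (K : R) : 0 <= K ->
  (forall x, `|beval b x| <= K * xi x ^+ 2) ->
  \int[mu]_x (\1_P x * beval (bderiv i b) x) = 0.
Proof.
move=> K0 bK.
have bM x : M < `|x| -> beval b x = 0.
  by move=> /xi2M Mx; apply/eqP; rewrite -normr_le0 (le_trans (bK x))// Mx mulr0.
have dbM x : M < `|x| -> beval (bderiv i b) x = 0.
  by move=> Mx; rewrite -partial_beval (partial_eq0 _ bM Mx).
have [D D0 [dbD _]] := bounded_lipschitz_beval (bderiv i b).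
have mdb := bounded_lipschitz_measurable (bounded_lipschitz_beval (bderiv i b)).
(* With this choice log (1 / e k) is exactly k + 1, so the normalised logarithm is 1 + log (e k + p)
   / (k + 1). *)
pose e (k : nat) : R := expR (- k.+1%:R).
have e0 k : 0 < e k by exact: expR_gt0.
have k0 k : 0 < k.+1%:R :> R by rewrite ltr0n.
pose l k x : R := k.+1%:R^-1 * ln (1 + p x / e k).
have lE k x : l k x = 1 + k.+1%:R^-1 * ln (e k + p x).
  rewrite /l.
  have -> : 1 + p x / e k = expR k.+1%:R * (e k + p x).
    by rewrite /e expRN invrK mulrDr mulrV ?unitfE ?gt_eqF ?expR_gt0// mulrC.
  rewrite lnM ?posrE ?expR_gt0 ?ltr_pwDl// expRK mulrDr mulVf//.
have ln_0 k x : 0 <= ln (1 + p x / e k).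
  by apply: ln_ge0; rewrite lerDl divr_ge0// ltW.
have ml k : measurable_fun setT (l k).
  have mf : measurable_fun setT (fun x => 1 + p x / e k).
    by apply: measurable_funD => //; apply: measurable_funM => //; exact: L1_measurable Lp.
  apply: measurable_funM => //; exact: (measurableT_comp (@measurable_ln R) mf).
have lle k x : `|l k x| <= 1 + p x.
  rewrite ger0_norm; last by rewrite mulr_ge0// invr_ge0 ltW.
  have ek : e k <= 1 by rewrite /e -[leRHS]expR0 ler_expR oppr_le0.
  rewrite lE lerD2l ler_pdivrMl//.
  apply: (@le_trans _ _ (ln (1 + p x))).
    by rewrite ler_ln ?posrE ?ltr_pwDl// lerD2r.
  rewrite (le_trans (le_ln1Dx _))//; first by rewrite (@lt_le_trans _ _ 0) ?oppr_lt0.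
  by rewrite ler_peMl// ler1n.
have cvgl x : l k x @[k --> \oo] --> (\1_P x : R).
  rewrite indicE; have [Px|nPx] := pselect (P x); last first.
    rewrite memNset//; apply: cvg_near_cst; apply: nearW => k.
    have px0 : p x = 0 by apply/eqP; rewrite eq_le p0 andbT leNgt; apply/negP.
    by rewrite /l px0 mul0r addr0 ln1 mulr0.
  rewrite mem_set//; under eq_fun do rewrite lE.
  have H0 : harmonic k * ln (e k + p x) @[k --> \oo] --> (0 : R).
    pose c := `|ln (p x)| + `|ln (1 + p x)|.
    have Hc (a : R) : harmonic k * a @[k --> \oo] --> (0 : R).
      by rewrite -(mul0r a); apply: cvgM; [exact: cvg_harmonic|exact: cvg_cst].
    apply: (squeeze_cvgr _ (Hc (- c)) (Hc c)); apply: nearW => k.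
    rewrite !ler_wpM2l ?harmonic_ge0//.
      rewrite (@le_trans _ _ (ln (1 + p x)))//.
        by rewrite ler_ln ?posrE ?ltr_pwDl// lerD2r /e -[leRHS]expR0 ler_expR oppr_le0.
      by rewrite (le_trans (ler_norm _))// lerDr.
    rewrite (@le_trans _ _ (ln (p x)))//.
      by rewrite lerNl (le_trans (ler_norm _))// normrN lerDl.
    by rewrite ler_ln ?posrE ?ltr_pwDl// lerDr ltW.
  have := cvgD (cvg_cst (1 : R)) H0; rewrite addr0; exact.
have DM : L1 (fun x => D * \1_[set x : E | `|x| <= M] x + D * p x).
  by apply: L1D; apply: L1Z => //; exact: L1_normball.
have bnd k x : `|l k x * beval (bderiv i b) x| <= D * \1_[set x : E | `|x| <= M] x + D * p x.
  rewrite indicE; have [xM|xM] := leP `|x| M; last first.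
    by rewrite dbM// mulr0 normr0 addr_ge0// mulr_ge0.
  by rewrite mem_set//= -mulrDr normrM mulrC ler_pM.
have [] := @Rintegral_dct _ _ _ mu (fun k x => l k x * beval (bderiv i b) x)
  (fun x => \1_P x * beval (bderiv i b) x) _ _ _ _ DM.
- by move=> k; exact: measurable_funM.
- exact: measurable_funM.
- by apply: aeW => x; apply: cvgM; [exact: cvgl|exact: cvg_cst].
- exact: bnd.
move=> _ H.
pose B := K * (\int[mu]_x (xi x ^+ 2) + 4 * \int[mu]_x grad_sq xi x +
       2 * \int[mu]_x (`|Vt x| * xi x ^+ 2)).
have HB k : `|\int[mu]_x (l k x * beval (bderiv i b) x)| <= harmonic k * B.
  have Ll : L1 (fun x => ln (1 + p x / e k) * beval (bderiv i b) x).
    have Lk : L1 (fun x => k.+1%:R * (l k x * beval (bderiv i b) x)).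
      by apply: L1Z; apply: (L1_le _ _ DM); [exact: measurable_funM|exact: bnd].
    move: Lk; congr (integrable _ _ _); apply/funext => x /=; rewrite /l.
    by rewrite !mulrA mulfV ?pnatr_eq0// mul1r.
  under eq_Rintegral do rewrite /l -mulrA.
  rewrite RintegralZl// normrM ger0_norm ?invr_ge0//.
  by rewrite ler_wpM2l ?invr_ge0//; exact: log_derivative_le.
have H0 : \int[mu]_x (l k x * beval (bderiv i b) x) @[k --> \oo] --> (0 : R).
  have Hc (a : R) : harmonic k * a @[k --> \oo] --> (0 : R).
    by rewrite -(mul0r a); apply: cvgM; [exact: cvg_harmonic|exact: cvg_cst].
  apply: (squeeze_cvgr _ (Hc (- B)) (Hc B)); apply: nearW => k.
  by rewrite mulrN -ler_norml.
exact: (cvg_unique _ H H0).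
Qed.

End supersolution.

(** * Compact neighbourhoods and extension by zero *)

Section localization.
Context {R : realType} {n : nat}.
Local Notation E := 'rV[R]_n.
Local Notation mu := (@lebesgue_rV R n).
Local Notation L1 f := (mu.-integrable setT (EFin \o f)).
Implicit Types (K Omega D : set E) (f g xi : E -> R).

Lemma compact_norm_bounded K : compact K -> exists2 M, 0 <= M & forall x, K x -> `|x| <= M.
Proof.
move=> /compact_bounded[M [_ HM]]; exists (`|M| + 1); first by rewrite addr_ge0.
by move=> x Kx; apply: HM => //; rewrite ltr_pwDr// ler_norm.
Qed.

Lemma closed_rV_le (z : E) (r : R) : closed [set y : E | `|y - z| <= r].
Proof.
have cf : continuous (fun y : E => `|y - z|).
  apply: (@lipschitz_continuous _ _ _ 1) => x y; rewrite mul1r.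
  by rewrite (le_trans (ler_dist_dist _ _))// opprB addrA subrK.
exact: (closed_comp (fun y _ => cf y) (@closed_le R r)).
Qed.

Lemma compact_rV_le (z : E) (r : R) : compact [set y : E | `|y - z| <= r].
Proof.
apply: bounded_closed_compact; last exact: closed_rV_le.
exists (r + `|z|); split; first exact: num_real.
move=> M HM y /= yr; rewrite (le_trans _ (ltW HM))//.
by rewrite -{1}(subrK z y) (le_trans (ler_normD _ _))// lerD2r.
Qed.

Definition thicken K (r : R) : set E := [set y | exists2 x, K x & `|y - x| <= r].

Lemma compact_thicken K r : compact K -> compact (thicken K r).
Proof.
move=> cK.
have -> : thicken K r = (fun z : E * E => z.1 + z.2) @` (K `*` [set y : E | `|y - 0| <= r]).
  apply/seteqP; split => [y [x Kx yx]|_ [[x y] /= [Kx yr] <-]].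
    by exists (x, y - x) => /=; [split => //; rewrite subr0|rewrite addrC subrK].
  by exists x => //=; rewrite addrAC subrr add0r -[y]subr0.
have cKB := compact_setX cK (@compact_rV_le 0 r).
apply: continuous_compact; last exact: cKB.
by apply: continuous_subspaceT => z; exact: add_continuous.
Qed.

Lemma thicken_in_open K Omega : compact K -> open Omega -> K `<=` Omega ->
  exists2 r, 0 < r & thicken K r `<=` Omega.
Proof.
move=> /compact_near_coveringP cK oO KO.
(* In near-covering form, compactness turns a radius valid around each point into one radius for all
   of [K]. *)
have := cK R (0 : R)^'+ (fun r x => forall y : E, `|y - x| <= r -> Omega y) _.
case=> [x Kx|].
  have /nbhs_ballP[s /= s0 sO] : nbhs x Omega by apply: open_nbhs_nbhs; split => //; exact: KO.
  exists ([set y : E | `|x - y| < s / 2], [set r : R | r < s / 2]); last first.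
    move=> [x' r] /= [xx' rs] y yr; apply: sO; rewrite rV_ballE /=.
    rewrite (splitr s) -(subrK x' x) -addrA (le_lt_trans (ler_normD _ _))// ltrD//.
    by rewrite distrC (le_lt_trans yr).
  split => /=.
    by apply/nbhs_ballP; exists (s / 2) => /=; [rewrite divr_gt0|rewrite rV_ballE].
  by apply: nbhs_right_lt; rewrite divr_gt0.
move=> r /= r0 H; exists (r / 2); first by rewrite divr_gt0.
move=> y [x Kx yr]; apply: (H (r / 2)) Kx _ yr => /=.
  by rewrite sub0r normrN gtr0_norm ?divr_gt0// ltr_pdivrMr// ltr_pMr// ltr1n.
by rewrite divr_gt0.
Qed.

Lemma integral_restrict_ae D f g : measurable D -> measurable_fun D f ->
  measurable_fun setT g -> {ae mu, forall x, D x -> f x = g x} ->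
  (forall x, ~ D x -> g x = 0) ->
  (\int[mu]_(x in D) (f x)%:E = \int[mu]_x (g x)%:E)%E.
Proof.
move=> mD mf mg fg g0; rewrite integral_mkcond; apply: ae_eq_integral => //.
- by apply/(measurable_restrictT _ mD)/measurable_EFinP.
- exact/measurable_EFinP.
- apply: aeS fg => x fgx _; rewrite restrict_EFin /= patchE.
  by case: ifPn => [/set_mem/fgx -> //|/negP xD]; rewrite g0// => Dx; apply: xD; exact: mem_set.
Qed.

Lemma L1_restrict K f : measurable K -> mu.-integrable K (EFin \o f) ->
  L1 (fun x => \1_K x * f x).
Proof.
move=> mK /(integrable_mkcond _ mK); rewrite restrict_EFin; congr (integrable _ _ _).
apply/funext => x /=; rewrite patchE indicE.
by case: (x \in K); rewrite ?mul1r ?mul0r.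
Qed.

(* Omega need not be convex: two points of which one is in the support are either
   close, hence both in Omega, or far apart, where boundedness is enough. *)
Lemma W1infty_c_bounded_lipschitz Omega xi : open Omega -> W1infty_c Omega xi ->
  bounded_lipschitz xi.
Proof.
move=> oO [lip [cK KO]].
set K := closure _ in cK KO.
have xK x : xi x != 0 -> K x by move=> x0; exact: subset_closure.
have [L L0 lxi] : exists2 L, 0 <= L & forall x y, Omega x -> Omega y ->
    `|xi x - xi y| <= L * `|x - y|.
  move: lip => [L [_ HL]]; exists (`|L| + 1); first by rewrite addr_ge0.
  move=> x y Ox Oy; have /HL : L < `|L| + 1 by rewrite ltr_pwDr// ler_norm.
  by move=> /(_ (x, y)); apply.
have [M M0 KM] := compact_norm_bounded cK.
have [C C0 xC] : exists2 C, 0 <= C & forall x, `|xi x| <= C.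
  have [K0|/set0P[a Ka]] := eqVneq K set0.
    exists 0 => // x; have [->|/xK] := eqVneq (xi x) 0; first by rewrite normr0.
    by rewrite K0.
  exists (`|xi a| + L * (M + M)); first by rewrite addr_ge0// mulr_ge0// addr_ge0.
  move=> x; have [->|/xK Kx] := eqVneq (xi x) 0.
    by rewrite normr0 addr_ge0// mulr_ge0// addr_ge0.
  rewrite -[xi x](subrK (xi a)) (le_trans (ler_normD _ _))// addrC lerD2l.
  rewrite (le_trans (lxi _ _ (KO _ Kx) (KO _ Ka)))// ler_wpM2l//.
  by rewrite (le_trans (ler_normB _ _))// lerD// KM.
have [r r0 rO] := thicken_in_open cK oO KO.
exists (C + L + (C + C) / r).
  by rewrite !addr_ge0// divr_ge0 ?addr_ge0// ltW.
have Cr : 0 <= (C + C) / r by rewrite divr_ge0 ?addr_ge0// ltW.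
split=> [x|]; first by rewrite (le_trans (xC x))// -addrA lerDl addr_ge0.
have near x y : K x -> `|xi x - xi y| <= (C + L + (C + C) / r) * `|x - y|.
  move=> Kx; have [xy|xy] := leP `|x - y| r.
    rewrite (le_trans (lxi _ _ (KO _ Kx) _))//; last first.
      by rewrite ler_wpM2r// addrAC lerDr addr_ge0.
    by apply: rO; exists x => //; rewrite distrC.
  rewrite (le_trans (ler_normB _ _))// (le_trans (lerD (xC x) (xC y)))//.
  apply: (@le_trans _ _ ((C + C) / r * `|x - y|)); last first.
    by rewrite ler_wpM2r// lerDr addr_ge0.
  by rewrite mulrAC ler_pdivlMr// ler_wpM2l ?addr_ge0// ltW.
move=> x y; have [x0|/xK/near//] := eqVneq (xi x) 0.
have [y0|/xK/near Ky] := eqVneq (xi y) 0; last by rewrite distrC (distrC x).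
by rewrite x0 y0 subrr normr0 mulr_ge0// !addr_ge0.
Qed.

Lemma partial_eq0_off_support xi i x : ~ closure [set y | xi y != 0] x -> partial i xi x = 0.
Proof.
move=> nx; have H0 : is_derive x (delta_mx ord0 i) (cst 0 : E -> R) 0 by exact: is_derive_cst.
have [] // := near_eq_is_derive _ H0 (g := xi).
have : nbhs x (~` closure [set y | xi y != 0]).
  by apply: open_nbhs_nbhs; split => //; apply: closed_openC; exact: closed_closure.
apply: filterS => y ny; apply/esym/eqP; apply: contrapT => /negP y0; apply: ny.
exact: subset_closure.
Qed.

End localization.

(** * From the distributional inequality on Omega to the mollified one *)

Section local_supersolution.
Context {R : realType} {n : nat}.
Local Notation E := 'rV[R]_n.
Local Notation mu := (@lebesgue_rV R n).
Local Notation L1 f := (mu.-integrable setT (EFin \o f)).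
Variables (Omega : set E) (V h Phi : E -> R).
Hypotheses (oO : open Omega) (hV : L1loc Omega V) (hh : L1loc Omega h)
  (h_ge0 : {ae mu, forall x, Omega x -> 0 <= h x})
  (hPhi : L1loc Omega Phi)
  (Phi_ge0 : {ae mu, forall x, Omega x -> 0 <= Phi x})
  (hVPhi : L1loc Omega (fun x => V x * Phi x))
  (Phi_super : distr_supersolution Omega V h Phi).
Implicit Types (K : set E) (xi : E -> R).

Let mO : measurable Omega. Proof. exact: open_measurable_rV. Qed.

Let loc K (f : E -> R) x : R := \1_K x * f x.

Let loc_in K f x : K x -> loc K f x = f x.
Proof. by move=> Kx; rewrite /loc indicE mem_set// mul1r. Qed.

Let loc_out K f x : ~ K x -> loc K f x = 0.
Proof. by move=> Kx; rewrite /loc indicE memNset// mul0r. Qed.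

(** The hypotheses give signs only almost everywhere. Absolute values make the truncated functions
    nonnegative at every point and change them only on a null set. *)
Let p K := loc K (fun x => `|Phi x|).
Let g K := loc K (fun x => `|h x|).
Let Vt K := loc K V.
Let q K x := Vt K x * p K x.

Let L1_loc_norm K f : compact K -> K `<=` Omega -> L1loc Omega f -> L1 (loc K (fun x => `|f x|)).
Proof.
move=> cK KO [_ /(_ _ cK KO) Lf]; have mK := compact_measurable_rV cK.
have := L1_abs (L1_restrict mK Lf); congr (integrable _ _ _); apply/funext => x /=.
by rewrite normrM (ger0_norm (_ : 0 <= \1_K x)).
Qed.

Let Lp K : compact K -> K `<=` Omega -> L1 (p K).
Proof. by move=> cK KO; exact: L1_loc_norm. Qed.

Let Lg K : compact K -> K `<=` Omega -> L1 (g K).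
Proof. by move=> cK KO; exact: L1_loc_norm. Qed.

Let LVt K : compact K -> K `<=` Omega -> L1 (Vt K).
Proof.
by move=> cK KO; apply: L1_restrict; [exact: compact_measurable_rV|exact: hV.2].
Qed.

Let Lq K : compact K -> K `<=` Omega -> L1 (q K).
Proof.
move=> cK KO; have LVP := L1_loc_norm cK KO hVPhi.
apply: (L1_le _ _ LVP).
  by apply: measurable_funM; apply: L1_measurable; [exact: LVt|exact: Lp].
move=> x; rewrite /q /Vt /p; have [Kx|Kx] := pselect (K x).
  by rewrite !loc_in// normrM normr_id normrM.
by rewrite !loc_out// mul0r normr0.
Qed.

Let p0 K x : 0 <= p K x.
Proof. by rewrite mulr_ge0. Qed.

Let g0 K x : 0 <= g K x.
Proof. by rewrite mulr_ge0. Qed.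

Let ae_norm (f : E -> R) : {ae mu, forall x, Omega x -> 0 <= f x} ->
  {ae mu, forall x, Omega x -> `|f x| = f x}.
Proof. by apply: aeS => x H /H /ger0_norm. Qed.

(** Test with y |-> k_d(y - x). Its support lies in the closed ball of radius [d] about [x], hence
    in [K], so truncating the data to [K] changes neither side; the Laplacian falls on the kernel,
    and each integral becomes a convolution at [x]. *)
Lemma local_mollified_super K d x : compact K -> K `<=` Omega -> 0 < d ->
  (forall y, `|y - x| <= d -> K y) ->
  convol (g K) (nbump d) x <=
  - (\sum_(i < n) convol (p K) (bderiv i (bderiv i (nbump d))) x) + convol (q K) (nbump d) x.
Proof.
move=> cK KO d0 ballK.
pose eta := beval (bshift (- x) (nbump d)).
have etaE y : eta y = beval (nbump d) (y - x) by rewrite /eta beval_shift.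
have eta0 y : d < `|y - x| -> eta y = 0.
  by move=> dy; rewrite etaE (@nbump_eq0 _ _ d)// ltW.
have lapE y : laplacian eta y = \sum_(i < n) beval (bderiv i (bderiv i (nbump d))) (y - x).
  by rewrite laplacian_beval; apply: eq_bigr => i _; rewrite !bderiv_shift beval_shift.
have lap0 y i : d < `|y - x| -> beval (bderiv i (bderiv i (nbump d))) (y - x) = 0.
  by move=> dy; apply: (@bderiv_eq0 _ _ (nbump d) d [:: i; i]) => // z; exact: nbump_eq0.
have sub : closure [set y | eta y != 0] `<=` [set y | `|y - x| <= d].
  rewrite [X in _ `<=` X](closure_id _).1; last exact: closed_rV_le.
  apply: closure_subset => y /= /negP y0; rewrite leNgt; apply/negP => dy.
  by apply: y0; rewrite eta0.
have Ceta : Cc_infty Omega eta.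
  split; first exact: smooth_beval.
  split; last by move=> y /sub/ballK/KO.
  apply: (subclosed_compact _ cK); first exact: closed_closure.
  by move=> y /sub/ballK.
have LHS : (\int[mu]_(y in Omega) (h y * eta y)%:E = (convol (g K) (nbump d) x)%:E)%E.
  rewrite /convol /Rintegral fineK; last exact: (integrable_fin_num measurableT (L1_convol _ _ (Lg cK KO))).
  apply: integral_restrict_ae => //.
  - apply: measurable_funM; first exact: hh.1.
    apply: measurable_funTS; apply: bounded_lipschitz_measurable; exact: bounded_lipschitz_beval.
  - exact: L1_measurable (L1_convol _ _ (Lg cK KO)).
  - apply: aeS (ae_norm h_ge0) => y H /H hy; rewrite etaE.
    have [dy|dy] := leP `|y - x| d; first by rewrite /g loc_in ?hy//; exact: ballK.
    by rewrite -etaE eta0// !mulr0.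
  - by move=> y nO; rewrite /g loc_out ?mul0r// => /KO.
pose G y := p K y * - (\sum_(i < n) beval (bderiv i (bderiv i (nbump d))) (y - x)) +
  q K y * beval (nbump d) (y - x).
have LG1 i : L1 (fun y => p K y * beval (bderiv i (bderiv i (nbump d))) (y - x)).
  exact: L1_convol (Lp cK KO).
have GE : G = (fun y => -1 * (\sum_(i < n) p K y * beval (bderiv i (bderiv i (nbump d))) (y - x)) +
    q K y * beval (nbump d) (y - x)).
  by apply/funext => y; rewrite /G mulrN mulN1r mulr_sumr.
have LG2 : L1 (fun y => \sum_(i < n) p K y * beval (bderiv i (bderiv i (nbump d))) (y - x)).
  exact: L1_sum.
have LG3 : L1 (fun y => q K y * beval (nbump d) (y - x)) by exact: L1_convol (Lq cK KO).
have LG : L1 G by rewrite GE; apply: L1D => //; exact: L1Z.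
have IG : \int[mu]_y G y = - (\sum_(i < n) convol (p K) (bderiv i (bderiv i (nbump d))) x) +
    convol (q K) (nbump d) x.
  rewrite GE RintegralD//; last exact: L1Z.
  by rewrite RintegralZl// Rintegral_sum// mulN1r.
have RHS : (\int[mu]_(y in Omega) (Phi y * (- laplacian eta y + V y * eta y))%:E =
    (\int[mu]_y G y)%:E)%E.
  rewrite /Rintegral fineK; last exact: (integrable_fin_num measurableT LG).
  have meta : measurable_fun Omega eta.
    by apply: measurable_funTS; apply: bounded_lipschitz_measurable; exact: bounded_lipschitz_beval.
  apply: integral_restrict_ae => //.
  - apply: measurable_funM; first exact: hPhi.1.
    apply: measurable_funD; last by apply: measurable_funM => //; exact: hV.1.
    apply: measurableT_comp => //.
    rewrite (_ : laplacian eta = (fun y => \sum_(i < n) beval (bderiv i (bderiv i (bshift (- x) (nbump d)))) y)).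
      apply: measurable_sum => i; apply: measurable_funTS; apply: bounded_lipschitz_measurable.
      exact: bounded_lipschitz_beval.
    by apply/funext => y; exact: laplacian_beval.
  - exact: L1_measurable LG.
  - apply: aeS (ae_norm Phi_ge0) => y H /H Py; rewrite /G lapE etaE.
    have [dy|dy] := leP `|y - x| d.
      by have Ky := ballK _ dy; rewrite /q /Vt /p !loc_in// Py; ring.
    rewrite -etaE eta0// big1 => [|i _]; last exact: lap0.
    by rewrite oppr0 !mulr0 addr0 mulr0.
  - move=> y nO; have nK : ~ K y by move/KO.
    by rewrite /G /q /Vt /p !loc_out// !mul0r addr0.
have := Phi_super Ceta; rewrite LHS RHS lee_fin IG; apply.
by move=> y; rewrite etaE; exact: nbump_ge0.
Qed.

Let local_data xi : compact_support_in Omega xi -> exists K M r,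
  [/\ compact K, K `<=` Omega, 0 < r, 0 <= M & (forall x, K x -> `|x| <= M) /\
    forall x y, xi x != 0 -> `|y - x| <= r -> K y].
Proof.
move=> [cK KO]; have [r r0 rO] := thicken_in_open cK oO KO.
have cT := @compact_thicken _ _ _ r cK; have [M M0 TM] := compact_norm_bounded cT.
exists (thicken (closure [set x | xi x != 0]) r), M, r; split => //; split => //.
by move=> x y x0 yx; exists x => //; exact: subset_closure.
Qed.

(** The quadratic form is shown to equal a real number. The resulting finiteness of the left side is
    recorded for the local integrability of the quotient. *)
Lemma local_supersolution_le xi : {ae mu, forall x, Omega x -> 0 < Phi x} ->
  bounded_lipschitz xi -> compact_support_in Omega xi ->
  (\int[mu]_(x in Omega) (h x / Phi x * xi x ^+ 2)%:E <= quadratic_form Omega V xi)%E /\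
  (\int[mu]_(x in Omega) (h x / Phi x * xi x ^+ 2)%:E < +oo)%E.
Proof.
move=> Phi0 bxi cxi.
have [K [M [r [cK KO r0 M0 [KM xiK]]]]] := local_data cxi.
have xiK' x : xi x != 0 -> K x by move=> x0; apply: (xiK x) => //; rewrite subrr normr0 ltW.
have xi0 x : ~ K x -> xi x = 0.
  by move=> nK; apply/eqP; apply: contrapT => /negP /xiK'.
have nK x : M < `|x| -> ~ K x by move=> Mx /KM; rewrite leNgt Mx.
have xiM x : M < `|x| -> xi x = 0 by move=> /nK/xi0.
have mxi2 : measurable_fun setT (fun x => xi x ^+ 2).
  by apply: measurable_funX; exact: bounded_lipschitz_measurable.
have super d x : 0 < d -> d < r -> xi x != 0 -> convol (g K) (nbump d) x <=
    - (\sum_(i < n) convol (p K) (bderiv i (bderiv i (nbump d))) x) + convol (q K) (nbump d) x.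
  move=> d0 dr x0; apply: local_mollified_super => // y yd.
  by apply: (xiK x) => //; rewrite (le_trans yd)// ltW.
have pos : {ae mu, forall x, xi x != 0 -> 0 < p K x}.
  apply: aeS Phi0 => x Phix x0; have Kx := xiK' _ x0.
  by rewrite /p loc_in// normr_gt0 gt_eqF// Phix//; exact: KO.
have H := supersolution_le (Lp cK KO) (Lg cK KO) (LVt cK KO) (Lq cK KO) (p0 K) (g0 K) M0
  (fun x Mx => loc_out _ (nK _ Mx)) (fun x Mx => loc_out _ (nK _ Mx)) bxi xiM r0 super pos.
have LHS : (\int[mu]_(x in Omega) (h x / Phi x * xi x ^+ 2)%:E =
    \int[mu]_x (g K x / p K x * xi x ^+ 2)%:E)%E.
  apply: integral_restrict_ae => //.
  - apply: measurable_funM; last exact: measurable_funTS.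
    apply: measurable_funM; first exact: hh.1.
    exact: (measurableT_comp (@measurable_invr R) hPhi.1).
  - apply: measurable_funM => //; apply: measurable_funM; first exact: L1_measurable (Lg cK KO).
    by apply: measurable_funV; exact: L1_measurable (Lp cK KO).
  - apply: aeS (aeI (ae_norm h_ge0) (ae_norm Phi_ge0)) => x [hx Px] Ox.
    have [Kx|nKx] := pselect (K x); first by rewrite /g /p !loc_in// hx// Px.
    by rewrite xi0// expr0n !mulr0.
  - by move=> x nO; rewrite xi0 ?expr0n ?mulr0// => /KO.
have LVxi : L1 (fun x => Vt K x * xi x ^+ 2).
  have [C C0 [xC _]] := bxi.
  apply: (L1_bounded (C := C ^+ 2) mxi2 _ (LVt cK KO)) => x.
  by rewrite normrX lerXn2r ?nnegrE.
have RHS : quadratic_form Omega V xi =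
    (\int[mu]_x grad_sq xi x + \int[mu]_x (Vt K x * xi x ^+ 2))%:E.
  have Lgr := L1_grad_sq bxi xiM.
  rewrite -RintegralD// /Rintegral fineK; last first.
    exact: (integrable_fin_num measurableT (L1D Lgr LVxi)).
  apply: integral_restrict_ae => //.
  - apply: measurable_funD; first by apply: measurable_funTS; exact: L1_measurable Lgr.
    by apply: measurable_funM; [exact: hV.1|exact: measurable_funTS].
  - exact: L1_measurable (L1D Lgr LVxi).
  - apply: aeW => x Ox; have [Kx|nKx] := pselect (K x); first by rewrite /Vt loc_in.
    by rewrite xi0// expr0n !mulr0.
  - move=> x nO; rewrite xi0 ?expr0n ?mulr0 ?addr0; last by move/KO.
    rewrite /grad_sq big1// => i _; rewrite partial_eq0_off_support ?expr0n//.
    by move/(cxi.2 _).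
by rewrite LHS RHS; split => //; rewrite (le_lt_trans H)// ltry.
Qed.

Lemma local_positivity_set_derive0 xi (i : 'I_n) (b : @bexp R n) (C : R) :
  bounded_lipschitz xi -> compact_support_in Omega xi -> 0 <= C ->
  (forall x, `|beval b x| <= C * xi x ^+ 2) ->
  (forall x, beval (bderiv i b) x != 0 -> xi x != 0) ->
  \int[mu]_x (\1_[set x | Omega x /\ Phi x != 0] x * beval (bderiv i b) x) = 0.
Proof.
move=> bxi cxi C0 bC bxi0.
have [K [M [r [cK KO r0 M0 [KM xiK]]]]] := local_data cxi.
have xiK' x : xi x != 0 -> K x by move=> x0; apply: (xiK x) => //; rewrite subrr normr0 ltW.
have xi0 x : ~ K x -> xi x = 0.
  by move=> nK; apply/eqP; apply: contrapT => /negP /xiK'.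
have nK x : M < `|x| -> ~ K x by move=> Mx /KM; rewrite leNgt Mx.
have xiM x : M < `|x| -> xi x = 0 by move=> /nK/xi0.
have super d x : 0 < d -> d < r -> xi x != 0 -> convol (g K) (nbump d) x <=
    - (\sum_(i < n) convol (p K) (bderiv i (bderiv i (nbump d))) x) + convol (q K) (nbump d) x.
  move=> d0 dr x0; apply: local_mollified_super => // y yd.
  by apply: (xiK x) => //; rewrite (le_trans yd)// ltW.
apply: etrans (positivity_set_derive0 (Lp cK KO) (Lg cK KO) (LVt cK KO) (Lq cK KO) (p0 K) (g0 K) M0
  (fun x Mx => loc_out _ (nK _ Mx)) bxi xiM r0 super i C0 bC).
apply: eq_Rintegral => x _.
(* Where the derivative of [b] does not vanish, the point lies in [K], and on [K] the set {p > 0}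
   coincides with the set where Phi is nonzero. *)
have [->|/bxi0/xiK' Kx] := eqVneq (beval (bderiv i b) x) 0; first by rewrite !mulr0.
congr (_ * _); rewrite !indicE; congr (_%:R); congr (nat_of_bool _).
apply/idP/idP => /set_mem /= H; apply/mem_set => /=.
  by rewrite /p loc_in// normr_gt0; exact: H.2.
by split; [exact: KO|move: H; rewrite /p loc_in// normr_gt0].
Qed.

End local_supersolution.

(** * The zero-one law on a connected set and positivity *)

Section strong_maximum_principle.
Context {R : realType} {n : nat}.
Local Notation E := 'rV[R]_n.
Local Notation mu := (@lebesgue_rV R n).
Local Notation L1 f := (mu.-integrable setT (EFin \o f)).
Implicit Types (K Omega A B : set E) (f g xi : E -> R).

Lemma L1_indic A (M : R) : measurable A -> (forall x, A x -> `|x| <= M) -> L1 (\1_A).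
Proof.
move=> mA AM; apply: (@L1_bounded_support _ _ _ 1 M); first exact: measurable_indic.
  by move=> x; rewrite indicE; case: (_ \in _); rewrite ?normr1 ?normr0.
by move=> x Mx; rewrite indicE memNset// => /AM; rewrite leNgt Mx.
Qed.

(** The indicator of the r/2-neighbourhood of [K] is mollified at radius r/2: around a point of [K]
    the kernel sees only the value 1, and outside the r-neighbourhood only 0. *)
Lemma cutoff K Omega : compact K -> open Omega -> K `<=` Omega -> exists xi,
  [/\ bounded_lipschitz xi, compact_support_in Omega xi & forall x, K x -> xi x = 1].
Proof.
move=> cK oO KO; have [r r0 rO] := thicken_in_open cK oO KO.
have r20 : 0 < r / 2 by rewrite divr_gt0.
have cT := @compact_thicken _ _ _ r cK.
have cT2 := @compact_thicken _ _ _ (r / 2) cK.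
have mT2 := compact_measurable_rV cT2.
have [M M0 TM] := compact_norm_bounded cT2.
have LT2 := L1_indic mT2 TM.
exists (convol (\1_(thicken K (r / 2))) (nbump (r / 2))); split.
- exact: bounded_lipschitz_convol.
- have sub : closure [set x | convol (\1_(thicken K (r / 2))) (nbump (r / 2)) x != 0] `<=` thicken K r.
    rewrite [X in _ `<=` X](closure_id _).1; last by apply: compact_closed => //; exact: norm_hausdorff.
    apply: closure_subset => x /=; apply: contra_neqP => nx.
    rewrite /convol -[RHS](mul0r (fine (mu setT))) -(Rintegral_cst mu measurableT).
    apply: eq_Rintegral => y _; rewrite indicE.
    have [[z Kz yz]|ny] := pselect (thicken K (r / 2) y); last by rewrite memNset// mul0r.
    rewrite nbump_eq0 ?mulr0//; rewrite leNgt; apply/negP => yx; apply: nx; exists z => //.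
    rewrite -(subrK y x) -addrA (le_trans (ler_normD _ _))// (splitr r) lerD// distrC.
    exact: ltW.
  split; last by move=> x /sub/rO.
  by apply: (subclosed_compact _ cT) => //; exact: closed_closure.
- move=> x Kx; rewrite /convol; apply: etrans (Rintegral_nbump x r20); apply: eq_Rintegral => y _.
  rewrite indicE; have [yx|yx] := leP (r / 2) `|y - x|.
    by rewrite nbump_eq0// mulr0.
  by rewrite mem_set ?mul1r//; exists x => //; exact: ltW.
Qed.

(** Move from [z] to [x] by changing one coordinate at a time, [y s] having already changed those in
    [s]. A ball of the sup norm is a box, so all these segments stay inside it, and the mean value
    theorem applies to each. *)
Lemma derive0_constant_ball f (z x : E) (r : R) :
  (forall i y, `|y - z| < r -> is_derive y (delta_mx ord0 i) f 0) ->
  `|x - z| < r -> f x = f z.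
Proof.
move=> df xz; have r0 : 0 < r by apply: le_lt_trans xz.
pose y (s : seq 'I_n) : E := \row_j (if j \in s then x ord0 j else z ord0 j).
have segment (phi : R -> R) (a b : R) : a < b ->
    (forall t, t \in `[a, b] -> is_derive t 1 phi 0) -> phi a = phi b.
  move=> ab dphi; have cphi : {within `[a, b], continuous phi}.
    by apply: derivable_within_continuous => t tab; have [] := dphi t tab.
  have dphi' t : t \in `]a, b[ -> is_derive t 1 phi 0.
    by move=> tab; apply: dphi; exact: subset_itv_oo_cc.
  have [c _] := MVT ab dphi' cphi; rewrite mul0r => /eqP.
  by rewrite subr_eq0 => /eqP.
suff H s : f (y s) = f z.
  rewrite -(H (enum 'I_n)); congr f; apply/rowP => j.
  by rewrite !mxE mem_enum.
elim: s => [|i s IH]; first by congr f; apply/rowP => j; rewrite !mxE.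
rewrite -{}IH; have [is_|is_] := boolP (i \in s).
  by congr f; apply/rowP => j; rewrite !mxE inE; case: eqP => [->|//]; rewrite is_.
pose a := x ord0 i - z ord0 i.
pose phi (t : R) := f (y s + t *: delta_mx ord0 i).
have -> : y (i :: s) = y s + a *: delta_mx ord0 i.
  apply/rowP => j; rewrite !mxE inE; have [->|ij] := eqVneq j i.
    by rewrite (negbTE is_)/= mulr1 addrC subrK.
  by rewrite andbF mulr0 addr0.
have -> : f (y s) = phi 0 by rewrite /phi scale0r addr0.
have dphi (t : R) : `|t| <= `|a| -> is_derive t 1 phi 0.
  move=> ta; apply: (is_derive_line f _ _ t 0).1; apply: df; apply/(rV_norm_ltP _ r0) => j.
  rewrite !mxE; have [->|ij] := eqVneq j i.
    rewrite (negbTE is_)/= mulr1 addrAC subrr add0r (le_lt_trans ta)// /a.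
    by have /(rV_norm_ltP _ r0)/(_ i) := xz; rewrite !mxE.
  rewrite andbF mulr0 addr0; case: ifP => _; last by rewrite subrr normr0.
  by have /(rV_norm_ltP _ r0)/(_ j) := xz; rewrite !mxE.
rewrite -/(phi a); have [a0|a0|->//] := ltgtP a 0.
- apply: segment => // t; rewrite in_itv/= => /andP[at_ t0]; apply: dphi.
  by rewrite !ler0_norm ?lerN2// ltW.
- apply/esym/segment => // t; rewrite in_itv/= => /andP[t0 ta]; apply: dphi.
  by rewrite !ger0_norm// ltW.
Qed.

(* The mollified indicators of A are constant in the ball. *)
Lemma zero_one_ball A (z : E) (r s0 : R) : measurable A -> 0 < r -> 0 < s0 ->
  (forall s x i, 0 < s -> s < s0 -> `|x - z| < r ->
    \int[mu]_y (\1_A y * beval (bderiv i (nbump s)) (y - x)) = 0) ->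
  mu (ball z r `&` A) = 0%E \/ mu (ball z r `&` ~` A) = 0%E.
Proof.
move=> mA r0 s00 H.
(* Cutting [A] to this ball makes its indicator integrable; kernels of radius below [s0] centred
   within [r] of [z] do not see the cut. *)
pose B := [set y : E | `|y - z| <= r + s0].
have mB : measurable B by apply: compact_measurable_rV; exact: compact_rV_le.
pose M := r + s0 + `|z|.
have BM x : B x -> `|x| <= M.
  by move=> xz; rewrite -(subrK z x) (le_trans (ler_normD _ _))// lerD2r.
have M0 : 0 <= M by rewrite !addr_ge0// ltW.
have mAB : measurable (A `&` B) by exact: measurableI.
have Lu : L1 (\1_(A `&` B)) by apply: (L1_indic mAB (M := M)) => x [_ /BM].
have uM x : M < `|x| -> (\1_(A `&` B) x : R) = 0.
  by move=> Mx; rewrite indicE memNset// => -[_ /BM]; rewrite leNgt Mx.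
have dF s x i : 0 < s -> s < s0 -> `|x - z| < r ->
    is_derive x (delta_mx ord0 i) (convol (\1_(A `&` B)) (nbump s)) 0.
  move=> s1 s2 xz; have := is_derive_convol (nbump s) i x Lu.
  rewrite (_ : convol _ (bderiv i _) x = 0) ?oppr0//.
  rewrite -(H s x i s1 s2 xz); apply: eq_Rintegral => y _.
  have [ys|ys] := leP `|y - x| s; last first.
    rewrite (@bderiv_eq0 _ _ (nbump s) s [:: i])// ?mulr0// => w.
    exact: nbump_eq0.
  congr (_ * _); rewrite !indicE; congr (nat_of_bool _)%:R.
  have By : B y.
    rewrite /B /= -(subrK x y) -addrA (le_trans (ler_normD _ _))// [leRHS]addrC lerD//; last exact: ltW.
    by rewrite (le_trans ys)// ltW.
  by apply/idP/idP => /set_mem => [[Ay _]|Ay]; apply/mem_set.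
have mball : measurable (ball z r) by exact: measurable_rV_ball.
have ballM x : ball z r x -> `|x| <= M.
  rewrite rV_ballE /= distrC => xz; apply: BM; rewrite /B /= (le_trans (ltW xz))//.
  by rewrite lerDl ltW.
have mBA : measurable (ball z r `&` A) by exact: measurableI.
have mBnA : measurable (ball z r `&` ~` A) by apply: measurableI => //; exact: measurableC.
have La : L1 (\1_(ball z r `&` A)) by apply: (L1_indic mBA (M := M)) => x [/ballM].
have Lb : L1 (\1_(ball z r `&` ~` A)) by apply: (L1_indic mBnA (M := M)) => x [/ballM].
set a := \int[mu]_x (\1_(ball z r `&` A) x : R).
set b := \int[mu]_x (\1_(ball z r `&` ~` A) x : R).
have mu0 S : measurable S -> L1 (\1_S) -> \int[mu]_x (\1_S x : R) = 0 -> mu S = 0%E.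
  move=> mS LS; rewrite /Rintegral => S0.
  have := integral_indic mu measurableT mS; rewrite setIT => <-.
  by rewrite -[LHS](fineK (integrable_fin_num measurableT LS)) S0.
have a0 : 0 <= a by exact: Rintegral_ge0.
have b0 : 0 <= b by exact: Rintegral_ge0.
have [ab|] := ltP 0 (Num.min a b); last first.
  rewrite ge_min => /orP[a1|b1]; [left|right]; apply: mu0 => //; apply/eqP.
    by rewrite eq_le a1 a0.
  by rewrite eq_le b1 b0.
exfalso; have t0 : 0 < Num.min a b / 2 by rewrite divr_gt0.
have [d0 d00 Hd] := moll_cvg M0 Lu uM t0.
pose s := Num.min d0 s0 / 2.
have m0 : 0 < Num.min d0 s0 by rewrite lt_min d00.
have s1 : 0 < s by rewrite divr_gt0.
have : s < Num.min d0 s0 by rewrite ltr_pdivrMr// ltr_pMr// ltr1n.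
rewrite lt_min => /andP[sd ss].
have {}Hd := Hd _ s1 sd.
have [LF _] := L1_moll s1 Lu.
set F := convol _ _ in Hd LF.
have Fc x : ball z r x -> F x = F z.
  rewrite rV_ballE /= distrC => xz; apply: (derive0_constant_ball _ xz) => i y yz.
  exact: dF.
(* On the ball the mollified indicator is the constant F z, and the left side is its L1 distance
   there to the indicator of [A]. As |F z - 1| + |F z| >= 1, this distance is at least min(a, b) >
   0, which contradicts the bound by half of it. *)
have : `|F z - 1| * a + `|F z| * b <= Num.min a b / 2.
  apply: le_trans Hd; rewrite /a /b -!RintegralZl// -RintegralD//; [|exact: L1Z|exact: L1Z].
  apply: le_Rintegral => //.
  - by apply: L1D; exact: L1Z.
  - have LFu := L1_abs (L1B LF Lu).
    under [X in EFin \o X]eq_fun do rewrite mulrC.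
    apply: (L1_bounded (C := 1)) LFu; first by apply: measurable_indic; exact: measurable_rV_normball.
    by move=> x; rewrite indicE; case: (_ \in _); rewrite ?normr1 ?normr0.
  move=> x _; have [zx|nzx] := pselect (ball z r x); last first.
    rewrite !indicE memNset; last by case.
    rewrite (memNset (A := ball z r `&` ~` A)); last by case.
    by rewrite !mulr0 addr0 mulr_ge0.
  have Bx : B x.
    by move: zx; rewrite rV_ballE /B /= distrC => /ltW/le_trans; apply; rewrite lerDl ltW.
  rewrite (Fc _ zx) !indicE (mem_set (BM _ Bx : [set x | `|x| <= M] x)) mul1r.
  have [Ax|nAx] := pselect (A x).
    rewrite mem_set// memNset; last by case.
    by rewrite mem_set// mulr1 mulr0 addr0.
  rewrite memNset; last by case.
  rewrite mem_set// memNset; last by case.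
  by rewrite mulr0 add0r mulr1 subr0.
have ma : Num.min a b <= a by rewrite ge_min lexx.
have mb : Num.min a b <= b by rewrite ge_min lexx orbT.
have one : 1 <= `|F z - 1| + `|F z|.
  rewrite (@le_trans _ _ `|F z - (F z - 1)|)//; first by rewrite subKr normr1.
  by rewrite [leRHS]addrC ler_normB.
have := lerD (ler_wpM2l (normr_ge0 (F z - 1)) ma) (ler_wpM2l (normr_ge0 (F z)) mb).
rewrite -mulrDl => /(le_trans (ler_wpM2r (ltW ab) one)) h1 /(le_trans h1).
by rewrite mul1r leNgt ltr_pdivrMr// ltr_pMr// ltr1n.
Qed.

(** A Lindelof argument: every point of Omega lies in one of countably many balls with rational
    centre and radius [k.+1%:R^-1] that meet [A] in a negligible set. *)
Lemma negligible_locally Omega A :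
  (forall z, Omega z -> exists2 r, 0 < r & mu.-negligible (ball z r `&` A)) ->
  mu.-negligible (Omega `&` A).
Proof.
move=> H.
pose c (q : 'rV[rat]_n) : E := map_mx ratr q.
pose G (i : 'rV[rat]_n * nat) : set E := ball (c i.1) i.2.+1%:R^-1 `&` A.
(* The rational balls are enumerated by [unpickle]; those with a non-negligible trace on [A] are
   replaced by the empty set. *)
pose F k := if unpickle k is Some i then
  if `[< mu.-negligible (G i) >] then G i else set0 else set0.
have nF : mu.-negligible (\bigcup_k F k).
  apply: negligible_bigcup => k; rewrite /F; case: unpickle => [i|]; last exact: negligible_set0.
  by case: asboolP => // _; exact: negligible_set0.
apply: negligibleS nF => z [Oz Az]; have [r r0 nr] := H z Oz.
have r20 : 0 < r / 2 by rewrite divr_gt0.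
have [k kr] : exists k : nat, k.+1%:R^-1 < r / 2.
  have /cvgrPdist_lt/(_ _ r20)[k _ /(_ k (leqnn k))/=] := @cvg_harmonic R.
  by rewrite sub0r normrN gtr0_norm ?invr_gt0//; exists k.
have k0 : 0 < k.+1%:R^-1 :> R by rewrite invr_gt0.
have [q zq] := rV_rat_approx z k0.
pose i : 'rV[rat]_n * nat := (q, k).
have nG : mu.-negligible (G i).
  apply: negligibleS nr => y [+ Ay]; rewrite rV_ballE /= => qy; split => //; rewrite rV_ballE /=.
  rewrite (splitr r) -(subrK (c i.1) z) -addrA (le_lt_trans (ler_normD _ _))//.
  by rewrite ltrD//; apply: lt_trans kr.
exists (pickle i) => //; rewrite /F pickleK; case: asboolP => // _.
by split => //; rewrite rV_ballE /= distrC.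
Qed.

Lemma open_negligible_near A : open [set z : E | exists2 r, 0 < r & mu.-negligible (ball z r `&` A)].
Proof.
rewrite openE => z [r r0 nr]; have r20 : 0 < r / 2 by rewrite divr_gt0.
apply/nbhs_ballP; exists (r / 2) => //= y zy; exists (r / 2) => //.
apply: negligibleS nr => x [yx Ax]; split => //.
by rewrite (splitr r); exact: ball_triangle zy yx.
Qed.

(** The points around which [A], respectively its complement, is locally negligible form two open
    sets covering Omega. They are disjoint, since a common point would have a ball of measure zero,
    so connectedness leaves only one of them. *)
Lemma connected_zero_one Omega A : open Omega -> connected Omega ->
  (forall z, Omega z -> exists2 r, 0 < r &
     mu.-negligible (ball z r `&` A) \/ mu.-negligible (ball z r `&` ~` A)) ->
  mu.-negligible (Omega `&` A) \/ mu.-negligible (Omega `&` ~` A).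
Proof.
move=> oO cO H.
pose U := [set z : E | exists2 r, 0 < r & mu.-negligible (ball z r `&` A)].
pose W := [set z : E | exists2 r, 0 < r & mu.-negligible (ball z r `&` ~` A)].
have UW : Omega `&` U = Omega `&` ~` W.
  apply/seteqP; split => z [Oz]; last first.
    move=> nW; split => //; have [r r0 [nA|nA]] := H z Oz; first by exists r.
    by exfalso; apply: nW; exists r.
  move=> [r r0 nA]; split => // -[s s0 nA'].
  pose t := Num.min r s.
  have t0 : 0 < t by rewrite lt_min r0.
  have : mu.-negligible (ball z t).
    apply: negligibleS (negligibleU nA nA') => y zy.
    have [Ay|nAy] := pselect (A y); [left|right]; split => //.
      by apply: le_ball zy; rewrite ge_min lexx.
    by apply: le_ball zy; rewrite ge_min lexx orbT.
  have mb : measurable (ball z t) by exact: measurable_rV_ball.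
  move=> /(negligibleP _ mb) b0.
  have ob : open (ball z t) by exact: ball_open.
  by have := @open_lebesgue_rV_gt0 R n _ z ob (ballxx _ t0); rewrite b0 ltxx.
have [[z [Oz Uz]]|nU] := pselect (Omega `&` U !=set0).
  left; apply: negligible_locally => y Oy.
  have OU : Omega `&` U = Omega.
    apply: cO; first by exists z.
    - by exists U => //; exact: open_negligible_near.
    - exists (~` W) => //; apply: open_closedC; exact: open_negligible_near.
  by move: Oy; rewrite -OU => -[].
right; apply: negligible_locally => y Oy.
have [r r0 [nA|nA]] := H y Oy; last by exists r.
by exfalso; apply: nU; exists y; split => //; exists r.
Qed.

Section positivity.
Variables (Omega : set E) (V h Phi : E -> R).
Hypotheses (dO : domain Omega) (hV : L1loc Omega V) (hh : L1loc Omega h)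
  (h_ge0 : {ae mu, forall x, Omega x -> 0 <= h x})
  (hPhi : L1loc Omega Phi)
  (Phi_ge0 : {ae mu, forall x, Omega x -> 0 <= Phi x})
  (hVPhi : L1loc Omega (fun x => V x * Phi x))
  (Phi_super : distr_supersolution Omega V h Phi).

Lemma strong_maximum_principle : ~ {ae mu, forall x, Omega x -> Phi x = 0} ->
  {ae mu, forall x, Omega x -> 0 < Phi x}.
Proof.
move=> Phi_neq0; have [_ oO cO] := dO.
have mO : measurable Omega by exact: open_measurable_rV.
pose P : set E := [set x | Omega x /\ Phi x != 0].
have mP : measurable P.
  have mPhi := hPhi.1 mO _ (measurableC (measurable_set1 (0 : R))).
  rewrite (_ : P = Omega `&` Phi @^-1` (~` [set 0])) //.
  by apply/seteqP; split => x [Ox]; [move=> /eqP|move=> /eqP].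
have local z : Omega z -> exists2 r, 0 < r &
    mu.-negligible (ball z r `&` P) \/ mu.-negligible (ball z r `&` ~` P).
  move=> Oz.
  have /nbhs_ballP[s /= s0 sO] : nbhs z Omega by apply: open_nbhs_nbhs.
  (* Centres within [r] of [z] and kernels of radius below [r] stay in the closed ball of radius 2 r
     < s, which lies in Omega and on which the cutoff is 1. There any bounded bump is dominated by a
     multiple of [xi ^+ 2]. *)
  pose r := s / 3.
  have r0 : 0 < r by rewrite divr_gt0.
  have BO : [set y : E | `|y - z| <= r + r] `<=` Omega.
    move=> y /= yz; apply: sO; rewrite rV_ballE /= distrC (le_lt_trans yz)//.
    by rewrite /r; lra.
  have [xi [bxi cxi xi1]] := cutoff (@compact_rV_le _ _ z (r + r)) oO BO.
  exists r => //.
  have [] := @zero_one_ball P z r r mP r0 r0.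
  - move=> t x i t0 tr xz; pose b := bshift (- x) (nbump t).
    have bE y : beval b y = beval (nbump t) (y - x) by rewrite /b beval_shift.
    have dbE y : beval (bderiv i b) y = beval (bderiv i (nbump t)) (y - x).
      by rewrite /b bderiv_shift beval_shift.
    have near y : `|y - x| <= t -> xi y = 1.
      move=> yx; apply: xi1 => /=; rewrite -(subrK x y) -addrA (le_trans (ler_normD _ _))//.
      by rewrite lerD//; [rewrite (le_trans yx)// ltW|exact: ltW].
    have [C C0 [bC _]] := bounded_lipschitz_beval b.
    under eq_Rintegral do rewrite -dbE.
    apply: (local_positivity_set_derive0 oO hV hh h_ge0 hPhi Phi_ge0 hVPhi Phi_super bxi cxi C0).
      move=> y; have [yx|yx] := leP `|y - x| t; first by rewrite near// expr1n mulr1.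
      rewrite bE nbump_eq0 ?(ltW yx)// normr0.
      by apply: mulr_ge0 => //; exact: sqr_ge0.
    move=> y; rewrite dbE; have [yx|yx] := leP `|y - x| t; first by rewrite near// oner_eq0.
    rewrite (@bderiv_eq0 _ _ (nbump t) t [:: i]) ?eqxx// => w.
    exact: nbump_eq0.
  - have mb : measurable (ball z r) by exact: measurable_rV_ball.
    by move=> H0; left; apply/negligibleP => //; exact: measurableI.
  - have mb : measurable (ball z r) by exact: measurable_rV_ball.
    by move=> H0; right; apply/negligibleP => //; apply: measurableI => //; exact: measurableC.
have [PO|nPO] := connected_zero_one oO cO local.
- exfalso; apply: Phi_neq0; apply: negligibleS PO => x /= nx.
  have Ox : Omega x by apply: contrapT => H; apply: nx => /H.
  by split => //; split => //; apply/eqP => Px; exact: nx.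
- have : {ae mu, forall x, Omega x -> Phi x != 0}.
    apply: negligibleS nPO => x /= nx.
    have Ox : Omega x by apply: contrapT => H; apply: nx => /H.
    by split => // -[_ Px]; exact: nx.
  move=> Phi0; apply: aeS (aeI Phi0 Phi_ge0) => x [x0 xge] Ox.
  by rewrite lt_neqAle eq_sym x0 ?xge.
Qed.

(** The inequality applied to a cutoff equal to 1 on [K] bounds the integral of the nonnegative
    quotient over [K] by a finite number. *)
Lemma L1loc_quotient : {ae mu, forall x, Omega x -> 0 < Phi x} ->
  L1loc Omega (fun x => h x / Phi x).
Proof.
move=> Phi0; have [_ oO _] := dO.
have mO : measurable Omega by exact: open_measurable_rV.
have mq : measurable_fun Omega (fun x => h x / Phi x).
  apply: measurable_funM; first exact: hh.1.
  exact: (measurableT_comp (@measurable_invr R) hPhi.1).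
split => // K cK KO; have [xi [bxi cxi xi1]] := cutoff cK oO KO.
have mK := compact_measurable_rV cK.
have mxi2 : measurable_fun Omega (fun x => xi x ^+ 2).
  by apply: measurable_funTS; apply: measurable_funX; exact: bounded_lipschitz_measurable.
have [_ fin] := local_supersolution_le oO hV hh h_ge0 hPhi Phi_ge0 hVPhi Phi_super Phi0 bxi cxi.
apply/integrableP; split.
  apply/measurable_EFinP; exact: (measurable_funS mO KO mq).
apply: le_lt_trans fin.
have mqxi : measurable_fun Omega (fun x => h x / Phi x * xi x ^+ 2) by exact: measurable_funM.
have -> : (\int[mu]_(x in Omega) (h x / Phi x * xi x ^+ 2)%:E =
    \int[mu]_(x in Omega) `|h x / Phi x * xi x ^+ 2|%:E)%E.
  apply: ae_eq_integral => //; [exact/measurable_EFinP|apply/measurable_EFinP; exact: measurableT_comp|].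
  apply: aeS (aeI h_ge0 Phi0) => x [hx Px] Ox; congr EFin.
  by rewrite ger0_norm// mulr_ge0 ?sqr_ge0// divr_ge0 ?hx// ltW// Px.
have -> : (\int[mu]_(x in K) `|(EFin \o (fun x => h x / Phi x)%R) x| =
    \int[mu]_(x in K) `|h x / Phi x * xi x ^+ 2|%:E)%E.
  by apply: eq_integral => x /set_mem Kx; rewrite xi1// expr1n mulr1.
by apply: ge0_subset_integral => //; apply/measurable_EFinP; exact: measurableT_comp.
Qed.

End positivity.
End strong_maximum_principle.

Theorem theorem7p2 (R : realType) (N : nat) (hN : (1 <= N)%N)
    (Omega : set 'rV[R]_N) (hOmega : domain Omega)
    (V h Phi : 'rV[R]_N -> R)
    (hV : L1loc Omega V)
    (hh : L1loc Omega h)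
    (h_ge0 : {ae lebesgue_rV N, forall x, Omega x -> 0 <= h x})
    (hPhi : L1loc Omega Phi)
    (Phi_ge0 : {ae lebesgue_rV N, forall x, Omega x -> 0 <= Phi x})
    (Phi_neq0 : ~ {ae lebesgue_rV N, forall x, Omega x -> Phi x = 0})
    (hVPhi : L1loc Omega (fun x => V x * Phi x))
    (Phi_super : distr_supersolution Omega V h Phi) :
  (forall xi : 'rV[R]_N -> R, W1infty_c Omega xi ->
     (\int[lebesgue_rV N]_(x in Omega) (h x / Phi x * xi x ^+ 2)%:E
        <= quadratic_form Omega V xi)%E)
  /\ L1loc Omega (fun x => h x / Phi x).
Proof.
have [_ oO _] := hOmega.
have Phi0 := strong_maximum_principle hOmega hV hh h_ge0 hPhi Phi_ge0 hVPhi Phi_super Phi_neq0.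
split; last exact: (L1loc_quotient hOmega hV hh h_ge0 hPhi Phi_ge0 hVPhi Phi_super Phi0).
move=> xi Wxi; have bxi := W1infty_c_bounded_lipschitz oO Wxi.
by have [] := local_supersolution_le oO hV hh h_ge0 hPhi Phi_ge0 hVPhi Phi_super Phi0 bxi Wxi.2.
Qed.
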